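(* Let $X=\{X_n\}_{n\ge 0}$ be a time-homogeneous Markov chain with state space a Borel set $S\subseteq\mathbb{R}$, with arbitrary initial distribution, such that $\limsup_{n\to\infty}X_n=\infty$ almost surely. Let $v>0$ be a decreasing differentiable function such that $xv(x)\to\infty$ and $v'(x)=o(v^2(x))$ as $x\to\infty$. Suppose there exist $b\in(0,\infty)$ and an increasing function $s(x)>0$ with $s(x)=o(1/v(x))$ such that $$m_1^{[s(x)]}(x)\sim v(x),\qquad m_2^{[s(x)]}(x)\to b\qquad\text{as }x\to\infty.$$ Assume also that $$\mathbb{P}\{|\xi(y)|\ge s(y)\}\le p(y)v(y)\quad\text{for all }y\ge0,$$ where $p$ is a non-increasing, non-negative function that is integrable at infinity, and that there is a random variable $\widehat\xi$ with $\mathbb{E}\widehat\xi^{\,2}<\infty$ such that $|\xi(y)|\,\mathbb{I}\{|\xi(y)|<s(y)\}\le_{\rm st}\widehat\xi$ for all $y\ge 0$. Assume further that there is a random variable $\xi$ such that $\xi(x)\Rightarrow\xi$ (convergence in distribution) as $x\to\infty$, and a random variable $\Xi$ with $\mathbb{E}\,\Xi<\infty$ such that $|\xi(x)|\le_{\rm st}\Xi$ for all $x$. Then: (a) if $\xi$ is non-lattice, for every $h>0$, $$H(x,x+h]\sim\frac{h}{v(x)}\qquad\text{as }x\to\infty;$$ (b) if the chain $X_n$ is integer valued and $\mathbb{Z}$ is the minimal lattice for $\xi$, $$H\{k\}\sim\frac{1}{v(k)}\qquad\text{as }k\to\infty.$$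
   Context: For a time-homogeneous Markov chain $X_n$ with state space a Borel set $S\subseteq\mathbb{R}$, $\xi(x)$ denotes a random variable with the distribution of the jump of the chain from state $x\in S$, i.e. $\mathbb{P}\{\xi(x)\in B\}=\mathbb{P}\{X_{n+1}-X_n\in B\mid X_n=x\}$ for Borel $B\subseteq\mathbb{R}$. All conditions involving $\xi(x)$ are understood for $x\in S$. For $s>0$, the $s$-truncated $k$th moment of the jump is $m_k^{[s]}(x):=\mathbb{E}\{\xi^k(x);\ |\xi(x)|\le s\}$, where $\mathbb{E}\{Y;A\}$ means $\mathbb{E}[Y\mathbb{I}_A]$. For random variables, $\xi\le_{\rm st}\eta$ means $\mathbb{P}\{\xi>t\}\le\mathbb{P}\{\eta>t\}$ for all $t\in\mathbb{R}$. The renewal measure (Green function) of the chain is $H(B):=\sum_{n=0}^\infty\mathbb{P}\{X_n\in B\}$ for Borel $B\subseteq\mathbb{R}$. $f\sim g$ means $f/g\to1$. *)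

(* Defs.v *)
From HB Require Import structures.
From mathcomp Require Import all_boot all_order all_algebra.
From mathcomp Require Import all_classical all_reals all_analysis.

Set Implicit Arguments.
Unset Strict Implicit.
Unset Printing Implicit Defensive.

Import Order.TTheory GRing.Theory Num.Theory.
Import numFieldNormedType.Exports.

Local Open Scope classical_set_scope.
Local Open Scope ring_scope.

(* Lets the Landau notation [f =o_ +oo g] typecheck. *)
Canonical pinfty_filter_on (R : realType) : filter_on R :=
  FilterType (pinfty_nbhs R) (@filter_filter _ _ (@proper_pinfty_nbhs R)).

Section Chain.
Context {R : realType} {d : measure_display} {Omega : measurableType d}.
Variable P : probability Omega R.

Definition natural_filtration (X : nat -> {RV P >-> R}) (n : nat) :
    set (set Omega) :=
  <<s [set A | exists i B,
        [/\ (i <= n)%N, measurable B & A = X i @^-1` B] ] >>.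

(* [Q x] is the law of the next state from [x].
   [Q] is a kernel on the whole line, but only its values at points of [S] are
   constrained or used. The last clause says that [Q (X n) B] is a version of
   the conditional probability of [X n.+1 \in B] given [X 0, ..., X n]; the
   law of [X 0] is unconstrained. *)
Definition markov_chain (S : set R) (Q : R.-pker R ~> R)
    (X : nat -> {RV P >-> R}) : Prop :=
  [/\ measurable S,
      forall x, S x -> Q x S = 1%E,
      forall n w, S (X n w) &
      forall n A B, natural_filtration X n A -> measurable B ->
        P (A `&` X n.+1 @^-1` B) = (\int[P]_(w in A) Q (X n w) B)%E].

Definition renewal_measure (X : nat -> {RV P >-> R}) (B : set R) : \bar R :=
  (\sum_(0 <= n <oo) P (X n @^-1` B))%E.

Definition on_lattice (xi : {RV P >-> R}) (L : set R) : Prop :=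
  P (xi @^-1` L) = 1%E.

End Chain.

(* The jump [xi(x)] is the random variable [y |-> y - x] on the probability
   space [(R, Q x)]. *)
Definition jump {R : realType} (x y : R) : R := y - x.

Definition truncated_moment {R : realType} (Q : R.-pker R ~> R)
    (k : nat) (s x : R) : R :=
  \int[Q x]_(y in [set y | `|jump x y| <= s]) jump x y ^+ k.

Definition st_le {R : realType} {d1 d2 : measure_display}
    {T1 : measurableType d1} {T2 : measurableType d2}
    (P1 : {measure set T1 -> \bar R}) (X1 : T1 -> R)
    (P2 : {measure set T2 -> \bar R}) (X2 : T2 -> R) : Prop :=
  forall t : R, (P1 [set w | t < X1 w]%R <= P2 [set w | t < X2 w]%R)%E.

(* Restricting the limit to [S]: "as x tends to infinity" for quantities that
   are only defined at states. *)
Definition pinfty_in {R : realType} (S : set R) : set_system R :=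
  within S (pinfty_nbhs R).

Definition jump_cvg_in_distribution {R : realType} (S : set R)
    (Q : R.-pker R ~> R) {d : measure_display} {T : measurableType d}
    (P : probability T R) (xi : {RV P >-> R}) : Prop :=
  forall f : R -> R, continuous f -> (exists M, forall u, `|f u| <= M) ->
    (\int[Q x]_y f (jump x y)) @[x --> pinfty_in S]
      --> \int[P]_w f (xi w).

(* Lattices are the subgroups [a Z] of the line, without shift, as is usual in
   renewal theory. *)
Definition lattice {R : realType} (a : R) : set R :=
  range (fun k : int => k%:~R * a).

Definition non_lattice {R : realType} {d : measure_display}
    {T : measurableType d} (P : probability T R) (xi : {RV P >-> R}) : Prop :=
  ~ exists2 a : R, 0 < a & on_lattice xi (lattice a).

Definition minimal_lattice {R : realType} {d : measure_display}
    {T : measurableType d} (P : probability T R) (xi : {RV P >-> R})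
    (a : R) : Prop :=
  on_lattice xi (lattice a) /\
  forall c : R, 0 < c -> on_lattice xi (lattice c) ->
    lattice c `<=` lattice a -> lattice c = lattice a.

Definition integrable_at_infinity {R : realType} (p : R -> R) : Prop :=
  exists a : R, lebesgue_measure.-integrable `[a, +oo[ (EFin \o p).

(* Main.v *)
(* Let [f_x y = exp (- k * theta (y - x))] with [k = 2 * v x / b], where [theta]
   is a C^2 cubic spline vanishing left of [-L], equal to the identity right of
   [L], and whose second derivative is [1 / L] times the tent of half-width [L].
   A Taylor expansion of the transition operator gives
   [f_x y - E f_x (y + xi y) = v x / L * tent L (y - x) + error]. Summing along
   the chain, the left-hand side telescopes to [1 - o(1)] (the chain is
   transient), and the accumulated error is at most [e] times the supremum over
   [x] of the quantity [v x / L * H (tent L (. - x))] to be estimated, so it can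
   be absorbed: this quantity is [1 + O(e)] for some large [L].
   To descend to a fixed width [dl], put [u x = v x * H (tent dl (. - x))]. The
   renewal equation and the convergence of the jumps give [u x ~ E u (x - xi)];
   a maximum principle, as in the Choquet-Deny theorem, then yields
   [u x - u (x - a) -> 0] for [a] in the support of [xi], hence for [a] in the
   closed subgroup it generates. If [dl] lies in that subgroup, writing the tent
   of half-width [m * dl] as an average of translates of the tent of half-width
   [dl] gives [u x -> dl]. Intervals are sandwiched between sums of tents, and
   on integers [tent 1] is the indicator of [0]. *)
Require Import Defs.
From HB Require Import structures.
From mathcomp Require Import all_boot all_order all_algebra.
From mathcomp Require Import all_classical all_reals all_analysis.
From mathcomp Require Import measurable_realfun random_variable ring lra.

Set Implicit Arguments.
Unset Strict Implicit.
Unset Printing Implicit Defensive.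

Import Order.TTheory GRing.Theory Num.Theory.
Import numFieldNormedType.Exports.

Local Open Scope classical_set_scope.
Local Open Scope ring_scope.

(** * Splines and tents *)

Section Spline.
Context {R : realType}.
Implicit Types (z u w L : R).

(** With k = 2 v(x) / b, the function exp (- k z) is annihilated to second order by jumps of mean
    v(x) and second moment b, since k v(x) = k^2 b / 2. Right of x the leading terms thus cancel up
    to the variation of v, and v' = o(v^2) says that 1 / v has small slope, so v hardly moves on the
    scale 1 / k. Left of x the function is constant: only the bend of [theta] contributes. Two
    obstacles shape the bootstrap. Errors are summed against the measure being estimated, not known
    to be locally finite, so absorption is done for the Green measure of the first N steps, with
    bounds free of N. And no drift estimate holds below a level A: there the test function is at
    first frozen at its value in A, which gives low states a favourable sign. The resulting upper
    bound makes the crossings from below A summable, hence transience, and only then does the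
    unfrozen function give both bounds. Errors are summed over blocks of length L: integrability of
    p handles large jumps, and the second moment of xihat makes truncated first moments beyond a
    distance summable over a grid of distances. *)

Definition pos (z : R) := Num.max 0 z.

Lemma posP z : (0 <= z /\ pos z = z) \/ (z <= 0 /\ pos z = 0).
Proof.
rewrite /pos; have [h|h] := leP 0 z; [left|right]; split => //.
exact: ltW.
Qed.

(** A second difference of truncated cubes, so that [spline1] and [spline2] are its first two
    derivatives and [spline2] is the tent of half-width 1. *)
Definition spline z := (pos (z + 1) ^+ 3 - 2 * pos z ^+ 3 + pos (z - 1) ^+ 3) / 6.
Definition spline1 z := (pos (z + 1) ^+ 2 - 2 * pos z ^+ 2 + pos (z - 1) ^+ 2) / 2.
Definition spline2 z := pos (z + 1) - 2 * pos z + pos (z - 1).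

Lemma pos_id z : 0 <= z -> pos z = z.
Proof. by move=> h; rewrite /pos max_r. Qed.
Lemma pos_0 z : z <= 0 -> pos z = 0.
Proof. by move=> h; rewrite /pos max_l. Qed.

Lemma splineA z : z <= -1 -> spline z = 0.
Proof. by move=> h; rewrite /spline !pos_0; [ring|lra|lra|lra]. Qed.
Lemma splineB z : -1 <= z -> z <= 0 -> spline z = (z + 1) ^+ 3 / 6.
Proof. by move=> h h'; rewrite /spline pos_id ?(@pos_0 z) ?(@pos_0 (z - 1)); [ring|lra|lra|lra]. Qed.
Lemma splineC z : 0 <= z -> z <= 1 -> spline z = z + (1 - z) ^+ 3 / 6.
Proof. by move=> h h'; rewrite /spline pos_id ?(@pos_id z) ?(@pos_0 (z - 1)); [field|lra|lra|lra]. Qed.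
Lemma splineD z : 1 <= z -> spline z = z.
Proof. by move=> h; rewrite /spline !pos_id; [field|lra|lra|lra]. Qed.

(** The derivative lies in [0, 1]. The bound is checked algebraically on the four polynomial pieces
    and glued at -1, 0 and 1. *)
Lemma spline_step z w : z <= w -> 0 <= spline w - spline z <= w - z.
Proof.
pose D (z w : R) := 0 <= spline w - spline z <= w - z.
have glue a : (forall z w, z <= w -> w <= a -> D z w) ->
    (forall z w, a <= z -> z <= w -> D z w) -> forall z w, z <= w -> D z w.
  move=> h1 h2 {}z {}w zw.
  have [wa|aw] := leP w a; first exact: h1.
  have [az|za] := leP a z; first exact: h2.
  have := h1 z a (ltW za) (lexx _); have := h2 a w (lexx _) (ltW aw).
  rewrite /D; lra.
suff : forall z w, z <= w -> D z w by apply.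
have p3 (a b : R) : 0 <= a -> a <= b -> b <= 1 -> 0 <= b ^+ 3 - a ^+ 3 <= 3 * (b - a).
  move=> a0 ab b1; have -> : b ^+ 3 - a ^+ 3 = (b - a) * (b ^+ 2 + a * b + a ^+ 2) by ring.
  have q0 : 0 <= b ^+ 2 + a * b + a ^+ 2 by nra.
  have q3 : b ^+ 2 + a * b + a ^+ 2 <= 3 by nra.
  have ba : 0 <= b - a by lra.
  by rewrite mulr_ge0 //= mulrC ler_wpM2r.
have c1 x y : x <= y -> y <= -1 -> D x y.
  by move=> xy y1; rewrite /D !splineA; lra.
have c2 x y : -1 <= x -> x <= y -> y <= 0 -> D x y.
  move=> x1 xy y1; rewrite /D !splineB; [|lra..].
  have := @p3 (x + 1) (y + 1); lra.
have c3 x y : 0 <= x -> x <= y -> y <= 1 -> D x y.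
  move=> x1 xy y1; rewrite /D !splineC; [|lra..].
  have := @p3 (1 - y) (1 - x); lra.
have c4 x y : 1 <= x -> x <= y -> D x y.
  by move=> xy y1; rewrite /D !splineD; lra.
apply: (glue 0) => x y.
- move=> xy y0; have [h|h] := leP y (-1); first exact: c1.
  have [h'|h'] := leP x (-1); last by apply: c2 => //; exact: ltW.
  have := c1 x (-1) h' (lexx _); have := c2 (-1) y (lexx _) (ltW h) y0.
  rewrite /D; lra.
- move=> x0 xy; have [h|h] := leP y 1; first exact: c3.
  have [h'|h'] := leP 1 x; first exact: c4.
  have := c3 x 1 x0 (ltW h') (lexx _); have := c4 1 y (lexx _) (ltW h).
  rewrite /D; lra.
Qed.

Lemma spline_ge0 z : 0 <= spline z.
Proof.
have [h|h] := leP z (-1); first by rewrite splineA.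
have := spline_step (ltW h); rewrite (splineA (lexx _)); lra.
Qed.

Lemma spline_lip z u : `|spline (z + u) - spline z| <= `|u|.
Proof.
have [h|h] := leP 0 u.
  have : z <= z + u by lra.
  move=> /spline_step; rewrite (ger0_norm h) => ?; rewrite ger0_norm; lra.
have : z + u <= z by lra.
move=> /spline_step; rewrite (ltr0_norm h) => ?; rewrite ler0_norm; lra.
Qed.

Lemma spline2_tent z : spline2 z = pos (1 - `|z|).
Proof.
rewrite /spline2; have [h|h] := leP 0 z.
  rewrite ger0_norm // (@pos_id z) // (@pos_id (z + 1)); last lra.
  have [h'|h'] := leP z 1; first by rewrite pos_0 ?pos_id; lra.
  by rewrite pos_id ?pos_0; lra.
rewrite ltr0_norm // (@pos_0 z) // ?(@pos_0 (z - 1)); [|lra..].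
by rewrite opprK addr0 mulr0 subr0 addrC.
Qed.

Lemma spline2_itv z : 0 <= spline2 z <= 1.
Proof.
rewrite spline2_tent; case: (posP (1 - `|z|)) => -[h ->]; have := normr_ge0 z; lra.
Qed.

Lemma spline1_itv z : 0 <= spline1 z <= 1.
Proof.
rewrite /spline1.
have [h|h] := leP z (-1); first by rewrite !pos_0; lra.
have [h2|h2] := leP z 0; first by rewrite pos_id ?(@pos_0 z) ?(@pos_0 (z - 1)); nra.
have [h3|h3] := leP z 1; first by rewrite pos_id ?(@pos_id z) ?(@pos_0 (z - 1)); nra.
rewrite !pos_id; nra.
Qed.

(** The third derivative of the truncated cube is 0 or 6, whence the constant 1 in front of the
    cubic remainder. In each sign pattern the left side is a cube, a difference of two cubes, or
    zero. *)
Lemma pos_taylor z u :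
  `|pos (z + u) ^+ 3 - pos z ^+ 3 - 3 * pos z ^+ 2 * u - 3 * pos z * u ^+ 2| <= `|u| ^+ 3.
Proof.
case: (posP (z + u)) => -[h1 ->]; case: (posP z) => -[h2 ->].
- rewrite [X in `|X|](_ : _ = u ^+ 3); last by ring.
  by rewrite normrX.
- rewrite [X in `|X|](_ : _ = (z + u) ^+ 3); last by ring.
  rewrite normrX lerXn2r ?nnegrE //; rewrite !ger0_norm; lra.
- rewrite [X in `|X|](_ : _ = (- (z + u)) ^+ 3 - (- u) ^+ 3); last by ring.
  have h3 : 0 <= (- (z + u)) ^+ 3 by rewrite exprn_ge0; lra.
  have h4 : (- (z + u)) ^+ 3 <= (- u) ^+ 3 by rewrite lerXn2r ?nnegrE; lra.
  rewrite (@ler0_norm _ u) ?ler0_norm; lra.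
- rewrite [X in `|X|](_ : _ = 0); last by ring.
  by rewrite normr0 exprn_ge0.
Qed.

(** Cubic for short jumps, quadratic for long ones. The minimum is what makes the remainder small
    after rescaling: u^2 min(|u| / L, 1) has a small mean for large L under a mere second-moment
    domination. *)
Lemma spline_taylor z u :
  `|spline (z + u) - spline z - spline1 z * u - spline2 z * u ^+ 2 / 2|
   <= 3 * u ^+ 2 * Num.min `|u| 1.
Proof.
have u2 : 0 <= u ^+ 2 by exact: sqr_ge0.
have nu : 0 <= `|u| by [].
have nu2 : `|u| ^+ 2 = u ^+ 2 by rewrite -normrX ger0_norm.
have [h|h] := leP `|u| 1.
  have := pos_taylor (z + 1) u; have := pos_taylor z u; have := pos_taylor (z - 1) u.
  rewrite /spline /spline1 /spline2 !(addrAC z _ u).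
  have -> : `|u| ^+ 3 = u ^+ 2 * `|u| by rewrite exprSr nu2.
  have : 0 <= u ^+ 2 * `|u| by exact: mulr_ge0.
  move: (pos (z + u + 1)) (pos (z + u)) (pos (z + u - 1)) (pos (z + 1)) (pos z) (pos (z - 1)).
  move=> a b c a' b' c' q; rewrite !ler_norml => /andP[] h1 h2 /andP[] h3 h4 /andP[] h5 h6.
  by apply/andP; split; lra.
have := spline_lip z u; have := spline1_itv z; have := spline2_itv z.
rewrite mulr1 !ler_norml => /andP[a1 a2] /andP[b1 b2] /andP[c1 c2].
have un : `|u| <= u ^+ 2 by rewrite -nu2 expr2; nra.
have : `|spline1 z * u| <= `|u|.
  rewrite normrM ger0_norm // -[leRHS]mul1r; exact: ler_wpM2r.
rewrite ler_norml => /andP[d1 d2].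
have e1 : 0 <= spline2 z * u ^+ 2 by exact: mulr_ge0.
have e2 : spline2 z * u ^+ 2 <= u ^+ 2 by rewrite -[leRHS]mul1r; exact: ler_wpM2r.
apply/andP; split; lra.
Qed.

(* The spline rescaled to width [L]: it vanishes left of [-L], is the identity
   right of [L], and its second derivative is the tent of half-width [L] and
   mass 1. *)
Definition theta L z := L * spline (z / L).
Definition theta1 L z := spline1 (z / L).
Definition tent L z := pos (1 - `|z| / L).

Section scaled.
Variables (L : R).
Hypothesis L0 : 0 < L.

Lemma theta_left z : z <= - L -> theta L z = 0.
Proof. by move=> h; rewrite /theta splineA ?mulr0 // ler_pdivrMr // mulN1r. Qed.
Lemma theta_right z : L <= z -> theta L z = z.
Proof.
move=> h; rewrite /theta splineD ?ler_pdivlMr ?mul1r //.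
by rewrite mulrC divfK // gt_eqF.
Qed.
Lemma theta_step z w : z <= w -> 0 <= theta L w - theta L z <= w - z.
Proof.
move=> h; rewrite /theta -mulrBr; have : z / L <= w / L by rewrite ler_pM2r ?invr_gt0.
move=> /spline_step /andP[h1 h2]; apply/andP; split; first by rewrite mulr_ge0 // ltW.
have : L * (spline (w / L) - spline (z / L)) <= L * (w / L - z / L) by rewrite ler_pM2l.
by rewrite (_ : L * (w / L - z / L) = w - z) //; field; rewrite gt_eqF.
Qed.
Lemma theta_lip z u : `|theta L (z + u) - theta L z| <= `|u|.
Proof.
have [h|h] := leP 0 u.
  have : z <= z + u by lra.
  move=> /theta_step; rewrite (ger0_norm h) => ?; rewrite ger0_norm; lra.
have : z + u <= z by lra.
move=> /theta_step; rewrite (ltr0_norm h) => ?; rewrite ler0_norm; lra.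
Qed.
Lemma theta_ge0 z : 0 <= theta L z.
Proof. by rewrite /theta mulr_ge0 ?spline_ge0 // ltW. Qed.
Lemma theta_le_pos z : theta L z <= pos (z + L).
Proof.
have [h|h] := leP z (- L); first by rewrite theta_left // /pos le_max lexx.
have := theta_step (ltW h); rewrite (theta_left (lexx _)) pos_id; lra.
Qed.
Lemma theta_ge z : z <= theta L z.
Proof.
have [h|h] := leP L z; first by rewrite theta_right.
have := theta_step (ltW h); rewrite (theta_right (lexx _)); lra.
Qed.
Lemma theta1_itv z : 0 <= theta1 L z <= 1.
Proof. exact: spline1_itv. Qed.
Lemma tent_itv z : 0 <= tent L z <= 1.
Proof.
rewrite /tent; case: (posP (1 - `|z| / L)) => -[h ->] //; last by rewrite lexx ler01.
have : 0 <= `|z| / L by rewrite divr_ge0 // ltW. lra.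
Qed.
Lemma theta_taylor z u :
  `|theta L (z + u) - theta L z - theta1 L z * u - tent L z / L * u ^+ 2 / 2|
   <= 3 * u ^+ 2 / L * Num.min (`|u| / L) 1.
Proof.
have := spline_taylor (z / L) (u / L); rewrite -mulrDl spline2_tent.
rewrite !normrM normfV (gtr0_norm L0) -/(tent L z) -/(theta1 L z).
set s := (X in `|X|) => hs.
rewrite [X in `|X|](_ : _ = L * s); last first.
  by rewrite /s /theta; field; rewrite gt_eqF.
rewrite normrM (gtr0_norm L0).
rewrite (_ : 3 * u ^+ 2 / L * _ = L * (3 * (u / L) ^+ 2 * Num.min (`|u| / L) 1)); last first.
  by field; rewrite gt_eqF.
by rewrite ler_pM2l.
Qed.
Lemma tent_out z : L <= `|z| -> tent L z = 0.
Proof. by move=> h; rewrite /tent pos_0 // subr_le0 ler_pdivlMr // mul1r. Qed.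
End scaled.
End Spline.

(** * Exponential bounds *)

Section ExpBounds.
Context {R : realType}.
Implicit Types x u t : R.

Lemma deriv_ge0_ge0 (F dF : R -> R) : (forall x, is_derive x 1 F (dF x)) ->
  (forall x, 0 <= x -> 0 <= dF x) -> F 0 = 0 -> forall x, 0 <= x -> 0 <= F x.
Proof.
move=> hF hd F0 x x0.
have cF : {within `[0, x], continuous F}.
  apply: continuous_subspaceT => y.
  by apply: differentiable_continuous; apply/derivable1_diffP; case: (hF y).
have [c] := MVT_segment x0 (fun y _ => hF y) cF.
by rewrite F0 !subr0 in_itv /= => /andP[c0 _] ->; rewrite mulr_ge0 // hd.
Qed.

Lemma expR_taylor1 u : `|u| <= 2^-1 -> `|1 - expR (- u) - u| <= 2 * u ^+ 2.
Proof.
rewrite ler_norml => /andP[u1 u2].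
have h1 := expR_ge1Dx (- u).
have h2 : expR (- u) <= (1 + u)^-1.
  rewrite expRN lef_pV2 ?posrE ?expR_gt0 ?expR_ge1Dx //; lra.
have h3 : (1 + u)^-1 <= 1 - u + 2 * u ^+ 2.
  rewrite -div1r ler_pdivrMr; last lra.
  have : 0 <= u ^+ 2 * (1 + 2 * u) by rewrite mulr_ge0 ?sqr_ge0 //; lra.
  by move=> ?; nra.
by rewrite ler_norml; apply/andP; split; nra.
Qed.

Lemma expR_taylor2_pos x : 0 <= x -> 0 <= expR x - 1 - x - x ^+ 2 / 2.
Proof.
move=> x0; pose F : R -> R := expR - cst 1 - id - (id * id) * cst 2^-1.
suff h : 0 <= F x by move: h; rewrite /F !fctE /= /cst; lra.
refine (@deriv_ge0_ge0 F (fun x => expR x - 1 - x) _ _ _ x x0).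
- move=> y; rewrite /F; apply: is_derive_eq; rewrite /GRing.scale /= /cst !fctE /=; by field.
- by move=> y y0; have := expR_ge1Dx y; lra.
- by rewrite /F !fctE /= ?oppr0 expR0 /cst; ring.
Qed.

(** (1 + x + x^2 / 2)(1 - x + x^2 / 2) = 1 + x^4 / 4 >= 1, so the lower bound on [expR x] inverts
    into an upper bound on [expR (- x)]. *)
Lemma expR_taylor2_neg x : 0 <= x -> 0 <= 1 - x + x ^+ 2 / 2 - expR (- x).
Proof.
move=> x0; have h := expR_taylor2_pos x0; have q0 : 0 < expR x by exact: expR_gt0.
have x4 : 0 <= x ^+ 4 by exact: exprn_ge0.
have s0 : 0 <= 1 - x + x ^+ 2 / 2 by have := sqr_ge0 (x - 1); lra.
have h2 : 1 + x + x ^+ 2 / 2 <= expR x by lra.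
rewrite subr_ge0 expRN -div1r ler_pdivrMr //.
by apply: le_trans (ler_wpM2l s0 h2); lra.
Qed.

(* The derivative of [1 - expR x * (1 - x + x ^+ 2 / 2 - x ^+ 3)] is
   [expR x * (5 / 2 * x ^+ 2 + x ^+ 3)]. *)
Lemma expR_taylor3_neg x : 0 <= x -> 0 <= expR (- x) - (1 - x + x ^+ 2 / 2 - x ^+ 3).
Proof.
move=> x0; pose q : R -> R := cst 1 - id + (id * id) * cst 2^-1 - id * id * id.
pose F : R -> R := cst 1 - expR * q.
have h : 0 <= F x.
  refine (@deriv_ge0_ge0 F (fun x => expR x * (5 / 2 * x ^+ 2 + x ^+ 3)) _ _ _ x x0).
  - move=> y; pose i := is_derive_id y (1 : R); pose c (k : R) := is_derive_cst k y (1 : R).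
    have dq := is_deriveB (is_deriveD (is_deriveB (c 1) i) (is_deriveM (is_deriveM i i) (c 2^-1)))
      (is_deriveM (is_deriveM i i) i).
    have dF := is_deriveB (c 1) (is_deriveM (is_derive_expR y) dq).
    apply: (@is_derive_eq _ _ _ _ _ _ _ _ dF).
    by rewrite /GRing.scale /= /cst !fctE /=; field.
  - by move=> y y0; rewrite mulr_ge0 ?expR_ge0 // addr_ge0 ?mulr_ge0 ?exprn_ge0 // divr_ge0.
  - by rewrite /F /q !fctE /= /cst expR0; lra.
have q0 : 0 < expR x by exact: expR_gt0.
have {}h : expR x * (1 - x + x ^+ 2 / 2 - x ^+ 3) <= 1.
  by move: h; rewrite /F /q !fctE /= /cst; lra.
by rewrite subr_ge0 expRN -[leRHS]div1r ler_pdivlMr // mulrC.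
Qed.

Lemma expR_taylor3_pos x : 0 <= x -> 0 <= x ^+ 3 * expR x - (expR x - 1 - x - x ^+ 2 / 2).
Proof.
move=> x0; pose F : R -> R := (id * id * id) * expR - (expR - cst 1 - id - (id * id) * cst 2^-1).
suff h : 0 <= F x by move: h; rewrite /F !fctE /= /cst; lra.
refine (@deriv_ge0_ge0 F (fun x => (3 * x ^+ 2 + x ^+ 3 - 1) * expR x + 1 + x) _ _ _ x x0).
- move=> y; rewrite /F; apply: is_derive_eq; rewrite /GRing.scale /= /cst !fctE /=; by field.
(* The derivative is nonnegative because (1 - y^2) exp y <= 1 + y, a consequence of 1 - y <= exp (-
   y). *)
- move=> y y0; have h := expR_ge1Dx (- y); have e0 := expR_gt0 y.
  have h1 : expR y * (1 - y) <= 1.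
    by rewrite -[leRHS](expRxMexpNx_1 y) ler_pM2l.
  have h2 := expR_ge1Dx y.
  have h3 : y * (expR y * (1 - y)) <= y by rewrite -[leRHS]mulr1 ler_wpM2l.
  have y2 : 0 <= y ^+ 2 * expR y by rewrite mulr_ge0 ?sqr_ge0 ?expR_ge0.
  have y3 : 0 <= y ^+ 3 * expR y by rewrite mulr_ge0 ?exprn_ge0 ?expR_ge0.
  nra.
- by rewrite /F !fctE /= ?oppr0 expR0 /cst; ring.
Qed.

Lemma expR_taylor2 u :
  `|1 - expR (- u) - u + u ^+ 2 / 2| <= `|u| ^+ 3 * expR `|u|.
Proof.
have [u0|u0] := leP 0 u.
  rewrite (ger0_norm u0).
  have h1 := expR_taylor2_neg u0; have h2 := expR_taylor3_neg u0.
  have h3 : 1 <= expR u by rewrite -expR0 ler_expR.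
  have u3 : 0 <= u ^+ 3 by exact: exprn_ge0.
  have : u ^+ 3 <= u ^+ 3 * expR u by rewrite -[leLHS]mulr1 ler_wpM2l.
  move=> h4; rewrite ler_norml; apply/andP; split; lra.
rewrite (ltr0_norm u0); have u0' : 0 <= - u by lra.
have h1 := expR_taylor2_pos u0'; have h2 := expR_taylor3_pos u0'.
have -> : u ^+ 2 = (- u) ^+ 2 by rewrite sqrrN.
by rewrite ler_norml; apply/andP; split; lra.
Qed.

Lemma expR_sub_le x u : 0 <= u -> 0 <= expR (- x) - expR (- (x + u)) <= expR (- x) * u.
Proof.
move=> u0; rewrite opprD expRD.
have h := expR_ge1Dx (- u); have e0 := expR_gt0 (- x).
have h1 : expR (- u) <= 1 by rewrite expR_le1 oppr_le0.
have -> : expR (- x) - expR (- x) * expR (- u) = expR (- x) * (1 - expR (- u)) by ring.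
rewrite mulr_ge0 /=; [|exact: ltW|lra].
rewrite ler_pM2l //; lra.
Qed.

(** From 1 + t <= 8 (1 + t / 8) and (1 + t / 8)^4 <= exp (t / 2). The fourth power pays for one
    factor 1 + k z of growth in the errors and leaves a decay (1 + k z)^-3. *)
Definition decay_const : R := 8 ^+ 4.

Lemma decay_const_ge0 : 0 <= decay_const.
Proof. by rewrite /decay_const exprn_ge0. Qed.

Lemma expR_poly_decay t : 0 <= t -> expR (- (t / 2)) * (1 + t) ^+ 4 <= decay_const.
Proof.
move=> t0; have h : 1 + t / 8 <= expR (t / 8) := expR_ge1Dx _.
have h1 : (1 + t / 8) ^+ 4 <= expR (t / 2).
  have -> : t / 2 = t / 8 * 4%:R by lra.
  rewrite expRM_natr lerXn2r ?nnegrE ?expR_ge0 //; lra.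
have h2 : (1 + t) ^+ 4 <= decay_const * (1 + t / 8) ^+ 4.
  rewrite /decay_const -exprMn lerXn2r ?nnegrE; lra.
rewrite expRN mulrC ler_pdivrMr ?expR_gt0 // (le_trans h2) //.
by rewrite ler_wpM2l // decay_const_ge0.
Qed.

End ExpBounds.

(** * Integration lemmas *)

Section Integrals.
Context {R : realType} d (T : measurableType d).

Lemma bounded_integrable (mu : {measure set T -> \bar R}) (D : set T) (f : T -> R) (M : R) :
  measurable D -> (mu D < +oo)%E -> measurable_fun D f ->
  (forall x, D x -> `|f x| <= M) -> mu.-integrable D (EFin \o f).
Proof.
move=> mD fD mf hf; apply: measurable_bounded_integrable => //.
exists M; split; first exact: num_real.
by move=> x Mx y Dy /=; rewrite (le_trans (hf _ Dy)) // ltW.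
Qed.

Lemma EFin_Rintegral (mu : {measure set T -> \bar R}) (D : set T) (f : T -> R) :
  measurable D -> mu.-integrable D (EFin \o f) ->
  (\int[mu]_(x in D) f x)%:E = (\int[mu]_(x in D) (f x)%:E)%E.
Proof.
move=> mD hf; rewrite /Rintegral fineK //.
exact: integrable_fin_num.
Qed.

(** On each block the integrand is at most [c j] and the mass at most [m j]. All error sums go
    through this: the Green measure is only known through the masses of windows. *)
Lemma block_integral (mu : {measure set T -> \bar R}) (D : set T) (e : T -> R)
    (B : nat -> set T) (c m : nat -> R) (C : R) :
  measurable D -> measurable_fun D e -> (forall j, measurable (B j)) ->
  trivIset setT B -> D `<=` \bigcup_j B j ->
  (forall y, D y -> 0 <= e y) ->
  (forall j y, D y -> B j y -> e y <= c j) ->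
  (forall j, 0 <= c j) ->
  (forall j, (mu (D `&` B j) <= (m j)%:E)%E) ->
  (forall J, \sum_(j < J) c j * m j <= C) ->
  (\int[mu]_(y in D) (e y)%:E <= C%:E)%E.
Proof.
move=> mD me mB tB DB e0 ec c0 Bm hC.
have DE : D = \bigcup_j (D `&` B j).
  by rewrite -setI_bigcupr; apply/esym/setIidPl.
have mDB j : measurable (D `&` B j) by exact: measurableI.
rewrite DE ge0_integral_bigcup //.
- apply: (@le_trans _ _ (\sum_(j <oo) (c j * m j)%:E)%E).
    apply: lee_nneseries => [j _ _|j _].
      by apply: integral_ge0 => y [Dy _]; rewrite lee_fin e0.
    apply: (@le_trans _ _ (\int[mu]_(y in D `&` B j) (c j)%:E)%E).
      apply: ge0_le_integral => //.
      - by move=> y [Dy _]; rewrite lee_fin e0.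
      - by apply/measurable_EFinP; apply: measurable_funS me => // y [].
      - by move=> y [Dy By]; rewrite lee_fin ec.
    by rewrite integral_cst // EFinM lee_wpmul2l // lee_fin.
  have m0 j : 0 <= m j by rewrite -lee_fin (le_trans _ (Bm j)).
  apply: lime_le.
    by apply: is_cvg_nneseries => j _ _; rewrite lee_fin mulr_ge0.
  by apply: nearW => J; rewrite sumEFin lee_fin big_mkord.
- by rewrite -DE; apply/measurable_EFinP.
- by move=> y; rewrite -DE => /e0; rewrite lee_fin.
- move=> i j _ _ [y [[_ Bi] [_ Bj]]]; apply: tB => //.
  by exists y.
Qed.

End Integrals.

Section BoundedMeasurable.
Context {R : realType} d (T : measurableType d).
Implicit Types (D : set T) (f g : T -> R).

(** Measurability is global but boundedness only on D, so that one function serves both on the whole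
    space and on the small-jump event, where it becomes bounded. *)
Definition bmeas D f := measurable_fun setT f /\ exists M, forall x, D x -> `|f x| <= M.

Lemma bmeasI D f M : measurable_fun setT f -> (forall x, D x -> `|f x| <= M) -> bmeas D f.
Proof. by move=> mf h; split => //; exists M. Qed.

Lemma bmeas_cst D (c : R) : bmeas D (fun=> c).
Proof. by split; [exact: measurable_cst|exists `|c|]. Qed.

Lemma bmeasD D f g : bmeas D f -> bmeas D g -> bmeas D (fun x => f x + g x).
Proof.
move=> [mf [M hf]] [mg [N hg]]; split; first exact: measurable_funD.
exists (M + N) => x Dx; rewrite (le_trans (ler_normD _ _)) // lerD ?hf ?hg //.
Qed.

Lemma bmeasM D f g : bmeas D f -> bmeas D g -> bmeas D (fun x => f x * g x).
Proof.
move=> [mf [M hf]] [mg [N hg]]; split; first exact: measurable_funM.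
exists (M * N) => x Dx; rewrite normrM ler_pM ?hf ?hg //.
Qed.

Lemma bmeasZ D (c : R) f : bmeas D f -> bmeas D (fun x => c * f x).
Proof. by apply: bmeasM; exact: bmeas_cst. Qed.

Lemma bmeasB D f g : bmeas D f -> bmeas D g -> bmeas D (fun x => f x - g x).
Proof.
move=> [mf [M hf]] [mg [N hg]]; split; first exact: measurable_funB.
exists (M + N) => x Dx; rewrite (le_trans (ler_normB _ _)) // lerD ?hf ?hg //.
Qed.

Lemma bmeas_norm D f : bmeas D f -> bmeas D (fun x => `|f x|).
Proof.
move=> [mf [M hf]]; split; first exact: measurableT_comp.
by exists M => x Dx; rewrite normr_id hf.
Qed.

Lemma bmeasS D D' f : D' `<=` D -> bmeas D f -> bmeas D' f.
Proof. by move=> DD [mf [M hf]]; split => //; exists M => x /DD; exact: hf. Qed.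

Section measure.
Variables (mu : {measure set T -> \bar R}) (D : set T).
Hypotheses (mD : measurable D) (muD : (mu D < +oo)%E).

Lemma bmeas_int f : bmeas D f -> mu.-integrable D (EFin \o f).
Proof.
move=> [mf [M hf]]; apply: (@bounded_integrable _ _ _ _ _ _ M) => //.
exact: measurable_funTS.
Qed.

Lemma bRintD f g : bmeas D f -> bmeas D g ->
  \int[mu]_(x in D) (f x + g x) = \int[mu]_(x in D) f x + \int[mu]_(x in D) g x.
Proof. by move=> bf bg; rewrite RintegralD //; exact: bmeas_int. Qed.

Lemma bRintB f g : bmeas D f -> bmeas D g ->
  \int[mu]_(x in D) (f x - g x) = \int[mu]_(x in D) f x - \int[mu]_(x in D) g x.
Proof. by move=> bf bg; rewrite RintegralB //; exact: bmeas_int. Qed.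

Lemma bRintZ (c : R) f : bmeas D f ->
  \int[mu]_(x in D) (c * f x) = c * \int[mu]_(x in D) f x.
Proof. by move=> bf; rewrite RintegralZl //; exact: bmeas_int. Qed.

Lemma le_bRint f g : bmeas D f -> bmeas D g -> (forall x, D x -> f x <= g x) ->
  \int[mu]_(x in D) f x <= \int[mu]_(x in D) g x.
Proof. by move=> bf bg h; apply: le_Rintegral => //; exact: bmeas_int. Qed.

Lemma le_norm_bRint f g : bmeas D f -> bmeas D g -> (forall x, D x -> `|f x| <= g x) ->
  `|\int[mu]_(x in D) f x| <= \int[mu]_(x in D) g x.
Proof.
move=> bf bg h; rewrite (le_trans (le_normr_Rintegral _ _)) //; first exact: bmeas_int.
by apply: le_bRint => //; exact: bmeas_norm.
Qed.

Lemma bRint_EFin f : bmeas D f ->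
  (\int[mu]_(x in D) f x)%:E = (\int[mu]_(x in D) (f x)%:E)%E.
Proof. by move=> bf; rewrite EFin_Rintegral //; exact: bmeas_int. Qed.

End measure.

Lemma bRint_setU (mu : {measure set T -> \bar R}) (A B : set T) f :
  measurable A -> measurable B -> A `&` B = set0 -> (mu (A `|` B) < +oo)%E ->
  bmeas (A `|` B) f ->
  \int[mu]_(x in A `|` B) f x = \int[mu]_(x in A) f x + \int[mu]_(x in B) f x.
Proof.
move=> mA mB AB muAB bf; rewrite Rintegral_setU //; last exact/disj_set2P.
by apply: bmeas_int => //; exact: measurableU.
Qed.

End BoundedMeasurable.

Section Blocks.
Context {R : realType}.

Definition upblock (a L : R) (j : nat) : set R := `[a + j%:R * L, a + j.+1%:R * L[%classic.
Definition downblock (a L : R) (j : nat) : set R := `[a - j.+1%:R * L, a - j%:R * L[%classic.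

Lemma upblock_cover (a L y : R) : 0 < L -> a <= y -> exists j, upblock a L j y.
Proof.
move=> L0 ay; exists (Num.truncn ((y - a) / L)).
have h0 : 0 <= (y - a) / L by rewrite divr_ge0 ?subr_ge0 // ltW.
have := truncn_itv h0; rewrite ler_pdivlMr // ltr_pdivrMr // => /andP[h1 h2].
rewrite /upblock /= in_itv /=; apply/andP; split; lra.
Qed.

Lemma upblock_triv (a L : R) : 0 < L -> trivIset setT (upblock a L).
Proof.
move=> L0 i j _ _ [y []]; rewrite /upblock /= !in_itv /= => /andP[h1 h2] /andP[h3 h4].
have q (k l : nat) : a + k%:R * L <= y -> y < a + l.+1%:R * L -> (k <= l)%N.
  move=> h h'; have : k%:R * L < l.+1%:R * L by lra.
  by rewrite ltr_pM2r // ltr_nat.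
by apply/eqP; rewrite eqn_leq !q.
Qed.

Lemma downblock_cover (a L y : R) : 0 < L -> y < a -> exists j, downblock a L j y.
Proof.
move=> L0 ya; have h0 : 0 < (a - y) / L by rewrite divr_gt0 ?subr_gt0.
have ex : exists n, (a - y) / L <= n%:R.
  by exists (Num.truncn ((a - y) / L)).+1; rewrite ltW // truncnS_gt.
case: (ex_minnP ex) => -[|n] hn hmin.
  by move: h0; rewrite ltNge hn.
exists n; rewrite /downblock /= in_itv /=.
have hn' : n%:R < (a - y) / L.
  by rewrite ltNge; apply/negP => /hmin; rewrite ltnn.
move: hn hn'; rewrite ltr_pdivlMr // ler_pdivrMr // => h1 h2.
by apply/andP; split; lra.
Qed.

Lemma downblock_triv (a L : R) : 0 < L -> trivIset setT (downblock a L).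
Proof.
move=> L0 i j _ _ [y []]; rewrite /downblock /= !in_itv /= => /andP[h1 h2] /andP[h3 h4].
have q (k l : nat) : y < a - k%:R * L -> a - l.+1%:R * L <= y -> (k <= l)%N.
  move=> h h'; have : k%:R * L < l.+1%:R * L by lra.
  by rewrite ltr_pM2r // ltr_nat.
by apply/eqP; rewrite eqn_leq !q.
Qed.

End Blocks.

Section Stochastic_order.
Context {R : realType} d1 d2 (T1 : measurableType d1) (T2 : measurableType d2).
Variables (P1 : probability T1 R) (P2 : probability T2 R).

(** Layer cake formula: expectations of nonnegative variables integrate their tails over levels t >=
    0, and each such level set of [phi] is an open half-line, where the stochastic order applies. *)
Lemma st_le_integral (X1 : T1 -> R) (X2 : T2 -> R) (phi : R -> R) :
  measurable_fun setT X1 -> measurable_fun setT X2 -> measurable_fun setT phi ->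
  (forall u, 0 <= phi u) ->
  (forall t, 0 <= t -> exists c, forall u, (t < phi u) = (c < u)) ->
  st_le P1 X1 P2 X2 ->
  (\int[P1]_w (phi (X1 w))%:E <= \int[P2]_w (phi (X2 w))%:E)%E.
Proof.
move=> mX1 mX2 mphi phi0 hphi st.
have m1 : measurable_fun setT (phi \o X1) by exact: measurableT_comp.
have m2 : measurable_fun setT (phi \o X2) by exact: measurableT_comp.
pose Y1 : {RV P1 >-> R} := HB.pack (phi \o X1) (isMeasurableFun.Build _ _ _ _ _ m1).
pose Y2 : {RV P2 >-> R} := HB.pack (phi \o X2) (isMeasurableFun.Build _ _ _ _ _ m2).
have e1 : (\int[P1]_w (phi (X1 w))%:E = 'E_P1[Y1])%E by rewrite expectation_def.
have e2 : (\int[P2]_w (phi (X2 w))%:E = 'E_P2[Y2])%E by rewrite expectation_def.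
rewrite e1 e2 !ge0_expectation_ccdf; [|by move=> w; exact: phi0..].
apply: ge0_le_integral => //.
- by apply: measurable_funS (ccdf_measurable Y1).
- by apply: measurable_funS (ccdf_measurable Y2).
move=> t /=; rewrite in_itv /= andbT => t0.
have [c hc] := hphi t t0.
rewrite /ccdf /distribution /pushforward /=.
have E d (T : measurableType d) (X : T -> R) :
   (phi \o X) @^-1` `]t, +oo[ = [set w | c < X w].
  by apply/seteqP; split => w /=; rewrite in_itv /= andbT hc.
by rewrite !E; exact: st.
Qed.

End Stochastic_order.

Section OneStep.
Context {R : realType} d (T : measurableType d).
Variables (q : {measure set T -> \bar R}) (xi : T -> R) (sg : R).
Hypothesis q1 : q setT = 1%E.
Hypothesis mxi : measurable_fun setT xi.

Definition small_jump : set T := [set w | `|xi w| < sg].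
Local Notation J := small_jump.

Lemma measurable_small_jump : measurable J.
Proof.
rewrite -[J]setTI; have : measurable_fun setT (fun w => `|xi w|) by exact: measurableT_comp.
move=> /(_ measurableT `]-oo, sg[%classic (measurable_itv _)).
by rewrite (_ : _ @^-1` _ = J) //; apply/seteqP; split => w /=; rewrite in_itv.
Qed.
Local Notation mJ := measurable_small_jump.

Lemma q_lty A : measurable A -> (q A < +oo)%E.
Proof.
move=> mA; apply: (@le_lt_trans _ _ (q setT)); last by rewrite q1 ltry.
by apply: le_measure; rewrite ?inE.
Qed.

(** Splits at the truncation level. Large jumps cost at most their probability, since G is bounded
    by 1; on small jumps the pointwise expansion is integrated. *)
Lemma Rintegral_approx (G f1 f2 : T -> R) (al be c1 c2 I1 I2 M : R) :
  0 < sg ->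
  measurable_fun setT G -> (forall w, `|G w| <= 1) ->
  measurable_fun setT f1 -> measurable_fun setT f2 ->
  (forall w, J w -> `|f1 w| <= M) -> (forall w, J w -> `|f2 w| <= M) ->
  0 <= c1 -> 0 <= c2 ->
  \int[q]_(w in J) f1 w <= I1 -> \int[q]_(w in J) f2 w <= I2 ->
  (forall w, J w -> `|G w - (al * xi w + be * xi w ^+ 2)| <= c1 * f1 w + c2 * f2 w) ->
  `|\int[q]_w G w - (al * (\int[q]_(w in J) xi w) + be * (\int[q]_(w in J) xi w ^+ 2))|
    <= fine (q (~` J)) + c1 * I1 + c2 * I2.
Proof.
move=> sg0 mG G1 mf1 mf2 bf1 bf2 c10 c20 hI1 hI2 hG.
have mJC : measurable (~` J) by apply: measurableC; exact: mJ.
have qJ := q_lty mJ; have qJC := q_lty mJC.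
have bG D : bmeas D G by apply: (@bmeasI _ _ _ _ _ 1).
have bx : bmeas J xi by apply: (@bmeasI _ _ _ _ _ sg) => // w /ltW.
have bx2 : bmeas J (fun w => xi w ^+ 2) by exact: bmeasM.
have b1 : bmeas J f1 by exact: bmeasI bf1.
have b2 : bmeas J f2 by exact: bmeasI bf2.
have bl : bmeas J (fun w => al * xi w + be * xi w ^+ 2) by apply: bmeasD; exact: bmeasZ.
have br : bmeas J (fun w => c1 * f1 w + c2 * f2 w) by apply: bmeasD; exact: bmeasZ.
rewrite -[in \int[q]_w _](setUv J) bRint_setU //; last 3 first.
- exact: mJ.
- exact: setICr.
- by rewrite setUv q1 ltry.
rewrite -(bRintZ mJ qJ) // -(bRintZ mJ qJ) // -bRintD //; [|exact: mJ|exact: bmeasZ..].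
rewrite addrAC -bRintB //; last exact: mJ.
rewrite (le_trans (ler_normD _ _)) //.
have h1 : `|\int[q]_(w in ~` J) G w| <= fine (q (~` J)).
  rewrite -[leRHS]mul1r -(Rintegral_cst q mJC 1).
  by apply: le_norm_bRint => //; exact: bmeas_cst.
have h2 : `|\int[q]_(w in J) (G w - (al * xi w + be * xi w ^+ 2))| <= c1 * I1 + c2 * I2.
  apply: (@le_trans _ _ (\int[q]_(w in J) (c1 * f1 w + c2 * f2 w))).
    by apply: le_norm_bRint => //; [exact: mJ|exact: bmeasB].
  rewrite bRintD //; [|exact: mJ|exact: bmeasZ..].
  by rewrite !bRintZ //; [|exact: mJ..]; rewrite lerD // ler_wpM2l.
lra.
Qed.

End OneStep.

(** * The exponential test function *)

Section Profile.
Context {R : realType}.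
Implicit Types (k L z u K : R).

Definition profile k L z := expR (- (k * theta L z)).
Definition cut1 K u := if K < `|u| then `|u| else 0.

Lemma cut1_ge0 K u : 0 <= cut1 K u.
Proof. by rewrite /cut1; case: ifP. Qed.

Lemma cut1_le K u : cut1 K u <= `|u|.
Proof. by rewrite /cut1; case: ifP. Qed.

Lemma measurable_cut1 K : measurable_fun setT (cut1 K).
Proof.
apply: measurable_fun_ifT; [|exact: normr_measurable|exact: measurable_cst].
by apply: measurable_fun_ltr; [exact: measurable_cst|exact: normr_measurable].
Qed.

Variables (k L : R).
Hypotheses (k0 : 0 <= k) (L0 : 0 < L).

Lemma profile_gt0 z : 0 < profile k L z.
Proof. exact: expR_gt0. Qed.

Lemma profile_le1 z : profile k L z <= 1.
Proof. by rewrite /profile expR_le1 oppr_le0 mulr_ge0 ?theta_ge0. Qed.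

Lemma profile_noninc z z' : z <= z' -> profile k L z' <= profile k L z.
Proof.
move=> h; rewrite /profile ler_expR lerN2 ler_wpM2l //.
by have := theta_step L0 h; lra.
Qed.

Lemma profile_left z : z <= - L -> profile k L z = 1.
Proof. by move=> h; rewrite /profile theta_left // mulr0 oppr0 expR0. Qed.

Lemma profile_right z : L <= z -> profile k L z = expR (- (k * z)).
Proof. by move=> h; rewrite /profile theta_right. Qed.

Lemma measurable_profile : measurable_fun setT (profile k L).
Proof. by apply: nonincreasing_measurable => // x y; exact: profile_noninc. Qed.

Lemma profile_diff_le1 z z' : `|profile k L z - profile k L z'| <= 1.
Proof.
have := profile_gt0 z; have := profile_gt0 z'; have := profile_le1 z; have := profile_le1 z'.
by move=> *; rewrite ler_norml; apply/andP; split; lra.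
Qed.

(** The profile equals 1 up to -L, so only a jump longer than half the distance to 0 can change it,
    and then by at most k times the jump. *)
Lemma profile_far_left z u : z <= - (2 * L) ->
  `|profile k L z - profile k L (z + u)| <= k * cut1 (- z / 2) u.
Proof.
have L0_ := L0; move=> hz; rewrite profile_left; last lra.
rewrite ger0_norm ?subr_ge0 ?profile_le1 //.
have h := expR_ge1Dx (- (k * theta L (z + u))); rewrite -/(profile k L (z + u)) in h.
have h2 : 1 - profile k L (z + u) <= k * theta L (z + u) by lra.
rewrite (le_trans h2) // ler_wpM2l // /cut1; case: ifPn => hc.
  rewrite (le_trans (theta_le_pos L0 _)) //.
  have := ler_norm u; have := normr_ge0 u.
  by case: (posP (z + u + L)) => -[_ ->]; lra.
rewrite -leNgt in hc; rewrite theta_left //; have := ler_norm u; lra.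
Qed.

(** Two nested expansions: the exponential to first order in k times the increment of [theta], then
    that increment by [theta_taylor]. Their remainders are the two terms on the right. *)
Lemma profile_central z u : k * `|u| <= 2^-1 ->
  `|profile k L z - profile k L (z + u)
    - (profile k L z * k * theta1 L z * u + profile k L z * k * (tent L z / L / 2) * u ^+ 2)|
  <= 2 * k ^+ 2 * u ^+ 2 + 3 * k / L * (u ^+ 2 * Num.min (`|u| / L) 1).
Proof.
have L0_ := L0; have k0_ := k0; move=> ku; pose D := theta L (z + u) - theta L z.
have hD : `|D| <= `|u| := theta_lip L0 z u.
have hkD : `|k * D| <= 2^-1.
  by rewrite normrM (ger0_norm k0) (le_trans _ ku) // ler_wpM2l.
have h1 := expR_taylor1 hkD; have h2 := theta_taylor L0 z u.
have p0 := profile_gt0 z; have p1 := profile_le1 z.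
have e : profile k L (z + u) = profile k L z * expR (- (k * D)).
  by rewrite /profile -expRD /D; congr expR; ring.
have D2 : D ^+ 2 <= u ^+ 2.
  by rewrite -[leLHS]ger0_norm ?sqr_ge0 // -[leRHS]ger0_norm ?sqr_ge0 // !normrX lerXn2r ?nnegrE.
set rhs2 := (X in _ <= X) in h2.
rewrite e [X in `|X|](_ : _ = profile k L z *
   ((1 - expR (- (k * D)) - k * D) + k * (D - theta1 L z * u - tent L z / L * u ^+ 2 / 2))); last by ring.
rewrite normrM (gtr0_norm p0) -[leRHS]mul1r ler_pM //; first exact: ltW.
rewrite (le_trans (ler_normD _ _)) // lerD //.
  rewrite (le_trans h1) // exprMn mulrA ler_wpM2l // mulr_ge0 ?sqr_ge0 //.
rewrite normrM (ger0_norm k0).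
have -> : 3 * k / L * (u ^+ 2 * Num.min (`|u| / L) 1) = k * rhs2.
  by rewrite /rhs2; ring.
by rewrite ler_wpM2l.
Qed.

(** Right of L the profile is a pure exponential, expanded to second order. Jumps back over the bend
    are longer than z / 2 and are charged to [cut1]. The growth exp (k |u|) of the remainder costs
    half of the decay exp (- k z), because k |u| <= (1 + k z) / 2. *)
Lemma profile_right_far z u e1 : 2 * L <= z -> 0 <= e1 -> e1 <= 2^-1 ->
  k * `|u| <= e1 * (1 + k * z) ->
  `|profile k L z - profile k L (z + u)
    - (expR (- (k * z)) * k * u + - (expR (- (k * z)) * k ^+ 2 / 2) * u ^+ 2)|
  <= 2 * expR (- (k * z / 2)) * k * cut1 (z / 2) u
     + 2 * expR (- (k * z / 2)) * (e1 * (1 + k * z)) * k ^+ 2 * u ^+ 2.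
Proof.
have L0_ := L0; have k0_ := k0; move=> hz e10 e1h ku.
have z0 : 0 <= z by lra.
have kz0 : 0 <= k * z by exact: mulr_ge0.
have hexp : expR (- (k * z)) * expR (k * `|u|) <= 2 * expR (- (k * z / 2)).
  have h12 : expR 2^-1 <= 2 :> R.
    have := expR_ge1Dx (- 2^-1 : R); rewrite expRN => h.
    have : expR 2^-1 * (1 - 2^-1) <= 1 :> R.
      by rewrite -ler_pdivlMl ?expR_gt0 // mulr1.
    lra.
  apply: (@le_trans _ _ (expR 2^-1 * expR (- (k * z / 2)))); last first.
    by rewrite ler_wpM2r // expR_ge0.
  rewrite -!expRD ler_expR; nra.
pose dl := theta L (z + u) - (z + u).
have dl0 : 0 <= dl by rewrite /dl subr_ge0 theta_ge.
have hdl : dl <= cut1 (z / 2) u.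
  rewrite /cut1 /dl; case: ifPn => hc.
    have [hu|hu] := leP 0 u.
      by rewrite theta_right ?subrr //; lra.
    have := @theta_step _ L L0 (z + u) z; rewrite (@theta_right _ L L0 z); last lra.
    rewrite (ltr0_norm hu); lra.
  rewrite -leNgt in hc; rewrite theta_right ?subrr //.
  have := ler_norm (- u); rewrite normrN; lra.
have e : profile k L (z + u) = expR (- (k * z + k * u + k * dl)).
  by rewrite /profile /dl; congr expR; ring.
have kdl : 0 <= k * dl by exact: mulr_ge0.
have h1 := expR_sub_le (k * z + k * u) kdl.
have h2 := expR_taylor2 (k * u).
have ez : 0 < expR (- (k * z)) by exact: expR_gt0.
have eku : expR (- (k * z + k * u)) = expR (- (k * z)) * expR (- (k * u)).
  by rewrite opprD expRD.
have ekl : expR (- (k * z + k * u)) <= 2 * expR (- (k * z / 2)).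
  rewrite eku (le_trans _ hexp) // ler_pM2l // ler_expR -mulrN ler_wpM2l //.
  by have := ler_norm (- u); rewrite normrN.
rewrite profile_right; last lra.
rewrite e [X in `|X|](_ : _ =
    (expR (- (k * z + k * u)) - expR (- (k * z + k * u + k * dl))) +
    expR (- (k * z)) * (1 - expR (- (k * u)) - k * u + (k * u) ^+ 2 / 2)); last by rewrite eku; field.
rewrite (le_trans (ler_normD _ _)) // lerD //.
  rewrite ger0_norm; last by case/andP: h1.
  case/andP: h1 => _ h1; rewrite (le_trans h1) // -mulrA ler_pM ?expR_ge0 //.
  by rewrite ler_wpM2l.
rewrite normrM (gtr0_norm ez).
have nk : `|k * u| = k * `|u| by rewrite normrM (ger0_norm k0).
rewrite nk in h2.
apply: (@le_trans _ _ (expR (- (k * z)) * ((k * `|u|) ^+ 3 * expR (k * `|u|)))).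
  by rewrite ler_pM2l.
have k3 : (k * `|u|) ^+ 3 = (k * `|u|) * (k ^+ 2 * u ^+ 2).
  by rewrite exprS exprMn -normrX (ger0_norm (sqr_ge0 u)).
have a0 : 0 <= k * `|u| by exact: mulr_ge0.
have b0 : 0 <= k ^+ 2 * u ^+ 2 by rewrite mulr_ge0 ?sqr_ge0.
have c0 : 0 <= expR (- (k * z)) * expR (k * `|u|) by rewrite mulr_ge0 ?expR_ge0.
rewrite k3 (_ : expR _ * _ = (expR (- (k * z)) * expR (k * `|u|)) * ((k * `|u|) * (k ^+ 2 * u ^+ 2))); last by ring.
apply: (@le_trans _ _ ((2 * expR (- (k * z / 2))) * ((e1 * (1 + k * z)) * (k ^+ 2 * u ^+ 2)))).
  apply: ler_pM => //; first exact: mulr_ge0.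
  exact: ler_wpM2r.
by rewrite !mulrA lexx.
Qed.

End Profile.

Section OneStepProfile.
Context {R : realType} d (T : measurableType d).
Variables (q : {measure set T -> \bar R}) (xi : T -> R) (sg : R).
Hypothesis q1 : q setT = 1%E.
Hypothesis mxi : measurable_fun setT xi.
Hypothesis sg0 : 0 < sg.
Local Notation J := (small_jump xi sg).
Variables (b L k e B2 : R) (t1 : R -> R).
Hypotheses (b0 : 0 < b) (L0 : 0 < L) (k0 : 0 < k) (e0 : 0 < e) (B20 : 0 <= B2).
Hypothesis ht1 : forall K, 0 <= K -> \int[q]_(w in J) cut1 K (xi w) <= t1 K.
Hypothesis hB2 : \int[q]_(w in J) xi w ^+ 2 <= B2.
Hypothesis hmix : \int[q]_(w in J) (xi w ^+ 2 * Num.min (`|xi w| / L) 1) <= e.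

Local Notation m1 := (\int[q]_(w in J) xi w).
Local Notation m2 := (\int[q]_(w in J) xi w ^+ 2).
Local Notation rho := (fine (q (~` J))).

Definition decrement (z : R) := \int[q]_w (profile k L z - profile k L (z + xi w)).

Let k0' : 0 <= k. Proof. exact: ltW. Qed.

Lemma measurable_decrement_fun z :
  measurable_fun setT (fun w => profile k L z - profile k L (z + xi w)).
Proof.
apply: measurable_funB; first exact: measurable_cst.
apply: measurableT_comp; first exact: measurable_profile.
exact: measurable_funD.
Qed.

Let mx2 : measurable_fun setT (fun w => xi w ^+ 2).
Proof. exact: measurable_funX. Qed.

Let mcut K : measurable_fun setT (fun w => cut1 K (xi w)).
Proof. apply: measurableT_comp => //; exact: measurable_cut1. Qed.

Let mmix : measurable_fun setT (fun w => xi w ^+ 2 * Num.min (`|xi w| / L) 1).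
Proof.
apply: measurable_funM => //; apply: measurable_minr; last exact: measurable_cst.
apply: measurable_funM; last exact: measurable_cst.
exact: measurableT_comp.
Qed.

Let M := Num.max sg (sg ^+ 2).

Let bx2 w : J w -> `|xi w ^+ 2| <= M.
Proof.
move=> Jw; rewrite /M le_max; apply/orP; right.
by rewrite normrX lerXn2r ?nnegrE ?normr_ge0 // ltW.
Qed.

Let bcut K w : J w -> `|cut1 K (xi w)| <= M.
Proof.
move=> Jw; rewrite /M le_max; apply/orP; left.
by rewrite ger0_norm ?cut1_ge0 // (le_trans (cut1_le _ _)) // ltW.
Qed.

Let bmix w : J w -> `|xi w ^+ 2 * Num.min (`|xi w| / L) 1| <= M.
Proof.
move=> Jw; have h := bx2 Jw; rewrite normrM -[leRHS]mulr1 ler_pM //.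
have h0 : 0 <= Num.min (`|xi w| / L) 1 by rewrite le_min ler01 divr_ge0 // ltW.
by rewrite ger0_norm // ge_min lexx orbT.
Qed.

Lemma decrement_far_left z : z <= - (2 * L) ->
  `|decrement z| <= rho + k * t1 (- z / 2).
Proof.
move=> hz.
have := @Rintegral_approx _ _ _ q xi sg q1 mxi
  (fun w => profile k L z - profile k L (z + xi w)) (fun w => cut1 (- z / 2) (xi w))
  (fun w => xi w ^+ 2) 0 0 k 0 (t1 (- z / 2)) B2 M sg0 (measurable_decrement_fun z)
  (fun w => profile_diff_le1 k0' L0 _ _) (mcut _) mx2 (bcut _) bx2 k0' (lexx _).
rewrite !mul0r addr0 subr0 addr0; apply => //.
  by apply: ht1; have := L0; lra.
by move=> w _; rewrite !mul0r !addr0 subr0; exact: profile_far_left.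
Qed.

(** The second moment gives the main term. The drift term is of order k^2, and k L <= e (2 / b)
    turns k^2 into a multiple of k e / L. *)
Lemma decrement_central z : `|z| <= 2 * L -> k * sg <= 2^-1 ->
  `|m1| <= 2 * b * k -> `|m2 - b| <= e -> k * L <= e * (2 / b) ->
  `|decrement z - k * (b / 2) * (tent L z / L)|
  <= rho + (4 + (4 * B2 + 2 * b) * (2 / b)) * (k * e / L).
Proof.
move=> hz ksg hm1 hm2 kL.
have kne : L != 0 by rewrite gt_eqF.
have k1 : 0 <= 2 * k ^+ 2 by rewrite mulr_ge0 ?sqr_ge0.
have k3 : 0 <= 3 * k / L by rewrite divr_ge0 ?mulr_ge0 // ltW.
have := @Rintegral_approx _ _ _ q xi sg q1 mxi
  (fun w => profile k L z - profile k L (z + xi w)) (fun w => xi w ^+ 2)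
  (fun w => xi w ^+ 2 * Num.min (`|xi w| / L) 1)
  (profile k L z * k * theta1 L z) (profile k L z * k * (tent L z / L / 2))
  (2 * k ^+ 2) (3 * k / L) B2 e M sg0 (measurable_decrement_fun z)
  (fun w => profile_diff_le1 k0' L0 _ _) mx2 mmix bx2 bmix k1 k3 hB2 hmix.
set A := (X in `|_ - X|); move=> H; unshelve epose proof (H _) as hA; clear H.
  move=> w Jw; apply: profile_central => //.
  by rewrite (le_trans _ ksg) // ler_wpM2l // ltW.
have p0 := profile_gt0 k L z; have p1 := profile_le1 k0' L0 z.
have t0 := tent_itv L0 z; have th0 := theta1_itv L z.
have pl : 1 - profile k L z <= k * (3 * L).
  have h := expR_ge1Dx (- (k * theta L z)); rewrite -/(profile k L z) in h.
  have h2 : theta L z <= 3 * L.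
    rewrite (le_trans (theta_le_pos L0 _)) //; have := ler_norm z; have := L0.
    by case: (posP (z + L)) => -[_ ->]; lra.
  have := ler_wpM2l k0' h2; lra.
have m20 : 0 <= m2 by apply: Rintegral_ge0 => w _; exact: sqr_ge0.
have hA2 : `|A - k * (b / 2) * (tent L z / L)| <= 2 * b * k * k + k / (2 * L) * (e + k * (3 * L) * B2).
  rewrite /A [X in `|X|](_ : _ = (profile k L z * theta1 L z) * (k * m1) +
      (tent L z) * (k / (2 * L)) * (profile k L z * m2 - b)); last by field.
  rewrite (le_trans (ler_normD _ _)) // lerD //.
    rewrite normrM [leRHS]mulrC -[leRHS]mul1r ler_pM //.
      rewrite ger0_norm; last by rewrite mulr_ge0 //; [exact: ltW|case/andP: th0].
      by case/andP: th0 => h1 h2; rewrite -[leRHS]mulr1 ler_pM // ltW.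
    by rewrite normrM (gtr0_norm k0) ler_wpM2l.
  rewrite normrM ler_pM //.
    rewrite ger0_norm; last first.
      case/andP: t0 => t0 _; apply: mulr_ge0 => //; rewrite divr_ge0 // mulr_ge0 // ltW //.
    case/andP: t0 => _ t1'; rewrite -[leRHS]mul1r ler_wpM2r //.
    by rewrite divr_ge0 // mulr_ge0 // ltW.
  have -> : profile k L z * m2 - b = (m2 - b) - (1 - profile k L z) * m2 by ring.
  rewrite (le_trans (ler_normB _ _)) // lerD // ger0_norm; last by rewrite mulr_ge0 //; lra.
  by rewrite ler_pM //; lra.
have -> : decrement z - k * (b / 2) * (tent L z / L) =
   (decrement z - A) + (A - k * (b / 2) * (tent L z / L)) by ring.
rewrite (le_trans (ler_normD _ _)) // (le_trans (lerD hA hA2)) //.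
have keL : 0 <= k * e / L by rewrite divr_ge0 ?mulr_ge0 // ltW.
have kk : k ^+ 2 <= (2 / b) * (k * e / L).
  rewrite (_ : 2 / b * _ = k * (e * (2 / b) / L)); last by ring.
  by rewrite expr2 ler_wpM2l // ler_pdivlMr.
have c0 : 0 <= 4 * B2 + 2 * b by have := b0; have := B20; lra.
have := ler_wpM2l c0 kk.
have -> : 3 * k / L * e = 3 * (k * e / L) by ring.
have -> : k / (2 * L) * (e + k * (3 * L) * B2) = (k * e / L) / 2 + 3 / 2 * B2 * k ^+ 2 by field.
have -> : 2 * b * k * k = 2 * b * k ^+ 2 by ring.
have : 0 <= B2 * k ^+ 2 by rewrite mulr_ge0 ?sqr_ge0.
set X := k * e / L in keL *; set Y := k ^+ 2; set W := 2 / b.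
move=> h1 h2; lra.
Qed.

(** The leading terms k m1 and k^2 m2 / 2 cancel at m1 = b k / 2 and m2 = b. The deviations allowed
    grow like 1 + k z, which [expR_poly_decay] absorbs. *)
Lemma decrement_far_right z c1 c3 : 0 <= c1 -> 0 <= c3 -> c1 * e <= 2^-1 -> 2 * L <= z ->
  k * sg <= c1 * e * (1 + k * z) ->
  `|m1 - b * k / 2| <= c3 * e * k * (1 + k * z) -> `|m2 - b| <= e ->
  `|decrement z| <= rho + (2 * (@decay_const R)) * (k * t1 (z / 2) / (1 + k * z)
      + (c1 * B2 + c3 + 1) * e * k ^+ 2 / (1 + k * z) ^+ 3).
Proof.
move=> c10 c30 ce hz ksg hm1 hm2.
have z0 : 0 <= z by have := L0; lra.
have kz0 : 0 <= k * z by exact: mulr_ge0.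
set E := expR (- (k * z / 2)); set w1 := 1 + k * z.
have w10 : 0 < w1 by rewrite /w1; lra.
have E0 : 0 <= E by exact: expR_ge0.
have ce0 : 0 <= c1 * e by rewrite mulr_ge0 // ltW.
have k1 : 0 <= 2 * E * k by rewrite !mulr_ge0.
have k2 : 0 <= 2 * E * (c1 * e * w1) * k ^+ 2 by rewrite !mulr_ge0 ?sqr_ge0 // ltW.
have z20 : 0 <= z / 2 by lra.
have := @Rintegral_approx _ _ _ q xi sg q1 mxi
  (fun w => profile k L z - profile k L (z + xi w)) (fun w => cut1 (z / 2) (xi w))
  (fun w => xi w ^+ 2) (expR (- (k * z)) * k) (- (expR (- (k * z)) * k ^+ 2 / 2))
  (2 * E * k) (2 * E * (c1 * e * w1) * k ^+ 2) (t1 (z / 2)) B2 M sg0 (measurable_decrement_fun z)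
  (fun w => profile_diff_le1 k0' L0 _ _) (mcut _) mx2 (bcut _) bx2 k1 k2 (ht1 z20) hB2.
set A := (X in `|_ - X|); move=> H; unshelve epose proof (H _) as hA; clear H.
  move=> w Jw; apply: profile_right_far => //.
  by rewrite (le_trans _ ksg) // ler_wpM2l // ltW.
have EE : expR (- (k * z)) <= E by rewrite ler_expR lerN2; lra.
have hA2 : `|A| <= E * (k * (c3 * e * k * w1) + k ^+ 2 * e).
  rewrite /A [X in `|X|](_ : _ = expR (- (k * z)) *
      (k * (m1 - b * k / 2) - k ^+ 2 / 2 * (m2 - b))); last by field.
  rewrite normrM (gtr0_norm (expR_gt0 _)) ler_pM ?expR_ge0 //.
  rewrite (le_trans (ler_normB _ _)) // lerD //.
    by rewrite normrM (gtr0_norm k0) ler_wpM2l.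
  have k22 : 0 <= k ^+ 2 by exact: sqr_ge0.
  rewrite normrM ger0_norm; last by lra.
  rewrite ler_pM //; lra.
have -> : decrement z = (decrement z - A) + A by ring.
rewrite (le_trans (ler_normD _ _)) // (le_trans (lerD hA hA2)) //.
have hE := expR_poly_decay kz0; rewrite -/E -/w1 in hE.
have w11 : 1 <= w1 by rewrite /w1; lra.
(* Trades n of the four powers of 1 + k z that the exponential can pay, and keeps the others as
   decay. *)
have wp n : (n <= 4)%N -> E * w1 ^+ n <= (@decay_const R) / w1 ^+ (4 - n).
  move=> n4; rewrite ler_pdivlMr ?exprn_gt0 // -mulrA -exprD subnKC //.
have tt : 0 <= t1 (z / 2).
  apply: le_trans (ht1 z20); apply: Rintegral_ge0 => w _; exact: cut1_ge0.
have a1 : 2 * E * k * t1 (z / 2) <= (2 * (@decay_const R)) * (k * t1 (z / 2) / w1).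
  have h : E <= (@decay_const R) / w1.
    have := wp 3 isT; rewrite expr1 => h; apply: le_trans h.
    by rewrite -[leLHS]mulr1 ler_wpM2l // exprn_ege1.
  have : E * (k * t1 (z / 2)) <= (@decay_const R) / w1 * (k * t1 (z / 2)).
    by rewrite ler_wpM2r // mulr_ge0.
  rewrite (_ : (2 * (@decay_const R)) * _ = 2 * ((@decay_const R) / w1 * (k * t1 (z / 2)))); last by ring.
  lra.
have ew : E * w1 <= (@decay_const R) / w1 ^+ 3 by have := wp 1 isT; rewrite expr1.
have e1 : E <= (@decay_const R) / w1 ^+ 3.
  by apply: le_trans ew; rewrite -[leLHS]mulr1 ler_wpM2l.
have ek : 0 <= e * k ^+ 2 by rewrite mulr_ge0 ?sqr_ge0 // ltW.
set Y := (@decay_const R) / w1 ^+ 3 in ew e1.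
have a2 : 2 * E * (c1 * e * w1) * k ^+ 2 * B2 <= 2 * Y * (c1 * B2 * (e * k ^+ 2)).
  rewrite (_ : 2 * E * _ * _ * B2 = (2 * (E * w1)) * (c1 * B2 * (e * k ^+ 2))); last by ring.
  rewrite ler_wpM2r ?ler_wpM2l //; by rewrite !mulr_ge0 // ltW.
have a3 : E * (k * (c3 * e * k * w1) + k ^+ 2 * e) <= Y * (c3 * (e * k ^+ 2)) + Y * (e * k ^+ 2).
  rewrite (_ : E * _ = (E * w1) * (c3 * (e * k ^+ 2)) + E * (e * k ^+ 2)); last by ring.
  by rewrite lerD // ler_wpM2r // mulr_ge0.
have -> : (2 * (@decay_const R)) * (k * t1 (z / 2) / w1 + (c1 * B2 + c3 + 1) * e * k ^+ 2 / w1 ^+ 3) =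
   (2 * (@decay_const R)) * (k * t1 (z / 2) / w1) + 2 * (Y * (c1 * B2 * (e * k ^+ 2)) + Y * (c3 * (e * k ^+ 2)) + Y * (e * k ^+ 2)).
  by rewrite /Y; ring.
have Y0 : 0 <= Y by rewrite divr_ge0 ?decay_const_ge0 // exprn_ge0 // ltW.
have y1 : 0 <= Y * (c3 * (e * k ^+ 2)) by apply: mulr_ge0 => //; exact: mulr_ge0.
have y2 : 0 <= Y * (e * k ^+ 2) by exact: mulr_ge0.
lra.
Qed.

End OneStepProfile.

(** * Summing the one-step errors over blocks *)

Section ErrorSum.
Context {R : realType}.
Variables (nu : {measure set R -> \bar R}) (D : set R) (err e1 : R -> R).
Variables (A L M x k e b C0 C1 C2 : R) (v p t1 : R -> R).
Hypotheses (mD : measurable D) (DA : forall y : R, D y -> A <= y).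
Hypotheses (merr : measurable_fun setT err) (me1 : measurable_fun setT e1).
Hypotheses (A0 : 0 <= A) (Ax : A <= x) (L0 : 0 < L) (M0 : 0 <= M) (e0 : 0 < e) (b0 : 0 < b).
Hypotheses (C00 : 0 <= C0) (C10 : 0 <= C1) (C20 : 0 <= C2) (eb : e * b <= 2).
Hypothesis v0 : forall y : R, 0 <= y -> 0 < v y.
Hypothesis vdecr : forall y y' : R, 0 <= y -> y <= y' -> v y' <= v y.
Hypothesis vslow : forall y y' : R, A <= y -> y <= y' -> (v y')^-1 - (v y)^-1 <= e * (y' - y).
Hypothesis kE : k = 2 * v x / b.
Hypothesis Lv : e * (2 * L) * v A <= 1.
Hypothesis p0 : forall y : R, 0 <= y -> 0 <= p y.
Hypothesis pdecr : forall y y' : R, 0 <= y -> y <= y' -> p y' <= p y.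
Hypothesis psum : forall J, \sum_(j < J) L * p (A + j%:R * L) <= e.
Hypothesis t1decr : forall y y' : R, 0 <= y -> y <= y' -> t1 y' <= t1 y.
Hypothesis t10 : forall y : R, 0 <= y -> 0 <= t1 y.
Hypothesis t1sum : forall J, \sum_(j < J) L / 2 * t1 (j.+2%:R * L / 2) <= e.
Hypothesis hwin : forall w : R, (nu (D `&` `[w, (w + L)%R[) <= (4 * L * M / v (Num.max w A))%:E)%E.
Hypothesis err0 : forall y : R, D y -> 0 <= err y.
Hypothesis he1 : forall y : R, D y -> e1 y = p y * v y.
Hypothesis hleft : forall y : R, D y -> y - x < - (2 * L) -> err y <= e1 y + k * t1 (- (y - x) / 2).
Hypothesis hmid : forall y : R, D y -> - (2 * L) <= y - x -> y - x < 2 * L ->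
  err y <= e1 y + C1 * (k * e / L).
Hypothesis hright : forall y : R, D y -> 2 * L <= y - x ->
  err y <= e1 y + C0 * (k * t1 ((y - x) / 2) / (1 + k * (y - x))
     + C2 * e * k ^+ 2 / (1 + k * (y - x)) ^+ 3).

(** What remains once large jumps are charged to [e1]. The sum of [e1] is bounded without reference
    to x, while that of [e2] is organised by the position relative to x. *)
Let e2 (y : R) := Num.max 0 (err y - e1 y).

Let me2 : measurable_fun setT e2.
Proof.
apply: measurable_maxr; first exact: measurable_cst.
exact: measurable_funB.
Qed.

Let x0 : 0 <= x. Proof. exact: le_trans Ax. Qed.
Let vx0 : 0 < v x. Proof. exact: v0. Qed.
Let k0 : 0 < k.
Proof. by rewrite kE divr_gt0 ?mulr_gt0. Qed.

Let e2_le (y c : R) : err y <= e1 y + c -> 0 <= c -> e2 y <= c.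
Proof. by move=> h c0; rewrite /e2 ge_max c0 lerBlDl. Qed.

Let kv : k / v x = 2 / b.
Proof. by rewrite kE; field; rewrite !gt_eqF. Qed.

Let m0 (w : R) : 0 <= w -> 0 <= 4 * L * M / v w.
Proof. by move=> w0; rewrite divr_ge0 ?mulr_ge0 // ltW // v0. Qed.

(** Telescoping: t / (u + t)^2 <= 1 / u - 1 / (u + t). The bound is uniform in t. *)
Lemma sum_inv_sq (t : R) J : 0 < t ->
  \sum_(j < J) t / (1 + j.+2%:R * t) ^+ 2 <= 1.
Proof.
move=> t0; suff : \sum_(j < J) t / (1 + j.+2%:R * t) ^+ 2 <= 1 - (1 + J.+1%:R * t)^-1.
  have : 0 <= (1 + J.+1%:R * t)^-1 by rewrite invr_ge0 addr_ge0 // mulr_ge0 // ltW.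
  lra.
elim: J => [|J IH].
  rewrite big_ord0 subr_ge0 invf_le1; have := t0; rewrite mul1r; lra.
rewrite big_ord_recr /= (le_trans (lerD IH (lexx _))) //.
set u := 1 + J.+1%:R * t; have u0 : 0 < u by rewrite /u addr_gt0 // mulr_gt0.
have -> : 1 + J.+2%:R * t = u + t by rewrite /u -[in LHS]natr1; ring.
have -> : t / (u + t) ^+ 2 = (u / (u + t)) * (t / (u * (u + t))).
  by field; rewrite !gt_eqF //; lra.
have e3 : u^-1 - (u + t)^-1 = t / (u * (u + t)).
  by field; rewrite !gt_eqF //; lra.
have q0 : 0 <= t / (u * (u + t)) by rewrite divr_ge0 ?mulr_ge0 //; lra.
have q1 : u / (u + t) <= 1 by rewrite ler_pdivrMr //; lra.
have := ler_wpM2r q0 q1; rewrite -e3; lra.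
Qed.

(** The factor v in the large-jump probability cancels the 1 / v in the window masses, which leaves
    a Riemann sum of p. *)
Lemma sum_err_tail : (\int[nu]_(y in D) (e1 y)%:E <= (4 * M * e)%:E)%E.
Proof.
apply: (@block_integral _ _ _ nu D e1 (upblock A L)
   (fun j => p (A + j%:R * L) * v (A + j%:R * L)) (fun j => 4 * L * M / v (A + j%:R * L))).
- exact: mD.
- exact: measurable_funTS.
- by move=> j; exact: measurable_itv.
- exact: upblock_triv.
- by move=> y Dy; have [j hj] := upblock_cover L0 (DA Dy); exists j.
- move=> y Dy; have y0 : 0 <= y by exact: le_trans (DA Dy).
  by rewrite he1 // mulr_ge0 ?p0 // ltW // v0.
- move=> j y Dy; rewrite /upblock /= in_itv /= => /andP[h _].
  have h0 : 0 <= A + j%:R * L by rewrite addr_ge0 // mulr_ge0 // ltW.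
  have y0 : 0 <= y by exact: le_trans h.
  by rewrite he1 // ler_pM ?p0 ?pdecr ?vdecr // ltW // v0.
- move=> j; have h0 : 0 <= A + j%:R * L by rewrite addr_ge0 // mulr_ge0 // ltW.
  by rewrite mulr_ge0 ?p0 // ltW // v0.
- move=> j; have := hwin (A + j%:R * L); rewrite max_l; last by rewrite lerDl mulr_ge0 // ltW.
  rewrite /upblock (_ : A + j.+1%:R * L = A + j%:R * L + L) //.
  by rewrite -natr1; ring.
- move=> J; rewrite (eq_bigr (fun j : 'I_J => 4 * M * (L * p (A + j%:R * L)))).
    by rewrite -mulr_sumr ler_wpM2l ?psum ?mulr_ge0.
  move=> j _; have h0 : 0 < v (A + j%:R * L) by rewrite v0 // addr_ge0 // mulr_ge0 // ltW.
  by field; rewrite gt_eqF.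
Qed.

(** Left of x the window bounds are at most the one at x, as v decreases. Block j lies at distance
    at least (j + 2) L from x, and k / v x = 2 / b leaves the sum of [t1] at half these
    distances. *)
Lemma sum_err_left :
  (\int[nu]_(y in D `&` `]-oo, (x - 2 * L)%R[) (e2 y)%:E <= (16 / b * M * e)%:E)%E.
Proof.
apply: (@block_integral _ _ _ nu _ e2 (downblock (x - 2 * L) L)
   (fun j => k * t1 (j.+2%:R * L / 2)) (fun j => 4 * L * M / v x)).
- by apply: measurableI => //; exact: measurable_itv.
- exact: measurable_funTS.
- by move=> j; exact: measurable_itv.
- exact: downblock_triv.
- move=> y [_] /=; rewrite in_itv /= => h.
  by have [j hj] := downblock_cover L0 h; exists j.
- by move=> y _; rewrite /e2 le_max lexx.
- move=> j y [Dy]; rewrite /downblock /= !in_itv /= => h /andP[_ h2].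
  have L0_ := L0; have j0 : 0 <= j%:R * L by rewrite mulr_ge0 // ltW.
  have h3 : - (y - x) / 2 >= j.+2%:R * L / 2.
    by rewrite -[j.+2%:R]natr1 -[j.+1%:R]natr1; lra.
  have h4 : 0 <= j.+2%:R * L / 2 by rewrite divr_ge0 ?mulr_ge0 // ltW.
  apply: (@le_trans _ _ (k * t1 (- (y - x) / 2))).
    apply: e2_le; first by apply: hleft => //; lra.
    rewrite mulr_ge0 ?t10 //; [exact: ltW|lra].
  by rewrite ler_wpM2l ?t1decr // ltW.
- by move=> j; rewrite mulr_ge0 ?t10 ?divr_ge0 ?mulr_ge0 // ltW.
- move=> j; set w := x - 2 * L - j.+1%:R * L.
  apply: (@le_trans _ _ (nu (D `&` `[w, (w + L)%R[))).
    apply: le_measure; rewrite ?inE.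
    + by apply: measurableI; [apply: measurableI => //; exact: measurable_itv|exact: measurable_itv].
    + by apply: measurableI => //; exact: measurable_itv.
    + move=> y [[Dy _]]; rewrite /downblock /= !in_itv /= => h; split => //.
      by move: h; rewrite /w -[j.+1%:R]natr1 => /andP[h1 h2]; apply/andP; split; lra.
  rewrite (le_trans (hwin w)) // lee_fin ler_wpM2l ?mulr_ge0 //; first exact: ltW.
  have wx : w <= x.
    have L0_ := L0; have : 0 <= j.+1%:R * L by rewrite mulr_ge0 // ltW.
    rewrite /w; lra.
  have h0 : 0 <= Num.max w A by rewrite le_max A0 orbT.
  by rewrite lef_pV2 ?posrE ?v0 // vdecr // ge_max wx.
- move=> J; rewrite (eq_bigr (fun j : 'I_J => (8 * M * (k / v x)) * (L / 2 * t1 (j.+2%:R * L / 2)))).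
    rewrite -mulr_sumr kv (_ : 16 / b * M * e = 8 * M * (2 / b) * e); last by ring.
    by rewrite ler_wpM2l ?t1sum // !mulr_ge0 // invr_ge0 ltW.
  by move=> j _; field; rewrite gt_eqF.
Qed.

Let vx2 (w : R) : w <= x + 2 * L -> (v (Num.max w A))^-1 <= 2 / v x.
Proof.
move=> wx; have h0 : 0 <= Num.max w A by rewrite le_max A0 orbT.
have L0_ := L0; have e0_ := e0; have vx0_ := vx0; have Ax_ := Ax.
have h1 : (v (Num.max w A))^-1 <= (v (x + 2 * L))^-1.
  have : 0 <= x + 2 * L by have := x0; lra.
  move=> h2; rewrite lef_pV2 ?posrE ?v0 // vdecr // ge_max wx /=; lra.
have h2 := @vslow x (x + 2 * L) Ax_ ltac:(lra).
rewrite (le_trans h1) //.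
have h3 : e * (x + 2 * L - x) <= (v x)^-1.
  rewrite addrAC subrr add0r -div1r ler_pdivlMr //.
  apply: le_trans Lv; rewrite ler_wpM2l //; last by rewrite vdecr.
  by rewrite !mulr_ge0 // ltW.
rewrite (_ : 2 / v x = (v x)^-1 + (v x)^-1); last by ring.
lra.
Qed.

(** Four windows of length L cover this zone, and each has mass of order L / v x since v is at least
    v x / 2 up to x + 2 L. *)
Lemma sum_err_mid :
  (\int[nu]_(y in D `&` `[(x - 2 * L)%R, (x + 2 * L)%R[) (e2 y)%:E <= (64 * C1 / b * M * e)%:E)%E.
Proof.
apply: (@block_integral _ _ _ nu _ e2 (upblock (x - 2 * L) L)
   (fun j => (j < 4)%:R * (C1 * (k * e / L))) (fun j => (j < 4)%:R * (4 * L * M * (2 / v x)))).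
- by apply: measurableI => //; exact: measurable_itv.
- exact: measurable_funTS.
- by move=> j; exact: measurable_itv.
- exact: upblock_triv.
- move=> y [_] /=; rewrite in_itv /= => /andP[h _].
  by have [j hj] := upblock_cover L0 h; exists j.
- by move=> y _; rewrite /e2 le_max lexx.
- move=> j y [Dy]; rewrite /upblock /= !in_itv /= => /andP[h1 h2] /andP[h3 h4].
  have -> : (j < 4)%N.
    have : j%:R * L < 4%:R * L by lra.
    by rewrite ltr_pM2r // ltr_nat.
  rewrite mul1r; apply: e2_le; first by apply: hmid => //; lra.
  by rewrite mulr_ge0 // divr_ge0 ?mulr_ge0 // ltW.
- by move=> j; rewrite !mulr_ge0 // ?invr_ge0 ltW.
- move=> j; have [j4|j4] := ltnP j 4; last first.
    rewrite mul0r (_ : _ `&` upblock _ _ _ = set0) ?measure0 //.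
    apply/seteqP; split => // y [[Dy]]; rewrite /upblock /= !in_itv /= => /andP[_ h1] /andP[h2 _].
    have : 4%:R * L <= j%:R * L by rewrite ler_pM2r // ler_nat.
    lra.
  rewrite mul1r; set w := x - 2 * L + j%:R * L.
  apply: (@le_trans _ _ (nu (D `&` `[w, (w + L)%R[))).
    apply: le_measure; rewrite ?inE.
    + by apply: measurableI; [apply: measurableI => //; exact: measurable_itv|exact: measurable_itv].
    + by apply: measurableI => //; exact: measurable_itv.
    + move=> y [[Dy _]]; rewrite /upblock /= !in_itv /= => h; split => //.
      by move: h; rewrite /w -[j.+1%:R]natr1 => /andP[h1 h2]; apply/andP; split; lra.
  rewrite (le_trans (hwin w)) // lee_fin ler_wpM2l ?mulr_ge0 //; first exact: ltW.
  apply: vx2; have : j%:R * L <= 4%:R * L by rewrite ler_pM2r // ler_nat ltnW.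
  rewrite /w; lra.
- move=> J; rewrite (eq_bigr (fun j : 'I_J => (j < 4)%:R * (16 * C1 / b * M * e))); last first.
    move=> j _; case: (j < 4)%N; rewrite ?mul0r // !mul1r.
    have -> : 16 * C1 / b * M * e = 8 * C1 * M * e * (k / v x) by rewrite kv; ring.
    by field; rewrite !gt_eqF.
  rewrite -mulr_suml (_ : 64 * C1 / b * M * e = 4 * (16 * C1 / b * M * e)); last by ring.
  rewrite ler_wpM2r //; first by rewrite !mulr_ge0 // ?invr_ge0 ltW.
  rewrite -natr_sum ler_nat.
  (* In truncated subtraction 4 - (4 - J) is the minimum of 4 and J. *)
  have : (\sum_(j < J) (j < 4) <= 4 - (4 - J))%N.
    elim: J => [|J IH]; first by rewrite big_ord0.
    rewrite big_ord_recr /= (leq_trans (leq_add IH (leqnn _))) //.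
    by case: J {IH} => [|[|[|[|J]]]].
  by move=> h; rewrite (leq_trans h) // leq_subr.
Qed.

(** Right of x the window bounds grow: 1 / v (x + z) <= (1 + k z) / v x, because 1 / v has slope at
    most e and e <= 2 / b = k / v x. The factor 1 + k z is paid by the denominators, leaving a sum
    of [t1] and one handled by [sum_inv_sq]. *)
Lemma sum_err_right :
  (\int[nu]_(y in D `&` `[(x + 2 * L)%R, +oo[) (e2 y)%:E <= (8 * C0 * (2 + C2) / b * M * e)%:E)%E.
Proof.
have k0_ := k0.
pose z j : R := j.+2%:R * L.
have z0 j : 0 <= z j by rewrite mulr_ge0 // ltW.
have kz j : 0 < 1 + k * z j by rewrite ltr_pwDl // mulr_ge0 // ltW.
have L0_ := L0.
pose g (y : R) := C0 * (k * t1 (y / 2) / (1 + k * y) + C2 * e * k ^+ 2 / (1 + k * y) ^+ 3).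
have g0 (y : R) : 0 <= y -> 0 <= g y.
  move=> y0; have h : 0 <= 1 + k * y by rewrite addr_ge0 // mulr_ge0 // ltW.
  rewrite /g mulr_ge0 // addr_ge0 // divr_ge0 ?exprn_ge0 //.
    by rewrite mulr_ge0 ?t10 ?divr_ge0 // ltW.
  by rewrite !mulr_ge0 ?sqr_ge0 // ltW.
have gdecr (y y' : R) : 0 <= y -> y <= y' -> g y' <= g y.
  move=> y0 yy; have h : 0 < 1 + k * y by rewrite ltr_pwDl // mulr_ge0 // ltW.
  have h1 : 1 + k * y <= 1 + k * y' by rewrite lerD2l ler_wpM2l // ltW.
  have h2 : 0 < 1 + k * y' by exact: lt_le_trans h1.
  have y2 : 0 <= y / 2 by rewrite divr_ge0.
  have yy2 : y / 2 <= y' / 2 by rewrite ler_pM2r.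
  rewrite /g ler_wpM2l // lerD //.
    apply: ler_pM; [|by rewrite invr_ge0 ltW| |by rewrite lef_pV2 ?posrE].
      by rewrite mulr_ge0 ?t10 //; [exact: ltW|exact: le_trans yy2].
    by rewrite ler_wpM2l ?t1decr // ltW.
  rewrite ler_wpM2l //; first by rewrite !mulr_ge0 ?sqr_ge0 // ltW.
  by rewrite lef_pV2 ?posrE ?exprn_gt0 // lerXn2r // nnegrE ltW.
apply: (@block_integral _ _ _ nu _ e2 (upblock (x + 2 * L) L)
   (fun j => g (z j)) (fun j => 4 * L * M / v x * (1 + k * z j))).
- by apply: measurableI => //; exact: measurable_itv.
- exact: measurable_funTS.
- by move=> j; exact: measurable_itv.
- exact: upblock_triv.
- move=> y [_] /=; rewrite in_itv /= andbT => h.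
  by have [j hj] := upblock_cover L0 h; exists j.
- by move=> y _; rewrite /e2 le_max lexx.
- move=> j y [Dy]; rewrite /upblock /= !in_itv /= andbT => h1 /andP[h3 h4].
  have h5 : z j <= y - x by move: h3; rewrite /z -[j.+2%:R]natr1 -[j.+1%:R]natr1; lra.
  apply: (@le_trans _ _ (g (y - x))); last by rewrite gdecr.
  apply: e2_le; first by apply: hright => //; lra.
  by apply: g0; apply: le_trans h5.
- by move=> j; exact: g0.
- move=> j; set w := x + 2 * L + j%:R * L.
  have wE : w = x + z j by rewrite /w /z -[j.+2%:R]natr1 -[j.+1%:R]natr1; ring.
  apply: (@le_trans _ _ (nu (D `&` `[w, (w + L)%R[))).
    apply: le_measure; rewrite ?inE.
    + by apply: measurableI; [apply: measurableI => //; exact: measurable_itv|exact: measurable_itv].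
    + by apply: measurableI => //; exact: measurable_itv.
    + move=> y [[Dy _]]; rewrite /upblock /= !in_itv /= => h; split => //.
      by move: h; rewrite /w -[j.+1%:R]natr1 => /andP[h1 h2]; apply/andP; split; lra.
  rewrite (le_trans (hwin w)) // lee_fin -[leRHS]mulrA ler_wpM2l ?mulr_ge0 //; first exact: ltW.
  have zj := z0 j; have Ax_ := Ax.
  rewrite max_l; last by rewrite wE; lra.
  have := @vslow x w Ax_; rewrite wE => h; have {}h := h ltac:(lra).
  have ev : e * (x + z j - x) <= k * z j / v x.
    rewrite (_ : k * z j / v x = (k / v x) * z j); last by ring.
    rewrite kv addrAC subrr add0r ler_wpM2r // ler_pdivlMr //.
  by rewrite mulrDr mulr1 [(v x)^-1 * _]mulrC; lra.
- move=> J.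
  rewrite (eq_bigr (fun j : 'I_J => C0 * 4 * M * (k / v x) *
     (2 * (L / 2 * t1 (j.+2%:R * L / 2)) + C2 * e * ((k * L) / (1 + j.+2%:R * (k * L)) ^+ 2)))); last first.
    move=> j _; have := kz j; rewrite /g /z.
    rewrite (_ : 1 + j.+2%:R * (k * L) = 1 + k * (j.+2%:R * L)); last by ring.
    move: (1 + _) (t1 _) => u t u0; field; rewrite !gt_eqF //.
  rewrite -mulr_sumr kv (_ : 8 * C0 * _ / b * M * e = C0 * 4 * M * (2 / b) * (2 * e + C2 * e)); last by ring.
  rewrite ler_wpM2l //; first by rewrite !mulr_ge0 // invr_ge0 ltW.
  rewrite big_split /= -[X in X + _]mulr_sumr -[X in _ + X]mulr_sumr; apply: lerD; first by rewrite ler_wpM2l ?t1sum.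
  rewrite -[leRHS]mulr1; apply: ler_wpM2l; first by rewrite mulr_ge0 // ltW.
  by apply: sum_inv_sq; rewrite mulr_gt0.
Qed.

Lemma sum_err : (\int[nu]_(y in D) (err y)%:E <=
  ((4 + 16 / b + 64 * C1 / b + 8 * C0 * (2 + C2) / b) * M * e)%:E)%E.
Proof.
have L0_ := L0.
have me2D (E : set R) : measurable_fun E (EFin \o e2).
  by apply/measurable_EFinP; exact: measurable_funTS.
have e20 y : 0 <= e2 y by rewrite /e2 le_max lexx.
apply: (@le_trans _ _ (\int[nu]_(y in D) ((e1 y)%:E + (e2 y)%:E))%E).
  apply: ge0_le_integral => //.
  - by apply/measurable_EFinP; exact: measurable_funTS.
  - by apply: emeasurable_funD => //; apply/measurable_EFinP; exact: measurable_funTS.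
  - move=> y Dy; rewrite -EFinD lee_fin /e2.
    have : err y - e1 y <= Num.max 0 (err y - e1 y) by rewrite le_max lexx orbT.
    lra.
have n1 y : D y -> (0 <= (e1 y)%:E)%E.
  move=> Dy; have y0 : 0 <= y by exact: le_trans (DA Dy).
  by rewrite lee_fin he1 // mulr_ge0 // ?p0 // ltW // v0.
have n2 y : D y -> (0 <= (e2 y)%:E)%E by rewrite lee_fin.
have m1 : measurable_fun D (EFin \o e1) by apply/measurable_EFinP; exact: measurable_funTS.
rewrite ge0_integralD //.
have -> : (\int[nu]_(y in D) (e2 y)%:E =
    \int[nu]_(y in D `&` `]-oo, (x - 2 * L)%R[) (e2 y)%:E +
    \int[nu]_(y in D `&` `[(x - 2 * L)%R, (x + 2 * L)%R[) (e2 y)%:E +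
    \int[nu]_(y in D `&` `[(x + 2 * L)%R, +oo[) (e2 y)%:E)%E.
  have mI (i : interval R) : measurable (D `&` [set` i]) by apply: measurableI => //; exact: measurable_itv.
  rewrite -ge0_integral_setU //; last 2 first.
  - by move=> y _; rewrite lee_fin.
  - apply/disj_setPS => y [[_ h1] [_ h2]]; move: h1 h2; rewrite /= !in_itv /=; lra.
  rewrite -ge0_integral_setU //; last 3 first.
  - exact: measurableU.
  - by move=> y _; rewrite lee_fin.
  - apply/disj_setPS => y [[[_ h1]|[_ h1]] [_ h2]]; move: h1 h2; rewrite /= !in_itv /= ?andbT; lra.
  congr (integral _ _ _); rewrite -!setIUr; apply/seteqP; split => y; last by case.
  move=> Dy; split => //=; rewrite !in_itv /= andbT.
  have [h1|h1] := ltP y (x - 2 * L); first by left; left.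
  have [h2|h2] := ltP y (x + 2 * L); first by left; right.
  by right.
have := leeD sum_err_tail (leeD (leeD sum_err_left sum_err_mid) sum_err_right).
move=> h; apply: (le_trans h); rewrite -!EFinD lee_fin.
by rewrite le_eqVlt; apply/orP; left; apply/eqP; ring.
Qed.

End ErrorSum.

Section Mixture.
Context {R : realType} d1 d2 (T1 : measurableType d1) (T2 : measurableType d2).
Variables (m : {measure set T1 -> \bar R}) (l : R.-ker T1 ~> T2) (m' : {measure set T2 -> \bar R}).
Hypothesis mixture : forall B, measurable B -> m' B = (\int[m]_y l y B)%E.

Import HBNNSimple.
Local Open Scope ereal_scope.

(** True for indicators by [mixture], for simple functions by linearity, and in general by monotone
    convergence on both sides. *)
Lemma ge0_integral_mixture (f : T2 -> \bar R) :
  measurable_fun setT f -> (forall z, 0 <= f z) ->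
  \int[m']_z f z = \int[m]_y \int[l y]_z f z.
Proof.
move=> mf f0; pose g := nnsfun_approx measurableT mf.
have g_cvg z : (g n z)%:E @[n --> \oo] --> f z by exact: cvg_nnsfun_approx.
have g_nd z : {homo (fun n => (g n z)%:E) : i j / (i <= j)%N >-> i <= j}.
  by move=> i j ij; rewrite lee_fin; exact/lefP/nd_nnsfun_approx.
have mg n : measurable_fun setT (fun z => (g n z)%:E) by exact/measurable_EFinP.
have lim_f (mu : {measure set T2 -> \bar R}) :
    \int[mu]_z (g n z)%:E @[n --> \oo] --> \int[mu]_z f z.
  rewrite (_ : \int[mu]_z f z = \int[mu]_z (limn (fun n => (g n z)%:E))); last first.
    by apply: eq_integral => z _; apply/esym/cvg_lim.
  apply: cvg_monotone_convergence => //.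
  - by move=> n z _; rewrite lee_fin.
have mint n : measurable_fun setT (fun y => \int[l y]_z (g n z)%:E).
  apply: measurable_fun_integral_kernel => //.
  - by move=> U; exact: measurable_kernel.
  - by move=> z; rewrite lee_fin.
have E : (fun n => \int[m']_z (g n z)%:E) = (fun n => \int[m]_y \int[l y]_z (g n z)%:E).
  apply/funext => n; rewrite integralT_nnsfun sintegralE.
  under [RHS]eq_integral do rewrite integralT_nnsfun sintegralE.
  rewrite ge0_integral_fsum //; first last.
  - move=> r y _; have [r0|r0] := leP 0%R r; first by rewrite mule_ge0 // lee_fin.
    by rewrite preimage_nnfun0 // measure0 mule0.
  - move=> r; apply: measurable_funeM; exact: measurable_kernel.
  apply: eq_fsbigr => r _; rewrite mixture //.
  have [r0|r0] := leP 0%R r.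
    by rewrite ge0_integralZl //; exact: measurable_kernel.
  by rewrite preimage_nnfun0 // !integral0_eq ?mule0 // => y _; rewrite measure0 // mule0.
apply: (cvg_unique (@ereal_hausdorff R) (lim_f m')); rewrite E.
rewrite (_ : \int[m]_y \int[l y]_z f z = \int[m]_y (limn (fun n => \int[l y]_z (g n z)%:E))); last first.
  by apply: eq_integral => y _; apply/esym/cvg_lim => //; exact: lim_f.
apply: cvg_monotone_convergence => //.
- by move=> n y _; apply: integral_ge0 => z _; rewrite lee_fin.
- move=> y _ i j ij; apply: ge0_le_integral => // z _; first [exact: g_nd | by rewrite lee_fin].
Qed.

End Mixture.

(** * Laws and Green measures of the chain *)

Section MeasureSum.
Context {R : realType} d (T : measurableType d).
Variable m : nat -> {measure set T -> \bar R}.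
Hypothesis m1 : forall n, m n setT = 1%E.

Lemma msumT N : (msum m N : {measure set T -> \bar R}) setT = N%:R%:E.
Proof.
rewrite [LHS](_ : _ = (\sum_(k < N) m k setT)%E) //.
under eq_bigr do rewrite m1.
by rewrite sumEFin sumr_const card_ord.
Qed.

Lemma msum_lty N : (msum m N setT < +oo)%E.
Proof. by have -> := msumT N; rewrite ltry. Qed.

Lemma finite_mass_lty (mu : {measure set T -> \bar R}) (A : set T) :
  (mu setT < +oo)%E -> measurable A -> (mu A < +oo)%E.
Proof.
move=> h mA; apply: le_lt_trans h; apply: le_measure; rewrite ?inE //.
Qed.

(** Reduces a signed bounded function to a nonnegative one, to which the extended-valued integration
    theorems apply. *)
Lemma Rintegral_shift (mu : {measure set T -> \bar R}) (f : T -> R) (M : R) :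
  (mu setT < +oo)%E -> bmeas setT f ->
  \int[mu]_y f y = \int[mu]_y (f y + M) - M * fine (mu setT).
Proof.
move=> h bf; rewrite bRintD //; last exact: bmeas_cst.
by rewrite Rintegral_cst // addrK.
Qed.

Lemma Rintegral_msum N (f : T -> R) : bmeas setT f ->
  \int[msum m N]_y f y = \sum_(n < N) \int[m n]_y f y.
Proof.
move=> bf; have [mf [M hM]] := bf.
have ml n : (m n setT < +oo)%E by rewrite m1 ltry.
have mg : measurable_fun setT (EFin \o (fun y => f y + M)).
  by apply/measurable_EFinP; apply: measurable_funD => //; exact: measurable_cst.
have g0 y : (0 <= (f y + M)%:E)%E.
  by rewrite lee_fin; have := hM y I; rewrite ler_norml; lra.
rewrite (Rintegral_shift M (msum_lty N) bf).
under [RHS]eq_bigr => n _ do rewrite (Rintegral_shift M (ml n) bf) m1 mulr1.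
have bg : bmeas setT (fun y => f y + M) by apply: bmeasD => //; exact: bmeas_cst.
rewrite sumrB; congr (_ - _); last first.
  by rewrite msumT /= sumr_const mulr_natr card_ord.
apply: EFin_inj; rewrite -sumEFin bRint_EFin //; last exact: msum_lty.
rewrite ge0_integral_measure_sum //.
by apply: eq_bigr => n _; rewrite bRint_EFin.
Qed.

End MeasureSum.

Section Chain.
Context {R : realType} d (Omega : measurableType d) (P : probability Omega R).
Variables (S : set R) (Q : R.-pker R ~> R) (X : nat -> {RV P >-> R}).
Hypothesis hX : markov_chain S Q X.

Definition law (n : nat) : {measure set R -> \bar R} := distribution P (X n).
Definition green (N : nat) : {measure set R -> \bar R} := msum law N.
Definition transition (f : R -> R) (y : R) : R := \int[Q y]_z f z.

Lemma measurable_states : measurable S. Proof. by case: hX. Qed.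

Lemma law1 n : law n setT = 1%E.
Proof. exact: probability_setT. Qed.

Lemma law_ltoo n A : measurable A -> (law n A < +oo)%E.
Proof. by apply: finite_mass_lty; rewrite law1 ltry. Qed.

Lemma law_states n : law n (~` S) = 0%E.
Proof.
rewrite /law /= /distribution /pushforward (_ : _ @^-1` _ = set0) ?measure0 //.
by apply/seteqP; split => // w /=; case: hX => _ _ h _; apply; exact: h.
Qed.

(** The event that X n lies in A belongs to the natural filtration at time n. *)
Lemma law_pair n A B : measurable A -> measurable B ->
  P (X n @^-1` A `&` X n.+1 @^-1` B) = (\int[law n]_(y in A) Q y B)%E.
Proof.
move=> mA mB; case: hX => _ _ _ /(_ n (X n @^-1` A) B) -> //; last first.
  by apply: sub_sigma_algebra; exists n, A; split.
rewrite /law ge0_integral_pushforward //.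
by apply: measurable_funTS; exact: measurable_kernel.
Qed.

Lemma law_next n B : measurable B -> law n.+1 B = (\int[law n]_y Q y B)%E.
Proof.
move=> mB; rewrite -law_pair // preimage_setT setTI //.
Qed.

Lemma Q1 y : Q y setT = 1%E. Proof. exact: prob_kernel. Qed.

Lemma Q_ltoo y A : measurable A -> (Q y A < +oo)%E.
Proof. by apply: finite_mass_lty; rewrite Q1 ltry. Qed.

Lemma transition_le f M y : bmeas setT f -> (forall x, `|f x| <= M) -> `|transition f y| <= M.
Proof.
move=> bf hM; rewrite -[M]mulr1 -[in leRHS](_ : fine (Q y setT) = 1); last by rewrite Q1.
rewrite -Rintegral_cst //; apply: le_norm_bRint => //; first exact: Q_ltoo.
exact: bmeas_cst.
Qed.

Lemma measurable_transition f : bmeas setT f -> measurable_fun setT (transition f).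
Proof.
move=> bf; have [mf [M hM]] := bf.
rewrite (_ : transition f = (fun y => fine (\int[Q y]_z (f z + M)%:E) - M)); last first.
  apply/funext => y; rewrite /transition (Rintegral_shift M (Q_ltoo y measurableT) bf).
  by rewrite Q1 mulr1.
apply: measurable_funB; last exact: measurable_cst.
apply: measurableT_comp => //.
apply: measurable_fun_integral_kernel.
- by move=> U; exact: measurable_kernel.
- by move=> z; rewrite lee_fin; have := hM z I; rewrite ler_norml; lra.
- by apply/measurable_EFinP; apply: measurable_funD => //; exact: measurable_cst.
Qed.

Lemma bmeas_transition f : bmeas setT f -> bmeas setT (transition f).
Proof.
move=> bf; split; first exact: measurable_transition.
have [_ [M hM]] := bf; exists M => y _; apply: transition_le => // x; exact: hM.
Qed.

Lemma ge0_law_next n f : measurable_fun setT f -> (forall z, 0 <= f z)%E ->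
  (\int[law n.+1]_z f z = \int[law n]_y \int[Q y]_z f z)%E.
Proof. by apply: ge0_integral_mixture; exact: law_next. Qed.

Lemma Rintegral_law_next n f : bmeas setT f ->
  \int[law n.+1]_z f z = \int[law n]_y transition f y.
Proof.
move=> bf; have [mf [M hM]] := bf.
have bg : bmeas setT (fun y => f y + M) by apply: bmeasD => //; exact: bmeas_cst.
rewrite (Rintegral_shift M _ bf) ?(Rintegral_shift M _ (bmeas_transition bf)) ?law1 ?ltry //.
congr (_ - _); apply: EFin_inj.
rewrite bRint_EFin ?law_ltoo // bRint_EFin ?law_ltoo //; last first.
  by apply: bmeasD; [exact: bmeas_transition|exact: bmeas_cst].
rewrite ge0_law_next //; last 2 first.
- by apply/measurable_EFinP; case: bg.
- by move=> z; rewrite lee_fin; have := hM z I; rewrite ler_norml; lra.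
apply: eq_integral => y _; rewrite -bRint_EFin ?Q_ltoo // bRintD ?Q_ltoo //; last exact: bmeas_cst.
by rewrite Rintegral_cst // Q1 mulr1.
Qed.

Lemma green_ltoo N A : measurable A -> (green N A < +oo)%E.
Proof. by apply: finite_mass_lty; apply: msum_lty; exact: law1. Qed.

Lemma green_telescope N f : bmeas setT f ->
  \int[green N]_y (f y - transition f y) = \int[law 0]_y f y - \int[law N]_y f y.
Proof.
move=> bf; have bt := bmeas_transition bf.
rewrite Rintegral_msum //; [|exact: law1|exact: bmeasB].
rewrite (eq_bigr (fun n : 'I_N => (\int[law n]_y f y - \int[law n.+1]_y f y))); last first.
  by move=> n _; rewrite bRintB ?law_ltoo // Rintegral_law_next.
elim: N => [|N IH]; first by rewrite big_ord0 subrr.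
by rewrite big_ord_recr /= IH; ring.
Qed.

Lemma green_states N : green N (~` S) = 0%E.
Proof. by rewrite /green /= /msum big1 // => n _; exact: law_states. Qed.

Lemma Rintegral_states (mu : {measure set R -> \bar R}) f A : mu (~` S) = 0%E ->
  (mu setT < +oo)%E -> bmeas setT f ->
  \int[mu]_y f y = \int[mu]_(y in S `&` `[A, +oo[) f y + \int[mu]_(y in S `&` `]-oo, A[) f y.
Proof.
move=> mu0 muT bf; have mS := measurable_states.
have mI (i : interval R) : measurable (S `&` [set` i]) by apply: measurableI => //; exact: measurable_itv.
have mSC : measurable (~` S) by exact: measurableC.
have lty B : measurable B -> (mu B < +oo)%E by exact: finite_mass_lty.
have bs B : bmeas B f by exact: bmeasS bf.
rewrite -[in LHS](setUv S) bRint_setU // ?setICr //; last by apply: lty; exact: measurableU.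
have -> : \int[mu]_(y in ~` S) f y = 0.
  by rewrite /Rintegral null_set_integral // ?lty //; apply/measurable_EFinP; apply: measurable_funTS; case: bf.
rewrite addr0 -bRint_setU //.
- congr (Rintegral _ _ _); rewrite -setIUr; apply/esym/setIidPl => y _ /=.
  by rewrite !in_itv /= andbT; case: (leP A y); [left|right].
- apply/seteqP; split => // y [[_ h1] [_ h2]]; move: h1 h2; rewrite /= !in_itv /= andbT; lra.
- by apply: lty; exact: measurableU.
Qed.

End Chain.

(** * Bootstrapping at a large scale *)

Section Setting.
Context {R : realType}.
Variables (S : set R) (Q : R.-pker R ~> R) (v s p t1 : R -> R) (b B2 : R).

(** The hypotheses valid at all nonnegative states. The dominating variable enters only through two
    consequences: a bound B2 on truncated second moments and a function t1 bounding truncated first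
    moments beyond a distance. *)
Record drift_setting : Prop := DriftSetting {
  ds_mS : measurable S;
  ds_b : 0 < b;
  ds_B2 : 0 <= B2;
  ds_v : forall y : R, 0 <= y -> 0 < v y;
  ds_vdecr : forall y y' : R, 0 <= y -> y <= y' -> v y' <= v y;
  ds_s : forall y : R, 0 <= y -> 0 < s y;
  ds_sincr : forall y y' : R, 0 <= y -> y <= y' -> s y <= s y';
  ds_p : forall y : R, 0 <= y -> 0 <= p y;
  ds_pdecr : forall y y' : R, 0 <= y -> y <= y' -> p y' <= p y;
  ds_t1 : forall K : R, 0 <= K -> 0 <= t1 K;
  ds_t1decr : forall K K' : R, 0 <= K -> K <= K' -> t1 K' <= t1 K;
  ds_tail : forall y, S y -> 0 <= y ->
    (Q y (~` small_jump (jump y) (s y)) <= (p y * v y)%:E)%E;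
  ds_cut1 : forall y K : R, S y -> 0 <= y -> 0 <= K ->
    \int[Q y]_(z in small_jump (jump y) (s y)) cut1 K (jump y z) <= t1 K;
  ds_second : forall y, S y -> 0 <= y ->
    \int[Q y]_(z in small_jump (jump y) (s y)) jump y z ^+ 2 <= B2 }.

(* The asymptotic hypotheses with error [e], beyond the level [A]; [L] is the
   half-width of the tents and [t1 K] bounds the mean of the truncated jump size
   restricted to sizes above [K]. *)
Record good (e L A : R) : Prop := Good {
  good_A : 0 <= A;
  good_L : 1 <= L;
  good_slow : forall y y' : R, A <= y -> y <= y' -> (v y')^-1 - (v y)^-1 <= e * (y' - y);
  good_Lv : L * v A <= e;
  good_sv : forall y : R, A <= y -> s y * v y <= e;
  good_p : forall J, \sum_(j < J) L * p (A + j%:R * L) <= e;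
  good_t1 : forall J, \sum_(j < J) L / 2 * t1 (j.+2%:R * L / 2) <= e;
  good_mix : forall y, S y -> A <= y ->
    \int[Q y]_(z in small_jump (jump y) (s y))
       (jump y z ^+ 2 * Num.min (`|jump y z| / L) 1) <= e;
  good_m1 : forall y, S y -> A <= y ->
    `|\int[Q y]_(z in small_jump (jump y) (s y)) jump y z - v y| <= e * v y;
  good_m2 : forall y, S y -> A <= y ->
    `|\int[Q y]_(z in small_jump (jump y) (s y)) jump y z ^+ 2 - b| <= e }.

Definition rate (x : R) := 2 * v x / b.
Definition green_fun (L x y : R) := profile (rate x) L (y - x).
Definition green_error (L x y : R) :=
  `|green_fun L x y - transition Q (green_fun L x) y - v x / L * tent L (y - x)|.

(** The constant of [sum_err] with the coefficients of the central zone and of the right zone filled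
    in. *)
Definition err_const := 4 + 16 / b + 64 * (4 + (4 * B2 + 2 * b) * (2 / b)) / b
  + 8 * (2 * @decay_const R) * (2 + (2 / b * B2 + (b / 2 + b ^+ 2 / 4) + 1)) / b.

Hypothesis H : drift_setting.

Lemma measurable_jump y : measurable_fun setT (@jump R y).
Proof. by apply: measurable_funB => //; exact: measurable_cst. Qed.

Lemma measurable_tent (L x : R) : measurable_fun setT (fun y : R => tent L (y - x)).
Proof.
apply: measurable_maxr; first exact: measurable_cst.
apply: measurable_funB; first exact: measurable_cst.
apply: measurable_funM; last exact: measurable_cst.
apply: measurableT_comp; first exact: normr_measurable.
by apply: measurable_funB => //; exact: measurable_cst.
Qed.

Section fixed.
Variables (e L A x : R).
Hypotheses (hg : good e L A) (e0 : 0 < e) (e2 : e <= 2^-1) (eb : e <= b / 8) (eb2 : e * b <= 2).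
Hypothesis Ax : A <= x.

Let b0 : 0 < b. Proof. exact: (ds_b H). Qed.
Let A0 : 0 <= A. Proof. exact: (good_A hg). Qed.
Let x0 : 0 <= x. Proof. exact: le_trans A0 Ax. Qed.
Let vx0 : 0 < v x. Proof. exact: (ds_v H x0). Qed.
Let L0 : 0 < L. Proof. exact: lt_le_trans (good_L hg). Qed.
Let k0 : 0 < rate x. Proof. by rewrite /rate divr_gt0 // mulr_gt0. Qed.
Let kb : rate x * (b / 2) = v x. Proof. by rewrite /rate; field; rewrite gt_eqF. Qed.

Lemma bmeas_green_fun : bmeas setT (green_fun L x).
Proof.
apply: (@bmeasI _ _ _ _ _ 1).
  apply: measurableT_comp; first by apply: measurable_profile => //; exact: ltW.
  by apply: measurable_funB => //; exact: measurable_cst.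
move=> y _; rewrite ger0_norm; last exact: ltW (profile_gt0 _ _ _).
by apply: profile_le1 => //; exact: ltW.
Qed.

Lemma measurable_green_error : measurable_fun setT (green_error L x).
Proof.
have [mg _] := bmeas_green_fun.
apply: measurableT_comp; first exact: normr_measurable.
apply: measurable_funB; first apply: measurable_funB => //.
  exact: measurable_transition bmeas_green_fun.
apply: measurable_funM; first exact: measurable_cst.
exact: measurable_tent.
Qed.

Lemma decrement_green y :
  decrement (Q y) (jump y) L (rate x) (y - x) = green_fun L x y - transition Q (green_fun L x) y.
Proof.
have [mg _] := bmeas_green_fun.
have jE z : profile (rate x) L (y - x + jump y z) = green_fun L x z.
  by rewrite /green_fun /jump; congr profile; ring.
rewrite /decrement; under eq_Rintegral do rewrite jE.
rewrite (bRintB measurableT (Q_ltoo Q y measurableT) (bmeas_cst _ _) bmeas_green_fun).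
by rewrite (Rintegral_cst _ measurableT) Q1 mulr1.
Qed.

Let rho_le y : S y -> A <= y -> fine (Q y (~` small_jump (jump y) (s y))) <= p y * v y.
Proof.
move=> Sy Ay; rewrite -lee_fin fineK; first by apply: (ds_tail H) => //; exact: le_trans Ay.
rewrite ge0_fin_numE // Q_ltoo //; apply: measurableC; apply: measurable_small_jump.
exact: measurable_jump.
Qed.

Let vle y z : A <= y -> y <= z -> (v z)^-1 <= (v y)^-1 + e * (z - y).
Proof. by move=> h1 h2; have := good_slow hg h1 h2; lra. Qed.

Let vx2 y : y <= x + 2 * L -> x <= y -> (v y)^-1 <= 2 / v x.
Proof.
move=> h1 h2; have := vle Ax h2.
have h3 : e * (y - x) <= (v x)^-1.
  rewrite -div1r ler_pdivlMr //.
  have h4 : e * (y - x) <= 2^-1 * (2 * L).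
    by apply: ler_pM => //; [exact: ltW|lra|lra].
  have h5 : L * v x <= e.
    apply: le_trans (good_Lv hg); rewrite ler_wpM2l ?(ds_vdecr H) // ltW //.
  have := ler_wpM2r (ltW vx0) h4; have e2_ := e2; lra.
rewrite (_ : 2 / v x = (v x)^-1 + (v x)^-1); last by ring.
lra.
Qed.

Lemma green_error_left y : S y -> A <= y -> y - x < - (2 * L) ->
  green_error L x y <= p y * v y + rate x * t1 (- (y - x) / 2).
Proof.
move=> Sy Ay hy; have y0 : 0 <= y by exact: le_trans Ay.
rewrite /green_error tent_out //; last first.
  by rewrite ltr0_norm; have := L0; lra.
rewrite mulr0 subr0 -decrement_green.
have := @decrement_far_left _ _ _ (Q y) (jump y) (s y) (Q1 Q y) (@measurable_jump y)
  (ds_s H y0) L (rate x) B2 t1 L0 k0 (fun K => ds_cut1 H Sy y0) (ds_second H Sy y0) (y - x) (ltW hy).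
by move=> h; rewrite (le_trans h) // lerD2r rho_le.
Qed.

Lemma green_error_mid y : S y -> A <= y -> - (2 * L) <= y - x -> y - x < 2 * L ->
  green_error L x y <= p y * v y + (4 + (4 * B2 + 2 * b) * (2 / b)) * (rate x * e / L).
Proof.
move=> Sy Ay hy1 hy2; have y0 : 0 <= y by exact: le_trans Ay.
have L0_ := L0; have e0_ := e0; have eb_ := eb; have b0_ := b0; have vx0_ := vx0; have e2_ := e2.
have LA := good_Lv hg.
have vy0 := ds_v H y0.
(* Within 2 L of x, v exceeds v x at most by a factor 2: 1 / v has slope at most e, and L v is at
   most e beyond A. *)
have vy2 : v y <= 2 * v x.
  have [xy|yx] := leP x y.
    by have := ds_vdecr H x0 xy; lra.
  have h1 := good_slow hg Ay (ltW yx).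
  have h2 : e * (x - y) <= 2^-1 * (2 * L) by apply: ler_pM; lra.
  have h3 : v y <= v A by apply: (ds_vdecr H).
  have h4 : L * v y <= 2^-1.
    by apply: (le_trans _ e2); apply: le_trans LA; rewrite ler_wpM2l // ltW.
  have h5 : v y * ((v x)^-1 - (v y)^-1) <= 2^-1.
    rewrite (le_trans _ h4) // mulrC ler_wpM2r //; [exact: ltW|lra].
  have h6 : v y * ((v x)^-1 - (v y)^-1) = v y / v x - 1 by field; rewrite !gt_eqF.
  have : v y / v x <= 2 by lra.
  by rewrite ler_pdivrMr.
have ksg : rate x * s y <= 2^-1.
  have h : v x * s y <= 2 * e.
    have [xy|yx] := leP x y.
      have yx2 : y <= x + 2 * L by lra.
      have h1 := vx2 yx2 xy.
      have h2 := good_sv hg Ay.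
      have h3 : v x <= 2 * v y.
        move: h1; rewrite ler_pdivlMr // mulrC -[leLHS]/(_ / _) ler_pdivrMr //.
      have sy0 := ds_s H y0.
      have := ler_wpM2r (ltW sy0) h3; lra.
    have h1 := ds_sincr H y0 (ltW yx); have h2 := good_sv hg Ax.
    have := ler_wpM2l (ltW vx0) h1; lra.
  have -> : rate x * s y = 2 * (v x * s y) / b by rewrite /rate; ring.
  rewrite ler_pdivrMr //; lra.
have := @decrement_central _ _ _ (Q y) (jump y) (s y) (Q1 Q y) (@measurable_jump y)
  (ds_s H y0) b L (rate x) e B2 b0 L0 k0 e0 (ds_B2 H) (ds_second H Sy y0)
  (good_mix hg Sy Ay) (y - x).
rewrite decrement_green kb.
rewrite (_ : v x * (tent L (y - x) / L) = v x / L * tent L (y - x)); last by ring.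
rewrite -/(green_error L x y) => h.
apply: le_trans (h _ ksg _ (good_m2 hg Sy Ay) _) _.
- by rewrite ler_norml hy1 ltW.
- have -> : 2 * b * rate x = 4 * v x by rewrite -kb; field.
  have := good_m1 hg Sy Ay; rewrite !ler_norml => /andP[h1 h2].
  have : e * v y <= 2^-1 * v y by rewrite ler_wpM2r // ltW.
  by move=> h3; apply/andP; split; lra.
- rewrite /rate (_ : 2 * v x / b * L = (L * v x) * (2 / b)); last by ring.
  rewrite ler_wpM2r //; first by rewrite divr_ge0 // ltW.
  by apply: le_trans LA; rewrite ler_wpM2l ?(ds_vdecr H) // ltW.
- by rewrite lerD2r rho_le.
Qed.

Lemma green_error_right y : S y -> A <= y -> 2 * L <= y - x ->
  green_error L x y <= p y * v y + (2 * @decay_const R) * (rate x * t1 ((y - x) / 2) / (1 + rate x * (y - x))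
     + (2 / b * B2 + (b / 2 + b ^+ 2 / 4) + 1) * e * rate x ^+ 2 / (1 + rate x * (y - x)) ^+ 3).
Proof.
move=> Sy Ay hy; have y0 : 0 <= y by exact: le_trans Ay.
have L0_ := L0; have e0_ := e0; have eb_ := eb; have b0_ := b0; have vx0_ := vx0; have e2_ := e2.
have vy0 := ds_v H y0; have xy : x <= y by lra.
have vxy := ds_vdecr H x0 xy.
rewrite /green_error tent_out //; last by rewrite ger0_norm; lra.
rewrite mulr0 subr0 -decrement_green.
have c10 : 0 <= 2 / b by rewrite divr_ge0 // ltW.
have c30 : 0 <= b / 2 + b ^+ 2 / 4 by have := sqr_ge0 b; lra.
have ce : 2 / b * e <= 2^-1.
  by rewrite mulrAC ler_pdivrMr //; lra.
have zx : 0 <= y - x by lra.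
have kz0 : 0 <= rate x * (y - x) by rewrite mulr_ge0 // ltW.
have := @decrement_far_right _ _ _ (Q y) (jump y) (s y) (Q1 Q y) (@measurable_jump y)
  (ds_s H y0) b L (rate x) e B2 t1 L0 k0 e0 (ds_B2 H) (fun K => ds_cut1 H Sy y0) (ds_second H Sy y0)
  (y - x) (2 / b) (b / 2 + b ^+ 2 / 4) c10 c30 ce hy.
move=> h; apply: le_trans (h _ _ (good_m2 hg Sy Ay)) _.
(* The truncation level s y <= e / v y grows at most linearly in y - x, with a small slope. *)
- have h1 := good_sv hg Ay; have h2 := vle Ax xy.
  have h3 : s y <= e * (v y)^-1 by rewrite ler_pdivlMr.
  have h4 : s y <= e * ((v x)^-1 + e * (y - x)).
    by rewrite (le_trans h3) // ler_wpM2l // ltW.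
  apply: (le_trans (ler_wpM2l (ltW k0) h4)).
  have -> : rate x * (e * ((v x)^-1 + e * (y - x))) = 2 / b * e * (1 + e * b / 2 * (rate x * (y - x))).
    by rewrite /rate; field; rewrite !gt_eqF.
  rewrite ler_wpM2l //; first by rewrite mulr_ge0 // ltW.
  rewrite lerD2l -[leRHS]mul1r ler_wpM2r //; have := eb2; lra.
- have -> : b * rate x / 2 = v x by rewrite -kb; ring.
  have h1 := good_m1 hg Sy Ay.
  (* Uses v x - v y = v x * v y * (1 / v y - 1 / v x) with v y <= v x = rate x * b / 2. *)
  have h2 : `|v y - v x| <= (b / 2) ^+ 2 * e * rate x * (rate x * (y - x)).
    rewrite distrC ger0_norm ?subr_ge0 //.
    have h3 := good_slow hg Ax xy.
    have h4 : v x - v y = v x * v y * ((v y)^-1 - (v x)^-1) by field; rewrite !gt_eqF.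
    rewrite h4 (_ : _ * (rate x * _) = (rate x * (b / 2)) * (rate x * (b / 2)) * (e * (y - x))); last by ring.
    rewrite kb ler_pM //; first by rewrite mulr_ge0 // ltW.
      by rewrite subr_ge0 lef_pV2 ?posrE.
    by rewrite ler_wpM2l // ltW.
  set m := Rintegral _ _ _ in h1 *.
  have -> : m - v x = (m - v y) + (v y - v x) by ring.
  rewrite (le_trans (ler_normD _ _)) // (le_trans (lerD h1 h2)) //.
  have h5 : e * v y <= e * (rate x * (b / 2)) by rewrite kb ler_wpM2l // ltW.
  have k00 := ltW k0; have e00 := ltW e0.
  have b200 : 0 <= b / 2 by lra.
  have h6 : 0 <= b / 2 * e * rate x * (rate x * (y - x)).
    by apply: mulr_ge0 => //; apply: mulr_ge0 => //; exact: mulr_ge0.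
  have h7 : 0 <= b ^+ 2 / 4 * e * rate x.
    by apply: mulr_ge0 => //; apply: mulr_ge0 => //; rewrite divr_ge0 ?sqr_ge0.
  lra.
- by rewrite lerD2r rho_le.
Qed.

Lemma green_error_sum (nu : {measure set R -> \bar R}) (M : R) : 0 <= M ->
  (forall w : R, (nu ((S `&` `[A, +oo[) `&` `[w, (w + L)%R[) <= (4 * L * M / v (Num.max w A))%:E)%E) ->
  (\int[nu]_(y in S `&` `[A, +oo[) (green_error L x y)%:E <= (err_const * M * e)%:E)%E.
Proof.
move=> M0 hwin; have b0_ := b0; have B20 := ds_B2 H.
pose e1 (y : R) := p (Num.max y 0) * v (Num.max y 0).
have mmono (f : R -> R) : (forall y y' : R, 0 <= y -> y <= y' -> f y' <= f y) ->
    measurable_fun setT (fun y : R => f (Num.max y 0)).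
  move=> hf; apply: nonincreasing_measurable => // y y' yy.
  by apply: hf; [rewrite le_max lexx orbT|rewrite ge_max !le_max lexx yy orbT].
have DA (y : R) : (S `&` `[A, +oo[) y -> S y /\ A <= y.
  by move=> [Sy] /=; rewrite in_itv /= andbT.
have e1E (y : R) : (S `&` `[A, +oo[) y -> e1 y = p y * v y.
  by move=> /DA[_ Ay]; rewrite /e1 max_l // (le_trans A0 Ay).
have q1 : 0 <= 2 / b by rewrite divr_ge0 // ltW.
apply: (@sum_err _ nu (S `&` `[A, +oo[) (green_error L x) e1 A L M x (rate x) e b (2 * @decay_const R)
  (4 + (4 * B2 + 2 * b) * (2 / b)) (2 / b * B2 + (b / 2 + b ^+ 2 / 4) + 1) v p t1).
- by apply: measurableI; [exact: (ds_mS H)|exact: measurable_itv].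
- by move=> y /DA[].
- exact: measurable_green_error.
- by apply: measurable_funM; apply: mmono; [exact: (ds_pdecr H)|exact: (ds_vdecr H)].
- exact: A0.
- exact: Ax.
- exact: L0.
- exact: M0.
- exact: e0.
- exact: b0.
- by rewrite mulr_ge0 ?decay_const_ge0.
- by rewrite addr_ge0 // mulr_ge0 // addr_ge0 // mulr_ge0 // ltW.
- have := sqr_ge0 b; have : 0 <= 2 / b * B2 by rewrite mulr_ge0.
  lra.
- exact: eb2.
- exact: (ds_v H).
- exact: (ds_vdecr H).
- exact: (good_slow hg).
- by [].
- have h := good_Lv hg; have h2 := ler_wpM2l (ltW e0) h; have e0_ := e0; have e2_ := e2.
  have : e * e <= 2^-1 * 1 by apply: ler_pM => //; lra.
  lra.
- exact: (ds_p H).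
- exact: (ds_pdecr H).
- exact: (good_p hg).
- exact: (ds_t1decr H).
- exact: (ds_t1 H).
- exact: (good_t1 hg).
- exact: hwin.
- by move=> y _; exact: normr_ge0.
- exact: e1E.
- by move=> y /[dup] Dy /DA[Sy Ay] h; rewrite e1E //; exact: green_error_left.
- by move=> y /[dup] Dy /DA[Sy Ay] h h'; rewrite e1E //; exact: green_error_mid.
- by move=> y /[dup] Dy /DA[Sy Ay] h; rewrite e1E //; exact: green_error_right.
Qed.

End fixed.
End Setting.

Lemma boot_arith (R : realType) (a c f g M : R) : c <= 2^-1 * M -> `|f - a| <= c ->
  f + g <= 1 -> 0 <= g -> a <= 1 + M / 2.
Proof. by rewrite ler_norml => h1 /andP[h2 _] h3 h4; lra. Qed.

Section Boot.
Context {R : realType} d (Omega : measurableType d) (P : probability Omega R).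
Variables (S : set R) (Q : R.-pker R ~> R) (X : nat -> {RV P >-> R}).
Variables (v s p t1 : R -> R) (b B2 e L A : R).
Hypothesis hX : markov_chain S Q X.
Hypothesis H : drift_setting S Q v s p t1 b B2.
Hypothesis hg : good S Q v s p t1 b e L A.
Hypotheses (e0 : 0 < e) (e2 : e <= 2^-1) (eb : e <= b / 8) (eb2 : e * b <= 2).
Hypothesis eC : err_const b B2 * e <= 2^-1.

Local Notation green := (green X).
Local Notation law := (law X).
Definition upper : set R := S `&` `[A, +oo[.
Definition lower : set R := S `&` `]-oo, A[.

Lemma measurable_upper : measurable upper.
Proof. by apply: measurableI; [exact: (ds_mS H)|exact: measurable_itv]. Qed.
Lemma measurable_lower : measurable lower.
Proof. by apply: measurableI; [exact: (ds_mS H)|exact: measurable_itv]. Qed.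
Let mU := measurable_upper.
Let mD := measurable_lower.

Lemma upperP y : upper y -> S y /\ A <= y.
Proof. by move=> [Sy] /=; rewrite in_itv /= andbT. Qed.
Lemma lowerP y : lower y -> S y /\ y < A.
Proof. by move=> [Sy] /=; rewrite in_itv. Qed.

Let b0 : 0 < b. Proof. exact: (ds_b H). Qed.
Let A0 : 0 <= A. Proof. exact: (good_A hg). Qed.
Let L0 : 0 < L. Proof. exact: lt_le_trans (good_L hg). Qed.
Let v0 x : A <= x -> 0 < v x.
Proof. by move=> Ax; apply: (ds_v H); exact: le_trans Ax. Qed.
Let rate0 x : A <= x -> 0 <= rate v b x.
Proof. by move=> Ax; apply: ltW; rewrite /rate divr_gt0 ?mulr_gt0 ?v0. Qed.
Let gU N : (green N upper < +oo)%E. Proof. exact: green_ltoo. Qed.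
Let gD N : (green N lower < +oo)%E. Proof. exact: green_ltoo. Qed.

(** Restricted to N steps and to states above A, hence finite; only this part of the Green measure
    is bounded at this stage. *)
Definition tent_mass N x := \int[green N]_(y in upper) tent L (y - x).

Lemma bmeas_tent x (D : set R) : bmeas D (fun y => tent L (y - x)).
Proof.
apply: (@bmeasI _ _ _ _ _ 1); first exact: measurable_tent.
by move=> y _; have := tent_itv L0 (y - x) => /andP[h1 h2]; rewrite ger0_norm.
Qed.

(** The tents centred at w' and w' + L sum to 1 on [w', w' + L], where w' is w moved up to A. Their
    mass bounds are comparable because v at most halves over a length L. *)
Lemma window_bound N M : 0 <= M ->
  (forall x, A <= x -> v x / L * tent_mass N x <= M) ->
  forall w : R, (green N (upper `&` `[w, (w + L)%R[) <= (4 * L * M / v (Num.max w A))%:E)%E.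
Proof.
move=> M0 hM w; set w' := Num.max w A.
have Aw : A <= w' by rewrite /w' le_max lexx orbT.
have AwL : A <= w' + L by have := L0; lra.
have tm x : A <= x -> tent_mass N x <= L * M / v x.
  move=> Ax; have vx := v0 Ax; rewrite ler_pdivlMr //.
  have := ler_wpM2l (ltW L0) (hM x Ax).
  by rewrite (_ : L * (v x / L * _) = tent_mass N x * v x) //; field; rewrite gt_eqF.
have mW : measurable (upper `&` `[w, (w + L)%R[) by apply: measurableI => //; exact: measurable_itv.
have gW : (green N (upper `&` `[w, (w + L)%R[) < +oo)%E by exact: green_ltoo.
have h1 : fine (green N (upper `&` `[w, (w + L)%R[)) <= tent_mass N w' + tent_mass N (w' + L).
  rewrite -[leLHS]mul1r -Rintegral_cst //.
  rewrite /tent_mass -bRintD //; [|exact: bmeas_tent..].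
  apply: (@le_trans _ _ (\int[green N]_(y in upper `&` `[w, (w + L)%R[) (tent L (y - w') + tent L (y - (w' + L))))).
    apply: le_bRint => //; [exact: bmeas_cst|by apply: bmeasD; exact: bmeas_tent|].
    move=> y [/upperP[Sy Ay]] /=; rewrite in_itv /= => /andP[hy1 hy2].
    have wy : w' <= y by rewrite /w' ge_max hy1 Ay.
    have yw : y < w' + L by apply: (lt_le_trans hy2); rewrite lerD2r /w' le_max lexx.
    rewrite /tent ger0_norm ?subr_ge0 // ler0_norm; last by rewrite subr_le0 ltW.
    have L0_ := L0.
    have q1 : (y - w') / L <= 1 by rewrite ler_pdivrMr //; lra.
    have q2 : 0 <= (y - w') / L by rewrite divr_ge0 ?subr_ge0 // ltW.
    have -> : - (y - (w' + L)) / L = 1 - (y - w') / L by field; rewrite gt_eqF.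
    rewrite !pos_id; lra.
  have gUN := gU N.
  have i1 : (green N).-integrable upper (EFin \o (fun y => tent L (y - w') + tent L (y - (w' + L)))).
    by apply: bmeas_int => //; apply: bmeasD; exact: bmeas_tent.
  rewrite /Rintegral fine_le //.
  - apply: integrable_fin_num => //; apply: integrableS i1 => //.
  - exact: integrable_fin_num.
  - apply: ge0_subset_integral => //.
    + by case/integrableP: i1.
    + move=> y _; rewrite lee_fin.
      by have /andP[h3 _] := tent_itv L0 (y - w'); have /andP[h4 _] := tent_itv L0 (y - (w' + L)); lra.
rewrite -(@fineK _ (green N _)) ?ge0_fin_numE // lee_fin (le_trans h1) //.
rewrite (le_trans (lerD (tm _ Aw) (tm _ AwL))) //.
have e0_ := e0; have e2_ := e2; have L0_ := L0.
have vw := v0 Aw.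
have h2 := good_slow hg Aw (_ : w' <= w' + L).
have {}h2 : (v (w' + L))^-1 - (v w')^-1 <= e * (w' + L - w') by apply: h2; lra.
have h3 : e * L <= (v w')^-1.
  rewrite -div1r ler_pdivlMr // -mulrA.
  have : L * v w' <= e.
    apply: le_trans (good_Lv hg); rewrite ler_wpM2l ?(ds_vdecr H) //; exact: ltW.
  have Lv : 0 <= L * v w' by rewrite mulr_ge0 // ltW.
  move=> h; apply: (@le_trans _ _ (1 * 1)); last by rewrite mulr1.
  by apply: ler_pM => //; [exact: ltW|lra|lra].
have LM : 0 <= L * M by rewrite mulr_ge0 // ltW.
have h4 : (v (w' + L))^-1 <= 2 * (v w')^-1 by lra.
have := ler_wpM2l LM h4.
have : 0 <= L * M * (v w')^-1 by rewrite mulr_ge0 // invr_ge0 ltW.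
lra.
Qed.

Definition capped (f : R -> R) (y : R) := f (Num.max y A).

Let f_le1 x y : A <= x -> 0 <= green_fun v b L x y <= 1.
Proof.
move=> Ax; apply/andP; split; first exact: ltW (profile_gt0 _ _ _).
by apply: profile_le1 => //; exact: rate0.
Qed.

Let f_noninc x y y' : A <= x -> y <= y' -> green_fun v b L x y' <= green_fun v b L x y.
Proof.
by move=> Ax yy; apply: profile_noninc => //; [exact: rate0|rewrite lerD2r].
Qed.

Let bf x : A <= x -> bmeas setT (green_fun v b L x).
Proof. by move=> Ax; apply: (bmeas_green_fun H hg). Qed.

Lemma bmeas_capped x : A <= x -> bmeas setT (capped (green_fun v b L x)).
Proof.
move=> Ax; apply: (@bmeasI _ _ _ _ _ 1).
  apply: measurableT_comp; first by case: (bf Ax).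
  by apply: measurable_maxr => //; exact: measurable_cst.
by move=> y _; have /andP[h1 h2] := f_le1 (Num.max y A) Ax; rewrite ger0_norm.
Qed.

Let law0_le x N : A <= x ->
  \int[law 0]_y capped (green_fun v b L x) y - \int[law N]_y capped (green_fun v b L x) y <= 1.
Proof.
move=> Ax; have bc := bmeas_capped Ax.
have h1 : \int[law 0]_y capped (green_fun v b L x) y <= 1.
  apply: (@le_trans _ _ (\int[law 0]_y 1)).
    apply: le_bRint => //; [exact: law_ltoo|exact: bmeas_cst|].
    by move=> y _; have /andP[] := f_le1 (Num.max y A) Ax.
  by rewrite Rintegral_cst // law1 /= mulr1.
have : 0 <= \int[law N]_y capped (green_fun v b L x) y.
  by apply: Rintegral_ge0 => y _; have /andP[] := f_le1 (Num.max y A) Ax.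
lra.
Qed.

Lemma capped_split N x : A <= x ->
  \int[green N]_(y in upper) (green_fun v b L x y - transition Q (green_fun v b L x) y)
  + \int[green N]_(y in lower)
      (capped (green_fun v b L x) y - transition Q (capped (green_fun v b L x)) y) <= 1.
Proof.
move=> Ax; have bc := bmeas_capped Ax; have bfx := bf Ax.
set f := green_fun v b L x in bc bfx *.
apply: le_trans (law0_le N Ax).
have bct := bmeas_transition Q bc; have bft := bmeas_transition Q bfx.
have gT : (green N setT < +oo)%E by exact: green_ltoo.
rewrite -(green_telescope hX N bc) (Rintegral_states hX A (green_states hX N) gT); last exact: bmeasB.
rewrite lerD2r; apply: (le_bRint mU (gU N)).
- exact: bmeasS (bmeasB bfx bft).
- exact: bmeasS (bmeasB bc bct).
move=> y /upperP[Sy Ay]; apply: lerB; first by rewrite /capped max_l.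
apply: (le_bRint measurableT (Q_ltoo Q y measurableT) bc bfx).
by move=> z _; apply: f_noninc => //; rewrite le_max lexx.
Qed.

Lemma capped_lower_ge0 N x : A <= x ->
  0 <= \int[green N]_(y in lower)
      (capped (green_fun v b L x) y - transition Q (capped (green_fun v b L x)) y).
Proof.
move=> Ax; have bc := bmeas_capped Ax.
apply: Rintegral_ge0 => y /lowerP[Sy yA]; rewrite subr_ge0 /capped max_r; last exact: ltW.
apply: (@le_trans _ _ (\int[Q y]_z green_fun v b L x A)).
  apply: le_bRint => //; [exact: Q_ltoo|exact: bmeas_cst|].
  by move=> z _; apply: f_noninc => //; rewrite le_max lexx orbT.
by rewrite Rintegral_cst // Q1 mulr1.
Qed.

Definition total_error N x := \int[green N]_(y in upper) green_error Q v b L x y.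

Let bmeas_err x : A <= x -> bmeas setT (green_error Q v b L x).
Proof.
move=> Ax; apply: bmeas_norm; apply: bmeasB.
  by apply: bmeasB; [exact: bf|apply: bmeas_transition; exact: bf].
by apply: bmeasZ; exact: bmeas_tent.
Qed.

Lemma total_error_le N M x : A <= x -> 0 <= M ->
  (forall x, A <= x -> v x / L * tent_mass N x <= M) ->
  total_error N x <= err_const b B2 * M * e.
Proof.
move=> Ax M0 hM.
have := green_error_sum H hg e0 e2 eb eb2 Ax M0 (window_bound M0 hM).
by rewrite -/upper -bRint_EFin //; exact: bmeasS (bmeas_err Ax).
Qed.

Lemma tent_upper_approx N x : A <= x ->
  `|\int[green N]_(y in upper) (green_fun v b L x y - transition Q (green_fun v b L x) y)
    - v x / L * tent_mass N x| <= total_error N x.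
Proof.
move=> Ax; have bfx := bf Ax; have bft := bmeas_transition Q bfx.
have b1 : bmeas upper (fun y => green_fun v b L x y - transition Q (green_fun v b L x) y).
  exact: bmeasS (bmeasB bfx bft).
rewrite -bRintZ //; last exact: bmeas_tent.
rewrite -bRintB //; last by apply: bmeasZ; exact: bmeas_tent.
apply: le_norm_bRint => //; first by apply: bmeasB => //; apply: bmeasZ; exact: bmeas_tent.
exact: bmeasS (bmeas_err Ax).
Qed.

(** The accumulated error is at most M / 2 since [err_const b B2 * e] is at most 1 / 2; the low
    states contribute a nonnegative term, which is dropped. *)
Lemma boot_step N M : 0 <= M ->
  (forall x, A <= x -> v x / L * tent_mass N x <= M) ->
  forall x, A <= x -> v x / L * tent_mass N x <= 1 + M / 2.
Proof.
move=> M0 hM x Ax.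
have h1 : total_error N x <= 2^-1 * M.
  apply: (le_trans (total_error_le Ax M0 hM)).
  by rewrite mulrAC; exact: ler_wpM2r.
have h2 := tent_upper_approx N Ax; have h3 := capped_split N Ax.
have h4 := capped_lower_ge0 N Ax.
exact: boot_arith h1 h2 h3 h4.
Qed.

(** Iterates M -> 1 + M / 2, whose fixed point is 2. The starting bound depends on N through the
    finite mass C, but this dependence disappears in the limit. *)
Lemma tent_bound N x : A <= x -> v x / L * tent_mass N x <= 2.
Proof.
pose C := v A / L * fine (green N upper).
have C0 : 0 <= C.
  by rewrite mulr_ge0 ?fine_ge0 // divr_ge0 //; apply: ltW => //; exact: v0.
have base y : A <= y -> v y / L * tent_mass N y <= 2 + C.
  move=> Ay; apply: (@le_trans _ _ C); last by rewrite lerDr.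
  apply: ler_pM.
  - by rewrite divr_ge0 //; apply: ltW => //; exact: v0.
  - by apply: Rintegral_ge0 => z _; case/andP: (tent_itv L0 (z - y)).
  - by rewrite ler_wpM2r ?invr_ge0 ?(ds_vdecr H) // ltW.
  - rewrite -[leRHS]mul1r -Rintegral_cst //; apply: le_bRint => //; [exact: bmeas_tent|exact: bmeas_cst|].
    by move=> z _; case/andP: (tent_itv L0 (z - y)).
have step k : forall y, A <= y -> v y / L * tent_mass N y <= 2 + C / 2 ^+ k.
  elim: k => [|k IH] y Ay; first by rewrite expr0 divr1; exact: base.
  have M0 : 0 <= 2 + C / 2 ^+ k by rewrite addr_ge0 // divr_ge0 // exprn_ge0.
  have := boot_step M0 IH Ay; rewrite exprSr invfM mulrA; lra.
move=> Ax; apply/ler_addgt0Pr => eps eps0.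
have [k hk] : exists k, C / 2 ^+ k <= eps.
  exists (Num.truncn (C / eps)).+1; rewrite ler_pdivrMr ?exprn_gt0 //.
  rewrite -ler_pdivrMl // mulrC.
  have h : C / eps < (Num.truncn (C / eps)).+1%:R by exact: truncnS_gt.
  apply: (le_trans (ltW h)); rewrite -natrX ler_nat; apply: ltnW; exact: ltn_expl.
by apply: (le_trans (step k x Ax)); rewrite lerD2l.
Qed.

Lemma window_bound8 N (w : R) :
  (green N (upper `&` `[w, (w + L)%R[) <= (8 * L / v (Num.max w A))%:E)%E.
Proof.
have := window_bound (ler0n _ 2) (tent_bound N) w.
by rewrite (_ : 4 * L * 2 = 8 * L) //; ring.
Qed.

Lemma total_error_small N x : A <= x -> total_error N x <= 2 * err_const b B2 * e.
Proof.
move=> Ax; have := total_error_le Ax (ler0n _ 2) (tent_bound N).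
by rewrite (_ : _ * 2 * e = 2 * err_const b B2 * e) //; ring.
Qed.

End Boot.

(** * Transience *)

Lemma upcross_arith (R : realType) (g f a c u l : R) : f + g <= 1 -> `|f - a| <= c ->
  c <= 2 * u * l -> 0 <= a -> u * l <= 2^-1 -> g <= 2.
Proof. by rewrite ler_norml => h1 /andP[h2 _] h3 h4 h5; lra. Qed.

Section Transience.
Context {R : realType} d (Omega : measurableType d) (P : probability Omega R).
Variables (S : set R) (Q : R.-pker R ~> R) (X : nat -> {RV P >-> R}).
Variables (v s p t1 : R -> R) (b B2 e L A : R).
Hypothesis hX : markov_chain S Q X.
Hypothesis H : drift_setting S Q v s p t1 b B2.
Hypothesis hg : good S Q v s p t1 b e L A.
Hypotheses (e0 : 0 < e) (e2 : e <= 2^-1) (eb : e <= b / 8) (eb2 : e * b <= 2).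
Hypothesis eC : err_const b B2 * e <= 2^-1.
Hypothesis hlimsup : {ae P, forall w, limn_esup (fun n => (X n w)%:E) = +oo%E}.

Local Notation green := (green X).
Local Notation law := (law X).
Local Notation upper := (upper S A).
Local Notation lower := (lower S A).
Local Notation tent_mass := (tent_mass S X L A).

Let b0 : 0 < b. Proof. exact: (ds_b H). Qed.
Let A0 : 0 <= A. Proof. exact: (good_A hg). Qed.
Let L0 : 0 < L. Proof. exact: lt_le_trans (good_L hg). Qed.
Let mU : measurable upper. Proof. exact: measurable_upper H. Qed.
Let mD : measurable lower. Proof. exact: measurable_lower H. Qed.
Let v0 x : A <= x -> 0 < v x.
Proof. by move=> Ax; apply: (ds_v H); exact: le_trans Ax. Qed.
Let rate0 x : A <= x -> 0 < rate v b x.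
Proof. by move=> Ax; rewrite /rate divr_gt0 ?mulr_gt0 ?v0. Qed.

Definition ray (B : R) : set R := `[B, +oo[%classic.

Lemma measurable_ray B : measurable (ray B).
Proof. exact: measurable_itv. Qed.

Definition upcross n (B : R) : set Omega :=
  X n @^-1` lower `&` X n.+1 @^-1` ray B.

Lemma measurable_upcross n B : measurable (upcross n B).
Proof.
apply: measurableI; rewrite -[_ @^-1` _]setTI; apply: measurable_funP => //; exact: measurable_ray.
Qed.

Lemma P_upcross n B : P (upcross n B) = (\int[law n]_(y in lower) Q y (ray B))%E.
Proof. by rewrite /upcross (law_pair hX) //; exact: measurable_ray. Qed.

Lemma upcross_far_le : exists K : R, forall N,
  (\int[green N]_(y in lower) Q y (ray (A + L)) <= K%:E)%E.
Proof.
set f := green_fun v b L A.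
have hk := rate0 (lexx A).
have c0 : 0 < f A - f (A + L).
  have L0_ := L0.
  rewrite subr_gt0 /f /green_fun /profile ltr_expR ltrN2 ltr_pM2l //.
  rewrite addrAC subrr add0r (theta_right L0 (lexx L)).
  rewrite /theta mul0r splineC //; lra.
exists (2 / (f A - f (A + L))) => N.
have gD : (green N lower < +oo)%E by exact: green_ltoo.
have gU : (green N upper < +oo)%E by exact: green_ltoo.
pose I := fun z : R => \1_(ray (A + L)) z : R.
have bI : bmeas setT I.
  apply: (@bmeasI _ _ _ _ _ 1); first by apply: measurable_indic; exact: measurable_ray.
  by move=> z _; rewrite /I indicE; case: (_ \in _); rewrite ?normr1 ?normr0.
have bq := bmeas_transition Q bI.
have qE y : (Q y (ray (A + L)) = (transition Q I y)%:E)%E.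
  rewrite /transition bRint_EFin ?Q_ltoo // integral_indic //; last exact: measurable_ray.
  by rewrite setIT.
under eq_integral do rewrite qE.
rewrite -bRint_EFin //; last exact: bmeasS bq.
rewrite lee_fin ler_pdivlMr // mulrC -bRintZ //; last exact: bmeasS bq.
have bc := bmeas_capped H hg (lexx A); have bct := bmeas_transition Q bc.
have bf : bmeas setT f := bmeas_green_fun H hg (lexx A).
have r0 : 0 <= rate v b A by exact: ltW.
have fn y y' : y <= y' -> f y' <= f y.
  by move=> yy; apply: profile_noninc => //; rewrite lerD2r.
have h1 : \int[green N]_(y in lower) ((f A - f (A + L)) * transition Q I y) <=
    \int[green N]_(y in lower) (capped A f y - transition Q (capped A f) y).
  apply: (le_bRint mD gD); first exact: bmeasZ (bmeasS _ bq).
    exact: bmeasS (bmeasB bc bct).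
  move=> y /lowerP[Sy yA]; rewrite lerBrDr.
  have -> : capped A f y = \int[Q y]_z (f A).
    by rewrite (Rintegral_cst _ measurableT) Q1 mulr1 /capped max_r // ltW.
  rewrite /transition -(bRintZ measurableT (Q_ltoo Q y measurableT) _ bI).
  rewrite -(bRintD measurableT (Q_ltoo Q y measurableT) (bmeasZ _ bI) bc).
  apply: (le_bRint measurableT (Q_ltoo Q y measurableT)).
  - by apply: bmeasD => //; exact: bmeasZ.
  - exact: bmeas_cst.
  move=> z _; rewrite /I indicE /capped; have [zr|zr] := pselect (ray (A + L) z).
    rewrite mem_set // mulr1; move: zr; rewrite /ray /= in_itv /= andbT => zr.
    rewrite -[leRHS](subrK (f (A + L))) lerD2l; apply: fn; by rewrite le_max zr.
  rewrite memNset // mulr0 add0r; apply: fn; rewrite le_max lexx orbT //.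
apply: (le_trans h1).
have h2 := capped_split hX H hg N (lexx A).
have h3 := tent_upper_approx X H hg N (lexx A).
have h4 := total_error_small hX H hg e0 e2 eb eb2 eC N (lexx A).
have h5 : 0 <= v A / L * tent_mass N A.
  rewrite mulr_ge0 //; first by rewrite divr_ge0 //; apply: ltW => //; exact: v0.
  by apply: Rintegral_ge0 => z _; case/andP: (tent_itv L0 (z - A)).
apply: upcross_arith h2 h3 h4 h5 _; have := eC; lra.
Qed.

Lemma green_window N w : A <= w ->
  (green N (upper `&` `[w, (w + L)%R[) <= (8 * L / v w)%:E)%E.
Proof.
move=> Aw; have := window_bound8 hX H hg e0 e2 eb eb2 eC N w.
by rewrite max_l.
Qed.

(** Crossings that land in [A, A + L) are counted by the window bound, those landing further by
    [upcross_far_le]. *)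
Lemma upcross_le : exists K : R, forall N, (\sum_(n < N) P (upcross n A) <= K%:E)%E.
Proof.
have [K hK] := upcross_far_le.
exists (K + 8 * L / v A) => N.
have mI : measurable (upper `&` `[A, (A + L)%R[) by apply: measurableI => //; exact: measurable_itv.
apply: (@le_trans _ _ (\sum_(n < N) (P (upcross n (A + L)) + law n.+1 (upper `&` `[A, (A + L)%R[)))%E).
  apply: lee_sum => n _.
  apply: (@le_trans _ _ (P (upcross n (A + L) `|` X n.+1 @^-1` (upper `&` `[A, (A + L)%R[)))).
    apply: le_measure; rewrite ?inE.
    - exact: measurable_upcross.
    - apply: measurableU; first exact: measurable_upcross.
      by rewrite -[_ @^-1` _]setTI; apply: measurable_funP.
    - move=> w [h1]; rewrite /upcross /ray /= in_itv /= andbT => h2.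
      have [h3|h3] := leP (A + L) (X n.+1 w); [left|right].
        by split => //=; rewrite in_itv /= andbT.
      split; last by rewrite /= in_itv /= h2.
      by split; [case: hX => _ _ hS _; exact: hS|rewrite /= in_itv /= andbT].
  apply: measureU2; first exact: measurable_upcross.
  by rewrite -[_ @^-1` _]setTI; apply: measurable_funP.
rewrite big_split /= EFinD leeD //.
  apply: le_trans (hK N); rewrite ge0_integral_measure_sum //; last first.
    by apply: measurable_funTS; exact: (measurable_kernel Q _ (measurable_ray _)).
  by apply: lee_sum => n _; rewrite P_upcross.
apply: le_trans (green_window N.+1 (lexx A)).
rewrite [leRHS](_ : _ = (\sum_(n < N.+1) law n (upper `&` `[A, (A + L)%R[))%E) //.
by rewrite big_ord_recl leeDr.
Qed.

Lemma upcross_tail (eps : R) : 0 < eps -> exists n0, forall n, (n0 <= n)%N ->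
  (\sum_(n <= m <oo) P (upcross m A) <= eps%:E)%E.
Proof.
move=> eps0; have [K hK] := upcross_le.
have fin : (\sum_(0 <= n <oo) P (upcross n A) < +oo)%E.
  apply: (@le_lt_trans _ _ K%:E); last exact: ltry.
  apply: lime_le; first exact: is_cvg_nneseries.
  by apply: nearW => N; rewrite big_mkord.
have := @nneseries_tail_cvg R (fun n => P (upcross n A)) xpredT fin (fun k _ => measure_ge0 _ _).
move/fine_cvgP => [h1 /cvgrPdist_le /(_ _ eps0) h2].
have [n0 _ h3] := h1; have [n1 _ h4] := h2.
exists (maxn n0 n1) => n; rewrite geq_max => /andP[n0n n1n].
have := h4 n n1n; have := h3 n n0n => /=; rewrite sub0r normrN => f1 f2.
rewrite -(fineK f1) lee_fin; apply: le_trans f2; exact: ler_norm.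
Qed.

(** Since the limsup is infinite, a path below A at time n almost surely crosses A at a later step,
    so the probability is at most a tail of the convergent series of crossing probabilities. *)
Lemma law_lower_cvg (eps : R) : 0 < eps -> exists n0, forall n, (n0 <= n)%N ->
  (law n lower <= eps%:E)%E.
Proof.
move=> eps0; have [n0 hn0] := upcross_tail eps0; exists n0 => n n0n.
apply: le_trans (hn0 n n0n).
have -> : law n lower = P (X n @^-1` lower) by [].
have [N0 [mN0 PN0 subN0]] := hlimsup.
have mXl : measurable (X n @^-1` lower) by rewrite -[_ @^-1` _]setTI; apply: measurable_funP.
have mD0 : measurable ((X n @^-1` lower) `\` N0) by exact: measurableD.
apply: (@le_trans _ _ (P ((X n @^-1` lower) `\` N0))).
  apply: (@le_trans _ _ (P (((X n @^-1` lower) `\` N0) `|` N0))).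
    apply: le_measure; [by rewrite inE|by rewrite inE; exact: measurableU|].
    by move=> w hw; have [h|h] := pselect (N0 w); [right|left].
  apply: (le_trans (measureU2 _ mD0 mN0)); rewrite -[leRHS]adde0 leeD //.
  by rewrite le_eqVlt; apply/orP; left; apply/eqP; exact: PN0.
apply: measure_sigma_subadditive_tail => //; first by move=> m; exact: measurable_upcross.
move=> w [hw nN0]; apply: contrapT => hno.
apply: nN0; apply: subN0 => /= hw1.
(* Without a later crossing the path would stay below A, against the infinite limsup. *)
have below m : (n <= m)%N -> X m w < A.
  elim: m => [|m IH]; first by rewrite leqn0 => /eqP <-; have [] := lowerP hw.
  rewrite leq_eqVlt => /predU1P[<-|nm]; first by have [] := lowerP hw.
  rewrite ltNge; apply/negP => hA; apply: hno; exists m => /=.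
    by apply/negP; rewrite -leqNgt.
  split; last by rewrite /ray /= in_itv /= andbT.
  by split; [case: hX => _ _ hS _; exact: hS|rewrite /= in_itv /= IH].
have : (limn_esup (fun n => (X n w)%:E) <= A%:E)%E.
  apply: (@le_trans _ _ (ereal_sup ((fun n => (X n w)%:E) @` [set m | (n <= m)%N]))).
    apply: ereal_inf_lbound; exists [set m | (n <= m)%N] => //.
    exact: nbhs_infty_ge.
  apply: ge_ereal_sup => _ [m nm <-]; rewrite lee_fin ltW //; exact: below.
by rewrite hw1 leye_eq.
Qed.

End Transience.

Section Series.
Context {R : realType}.

Lemma nneseries_tail_small (a : nat -> \bar R) (K : R) : (forall n, 0 <= a n)%E ->
  (forall N, (\sum_(n < N) a n <= K%:E)%E) ->
  forall eps : R, 0 < eps -> exists n0, forall n, (n0 <= n)%N ->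
  (\sum_(n <= m <oo) a m <= eps%:E)%E.
Proof.
move=> a0 hK eps eps0.
have fin : (\sum_(0 <= n <oo) a n < +oo)%E.
  apply: (@le_lt_trans _ _ K%:E); last exact: ltry.
  apply: lime_le; first exact: is_cvg_nneseries.
  by apply: nearW => N; rewrite big_mkord.
have := @nneseries_tail_cvg R a xpredT fin (fun k _ => a0 k).
move/fine_cvgP => [h1 /cvgrPdist_le /(_ _ eps0) h2].
have [n0 _ h3] := h1; have [n1 _ h4] := h2.
exists (maxn n0 n1) => n; rewrite geq_max => /andP[n0n n1n].
have := h4 n n1n; have := h3 n n0n => /=; rewrite sub0r normrN => f1 f2.
rewrite -(fineK f1) lee_fin; apply: le_trans f2; exact: ler_norm.
Qed.

Lemma nneseries_term_small (a : nat -> \bar R) (K : R) : (forall n, 0 <= a n)%E ->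
  (forall N, (\sum_(n < N) a n <= K%:E)%E) ->
  forall eps : R, 0 < eps -> exists n0, forall n, (n0 <= n)%N -> (a n <= eps%:E)%E.
Proof.
move=> a0 hK eps eps0; have [n0 h] := nneseries_tail_small a0 hK eps0.
exists n0 => n /h; apply: le_trans.
apply: (@le_trans _ _ (\sum_(n <= m < n.+1) a m)%E); first by rewrite big_nat1.
exact: nneseries_lim_ge.
Qed.

End Series.

Lemma tent_arith (R : realType) (a f g c u E0 EN e : R) : `|f - a| <= c -> f + g = E0 - EN ->
  0 <= g -> g <= u -> 1 - E0 <= e -> E0 <= 1 -> 0 <= EN -> EN <= e -> u <= 2 * e ->
  `|a - 1| <= c + 4 * e.
Proof.
rewrite ler_norml => /andP[h1 h2] h3 h4 h5 h6 h7 h8 h9 h10.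
by rewrite ler_norml; apply/andP; split; lra.
Qed.

(** * Tent masses at the large scale *)

Section TentAsymptotics.
Context {R : realType} d (Omega : measurableType d) (P : probability Omega R).
Variables (S : set R) (Q : R.-pker R ~> R) (X : nat -> {RV P >-> R}).
Variables (v s p t1 : R -> R) (b B2 e L A : R).
Hypothesis hX : markov_chain S Q X.
Hypothesis H : drift_setting S Q v s p t1 b B2.
Hypothesis hg : good S Q v s p t1 b e L A.
Hypotheses (e0 : 0 < e) (e2 : e <= 2^-1) (eb : e <= b / 8) (eb2 : e * b <= 2).
Hypothesis eC : err_const b B2 * e <= 2^-1.
Hypothesis hlimsup : {ae P, forall w, limn_esup (fun n => (X n w)%:E) = +oo%E}.

Local Notation green := (green X).
Local Notation law := (law X).
Local Notation upper := (upper S A).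
Local Notation lower := (lower S A).
Local Notation tent_mass := (tent_mass S X L A).
Local Notation upcross := (upcross S X A).

Let b0 : 0 < b. Proof. exact: (ds_b H). Qed.
Let A0 : 0 <= A. Proof. exact: (good_A hg). Qed.
Let L0 : 0 < L. Proof. exact: lt_le_trans (good_L hg). Qed.
Let mU : measurable upper. Proof. exact: measurable_upper H. Qed.
Let mD : measurable lower. Proof. exact: measurable_lower H. Qed.
Let v0 x : A <= x -> 0 < v x.
Proof. by move=> Ax; apply: (ds_v H); exact: le_trans Ax. Qed.
Let rate0 x : A <= x -> 0 < rate v b x.
Proof. by move=> Ax; rewrite /rate divr_gt0 ?mulr_gt0 ?v0. Qed.
Let mS : measurable S. Proof. exact: (ds_mS H). Qed.
Let mbelow (B : R) : measurable (S `&` `]-oo, B[).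
Proof. by apply: measurableI => //; exact: measurable_itv. Qed.

Lemma law_window_cvg w (eps : R) : A <= w -> 0 < eps -> exists n0, forall n, (n0 <= n)%N ->
  (law n (upper `&` `[w, (w + L)%R[) <= eps%:E)%E.
Proof.
move=> Aw; apply: (@nneseries_term_small R _ (8 * L / v w)) => // N.
exact: le_trans (green_window hX H hg e0 e2 eb eb2 eC N Aw).
Qed.

(** Climbs from A to B by windows of length L, each with Green mass bounded in N and hence of
    vanishing probability. *)
Lemma law_below_cvg (B : R) (eps : R) : 0 < eps -> exists n0, forall n, (n0 <= n)%N ->
  (law n (S `&` `]-oo, B[) <= eps%:E)%E.
Proof.
move=> eps0; pose k := (Num.truncn ((B - A) / L)).+1.
have Bk : B <= A + k%:R * L.
  have : (B - A) / L < k%:R by exact: truncnS_gt.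
  by rewrite ltr_pdivrMr //; lra.
suff : forall eps : R, 0 < eps -> exists n0, forall n, (n0 <= n)%N ->
    (law n (S `&` `]-oo, (A + k%:R * L)%R[) <= eps%:E)%E.
  move=> /(_ eps eps0)[n0 h]; exists n0 => n /h; apply: le_trans.
  apply: le_measure; rewrite ?inE //.
  move=> y [Sy]; rewrite /= !in_itv /= => yB; split => //; exact: lt_le_trans Bk.
move: k {Bk} => k; elim: k => [|k IH] {eps0}eps eps0.
  rewrite mul0r addr0.
  exact: (law_lower_cvg hX H hg e0 e2 eb eb2 eC hlimsup eps0).
have eps2 : 0 < eps / 2 by rewrite divr_gt0.
have Aw : A <= A + k%:R * L by rewrite lerDl mulr_ge0 // ltW.
have [n0 h0] := IH _ eps2; have [n1 h1] := law_window_cvg Aw eps2.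
exists (maxn n0 n1) => n; rewrite geq_max => /andP[/h0 h2 /h1 h3].
have mW : measurable (upper `&` `[(A + k%:R * L)%R, (A + k%:R * L + L)%R[).
  by apply: measurableI => //; exact: measurable_itv.
apply: (@le_trans _ _ (law n ((S `&` `]-oo, (A + k%:R * L)%R[) `|`
    (upper `&` `[(A + k%:R * L)%R, (A + k%:R * L + L)%R[)))).
  apply: le_measure; [by rewrite inE|by rewrite inE; exact: measurableU|].
  move=> y [Sy]; rewrite /= !in_itv /= -natr1 => yB.
  have [h|h] := leP (A + k%:R * L) y; [right|left; split => //=; by rewrite in_itv].
  split; first by split => //=; rewrite in_itv /= andbT (le_trans Aw).
  by move: yB; rewrite mulrDl mul1r addrA.
apply: (le_trans (measureU2 _ (mbelow _) mW)); apply: (le_trans (leeD h2 h3)).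
by rewrite -EFinD -splitr.
Qed.

Lemma law_ray_cvg n (eps : R) : 0 < eps -> exists B0, forall B, B0 <= B ->
  (law n (ray B) <= eps%:E)%E.
Proof.
move=> eps0; have := @cvg_ccdfy0 _ _ _ P (X n).
move/fine_cvgP => [h1 /cvgrPdist_le /(_ _ eps0) h2].
have [M0 [_ h3]] := h1; have [M1 [_ h4]] := h2.
exists (Num.max M0 M1 + 2) => B hB.
have hM : M0 < B - 1 /\ M1 < B - 1.
  have : M0 <= Num.max M0 M1 by rewrite le_max lexx.
  have : M1 <= Num.max M0 M1 by rewrite le_max lexx orbT.
  lra.
have := h4 _ hM.2; have := h3 _ hM.1 => /=; rewrite sub0r normrN => f1 f2.
apply: (@le_trans _ _ (ccdf (X n) (B - 1))).
  rewrite /ccdf; apply: le_measure; rewrite ?inE //; first exact: measurable_ray.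
  by move=> y; rewrite /ray /= !in_itv /= !andbT; lra.
rewrite -(fineK f1) lee_fin; apply: le_trans f2; exact: ler_norm.
Qed.

Let mup n B : measurable (upcross n B).
Proof. exact: (measurable_upcross X A H). Qed.

Let upcrossS n B : A <= B -> (P (upcross n B) <= P (upcross n A))%E.
Proof.
move=> AB; apply: le_measure; rewrite ?inE //.
move=> w [h2 h3]; split => //; move: h3; rewrite /ray /= !in_itv /= !andbT.
exact: le_trans.
Qed.

(** Late crossings are bounded by the tail of the convergent series at level A; each of the finitely
    many early ones becomes rare as B grows. The bound is uniform in N. *)
Lemma upcross_far_small (eps : R) : 0 < eps -> exists B0, forall B, B0 <= B ->
  forall N, (\sum_(n < N) P (upcross n B) <= (2 * eps)%:E)%E.
Proof.
move=> eps0.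
have [K hK] := upcross_le hX H hg e0 e2 eb eb2 eC.
have [n0 /(_ _ (leqnn n0)) hn0] := nneseries_tail_small (fun n => measure_ge0 P (upcross n A)) hK eps0.
have [B0 hB0] : exists B0, forall B, B0 <= B -> (\sum_(n < n0) P (upcross n B) <= eps%:E)%E.
  have : forall eps : R, 0 < eps -> exists B0, forall B, B0 <= B -> (\sum_(n < n0) P (upcross n B) <= eps%:E)%E.
    elim: n0 {hn0} => [|n IH] eps' eps0'.
      by exists 0 => B _; rewrite big_ord0 lee_fin ltW.
    have e2' : 0 < eps' / 2 by rewrite divr_gt0.
    have [B0 h0] := IH _ e2'; have [B1 h1] := law_ray_cvg n.+1 e2'.
    exists (Num.max B0 B1) => B; rewrite ge_max => /andP[/h0 h2 /h1 h3].
    rewrite big_ord_recr /= [eps'%:E](_ : _ = (eps' / 2)%:E + (eps' / 2)%:E)%E; last first.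
      by rewrite -EFinD -splitr.
    rewrite leeD //; apply: le_trans h3.
    have -> : law n.+1 (ray B) = P (X n.+1 @^-1` ray B) by [].
    apply: le_measure; rewrite ?inE //; last by move=> w [].
    by rewrite -[_ @^-1` _]setTI; apply: measurable_funP => //; exact: measurable_ray.
  by apply.
exists (Num.max B0 A) => B; rewrite ge_max => /andP[/hB0 h1 AB] N.
apply: (@le_trans _ _ (\sum_(n < n0 + N) P (upcross n B))%E).
  rewrite -!(big_mkord xpredT (fun n => P (upcross n B))).
  by apply: lee_sum_nneg_natr => //; exact: leq_addl.
rewrite big_split_ord /= [(2 * eps)%:E](_ : _ = eps%:E + eps%:E)%E; last first.
  by rewrite -EFinD; congr EFin; ring.
rewrite leeD //; apply: le_trans hn0.
apply: (@le_trans _ _ (\sum_(n0 <= m < n0 + N) P (upcross m A))%E).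
  have -> : (\sum_(n0 <= m < n0 + N) P (upcross m A) = \sum_(i < N) P (upcross (i + n0) A))%E.
    by rewrite -{1}[n0]add0n big_addn addnC addnK big_mkord.
  by apply: lee_sum => n _; rewrite addnC; exact: upcrossS.
exact: nneseries_lim_ge.
Qed.

End TentAsymptotics.

Section TentAsymptotics2.
Context {R : realType} d (Omega : measurableType d) (P : probability Omega R).
Variables (S : set R) (Q : R.-pker R ~> R) (X : nat -> {RV P >-> R}).
Variables (v s p t1 : R -> R) (b B2 e L A : R).
Hypothesis hX : markov_chain S Q X.
Hypothesis H : drift_setting S Q v s p t1 b B2.
Hypothesis hg : good S Q v s p t1 b e L A.
Hypotheses (e0 : 0 < e) (e2 : e <= 2^-1) (eb : e <= b / 8) (eb2 : e * b <= 2).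
Hypothesis eC : err_const b B2 * e <= 2^-1.
Hypothesis hlimsup : {ae P, forall w, limn_esup (fun n => (X n w)%:E) = +oo%E}.

Local Notation green := (green X).
Local Notation law := (law X).
Local Notation upper := (upper S A).
Local Notation lower := (lower S A).
Local Notation tent_mass := (tent_mass S X L A).
Local Notation upcross := (upcross S X A).

Let b0 : 0 < b. Proof. exact: (ds_b H). Qed.
Let A0 : 0 <= A. Proof. exact: (good_A hg). Qed.
Let L0 : 0 < L. Proof. exact: lt_le_trans (good_L hg). Qed.
Let mU : measurable upper. Proof. exact: measurable_upper H. Qed.
Let mD : measurable lower. Proof. exact: measurable_lower H. Qed.
Let v0 x : A <= x -> 0 < v x.
Proof. by move=> Ax; apply: (ds_v H); exact: le_trans Ax. Qed.
Let rate0 x : A <= x -> 0 < rate v b x.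
Proof. by move=> Ax; rewrite /rate divr_gt0 ?mulr_gt0 ?v0. Qed.
Let mS : measurable S. Proof. exact: (ds_mS H). Qed.
Let mbelow (B : R) : measurable (S `&` `]-oo, B[).
Proof. by apply: measurableI => //; exact: measurable_itv. Qed.

Let bf x : A <= x -> bmeas setT (green_fun v b L x).
Proof. by move=> Ax; exact: (bmeas_green_fun H hg Ax). Qed.

Let f1 x y : A <= x -> 0 <= green_fun v b L x y <= 1.
Proof.
move=> Ax; apply/andP; split; first exact: ltW (profile_gt0 _ _ _).
by apply: profile_le1 => //; exact: ltW (rate0 Ax).
Qed.

Definition ray_ind (B z : R) : R := \1_(ray B) z.

Lemma bmeas_ray_ind B (D : set R) : bmeas D (ray_ind B).
Proof.
apply: (@bmeasI _ _ _ _ _ 1); first by apply: measurable_indic; exact: measurable_ray.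
by move=> z _; rewrite /ray_ind indicE; case: (_ \in _); rewrite ?normr1 ?normr0.
Qed.

Lemma transition_ray_ind B y : Q y (ray B) = (transition Q (ray_ind B) y)%:E.
Proof.
rewrite /transition bRint_EFin ?Q_ltoo //; last exact: bmeas_ray_ind.
by rewrite integral_indic ?setIT //; exact: measurable_ray.
Qed.

Let f_ray x z : A <= x -> 1 - green_fun v b L x z <= ray_ind (x - L) z.
Proof.
move=> Ax; rewrite /ray_ind indicE; have [zr|zr] := pselect (ray (x - L) z).
  by rewrite mem_set //; have /andP[h _] := f1 z Ax; rewrite lerBlDr lerDl.
rewrite memNset // /green_fun profile_left ?subrr //.
by move: zr; rewrite /ray /= in_itv /= andbT => /negP; rewrite -ltNge; lra.
Qed.

Lemma green_fun_vanish x (eps : R) : A <= x -> 0 < eps -> exists n0, forall n, (n0 <= n)%N ->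
  \int[law n]_y green_fun v b L x y <= 2 * eps.
Proof.
move=> Ax eps0; have k0 := rate0 Ax.
(* Beyond B the exponent is at least 1 / eps, and exp (1 / eps) >= 1 / eps. *)
pose B := x + L + (rate v b x)^-1 * eps^-1.
have q0 : 0 <= (rate v b x)^-1 * eps^-1.
  by rewrite mulr_ge0 // invr_ge0 ltW.
have fB y : B <= y -> green_fun v b L x y <= eps.
  rewrite /B => By; rewrite /green_fun profile_right //; last lra.
  rewrite expRN -[leRHS]invrK lef_pV2 ?posrE ?expR_gt0 ?invr_gt0 //.
  apply: le_trans (expR_ge1Dx _).
  have : eps^-1 <= rate v b x * (y - x).
    by rewrite -ler_pdivrMl //; have := L0; lra.
  lra.
have [n0 h0] := law_below_cvg hX H hg e0 e2 eb eb2 eC hlimsup B eps0; exists n0 => n /h0 h.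
have lt := law_ltoo X n measurableT.
rewrite (Rintegral_states hX B (law_states hX n) lt (bf Ax)).
have mSB : measurable (S `&` `[B, +oo[) by apply: measurableI => //; exact: measurable_itv.
have lA : (law n (S `&` `[B, +oo[) < +oo)%E by exact: law_ltoo.
have lB : (law n (S `&` `]-oo, B[) < +oo)%E by exact: law_ltoo.
have h1 : \int[law n]_(y in S `&` `[B, +oo[) green_fun v b L x y <= eps.
  apply: (@le_trans _ _ (\int[law n]_(y in S `&` `[B, +oo[) eps)).
    apply: (le_bRint mSB lA); [exact: bmeasS (bf Ax)|exact: bmeas_cst|].
    by move=> y [_] /=; rewrite in_itv /= andbT; exact: fB.
  rewrite Rintegral_cst // -[leRHS]mulr1 ler_wpM2l //; first exact: ltW.
  rewrite -lee_fin fineK; last by rewrite ge0_fin_numE.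
  by rewrite -(law1 X n); apply: le_measure; rewrite ?inE.
have h2 : \int[law n]_(y in S `&` `]-oo, B[) green_fun v b L x y <= eps.
  apply: (@le_trans _ _ (\int[law n]_(y in S `&` `]-oo, B[) 1)).
    apply: (le_bRint (mbelow B) lB); [exact: bmeasS (bf Ax)|exact: bmeas_cst|].
    by move=> y _; case/andP: (f1 y Ax).
  by rewrite Rintegral_cst // mul1r -lee_fin fineK // ge0_fin_numE.
lra.
Qed.

(** For x >= A + L the test function is already 1 below A, so a low state loses at most its
    probability of jumping beyond x - L, which is an upcrossing. *)
Lemma green_lower_le x N : A + L <= x ->
  0 <= \int[green N]_(y in lower) (green_fun v b L x y - transition Q (green_fun v b L x) y) /\
  ((\int[green N]_(y in lower) (green_fun v b L x y - transition Q (green_fun v b L x) y))%:E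
    <= \sum_(n < N) P (upcross n (x - L)))%E.
Proof.
move=> ALx; have Ax : A <= x by have := L0; lra.
set f := green_fun v b L x.
have bfx : bmeas setT f := bf Ax.
have bI := bmeas_ray_ind (x - L) setT.
have bq := bmeas_transition Q bI; have bt := bmeas_transition Q bfx.
have fE y : lower y -> f y = \int[Q y]_z 1.
  move=> /lowerP[_ yA]; rewrite (Rintegral_cst _ measurableT) Q1 mulr1 /f /green_fun profile_left //.
  lra.
have key y : lower y -> 0 <= f y - transition Q f y <= transition Q (ray_ind (x - L)) y.
  move=> ly; rewrite fE // /transition.
  have QT := Q_ltoo Q y measurableT.
  rewrite -(bRintB measurableT QT (bmeas_cst _ _) bfx); apply/andP; split.
    by apply: Rintegral_ge0 => z _; rewrite subr_ge0; case/andP: (f1 z Ax).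
  apply: (le_bRint measurableT QT _ bI); first by apply: bmeasB => //; exact: bmeas_cst.
  by move=> z _; exact: f_ray.
have gD : (green N lower < +oo)%E by exact: green_ltoo.
split; first by apply: Rintegral_ge0 => y /key /andP[].
apply: (@le_trans _ _ (\int[green N]_(y in lower) transition Q (ray_ind (x - L)) y)%:E).
  rewrite lee_fin; apply: (le_bRint mD gD).
  - exact: bmeasS (bmeasB bfx bt).
  - exact: bmeasS bq.
  - by move=> y /key /andP[].
rewrite bRint_EFin //; last exact: bmeasS bq.
under eq_integral do rewrite -transition_ray_ind.
rewrite ge0_integral_measure_sum //; last first.
  by apply: measurable_funTS; exact: (measurable_kernel Q _ (measurable_ray _)).
by apply: lee_sum => n _; rewrite (P_upcross A hX H).
Qed.

(** With the initial mean close to 1, the mean at time N close to 0 and the low states negligible,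
    the telescoped identity pins the tent mass from both sides. The time N0 depends on x. *)
Theorem tent_asymptotics : exists B, forall x, B <= x -> exists N0, forall N, (N0 <= N)%N ->
  `|v x / L * tent_mass N x - 1| <= 2 * err_const b B2 * e + 4 * e.
Proof.
have [B0 hB0] := upcross_far_small hX H hg e0 e2 eb eb2 eC e0.
have [B1 hB1] := law_ray_cvg X 0 e0.
exists (Num.max (Num.max B0 B1) A + L) => x hx.
have L0_ := L0.
have xA : A + L <= x.
  by apply: le_trans hx; rewrite lerD2r le_max lexx orbT.
have xB0 : B0 <= x - L.
  by rewrite lerBrDr; apply: le_trans hx; rewrite lerD2r !le_max lexx.
have xB1 : B1 <= x - L.
  by rewrite lerBrDr; apply: le_trans hx; rewrite lerD2r !le_max lexx orbT.
have Ax : A <= x by lra.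
have eh : 0 < e / 2 by rewrite divr_gt0.
have [N0 hN0] := green_fun_vanish Ax eh; exists N0 => N /hN0 hN.
have bfx := bf Ax.
have [g0 gu] := green_lower_le N xA.
have hu : \int[green N]_(y in lower) (green_fun v b L x y - transition Q (green_fun v b L x) y) <= 2 * e.
  by rewrite -lee_fin (le_trans gu) // hB0.
have tele := green_telescope hX N bfx.
rewrite (Rintegral_states hX A (green_states hX N) (green_ltoo X N measurableT)) in tele; last first.
  by apply: bmeasB => //; exact: bmeas_transition.
have l0 := law_ltoo X 0 measurableT.
have h1 : 1 = \int[law 0]_y 1 :> R by rewrite (Rintegral_cst _ measurableT) law1 /= mulr1.
have E01 : \int[law 0]_y green_fun v b L x y <= 1.
  rewrite [leRHS]h1; apply: (le_bRint measurableT l0 bfx (bmeas_cst _ _)).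
  by move=> y _; case/andP: (f1 y Ax).
have E0 : 1 - \int[law 0]_y green_fun v b L x y <= e.
  rewrite [X in X - _]h1 -(bRintB measurableT l0 (bmeas_cst _ _) bfx).
  have bI := bmeas_ray_ind (x - L) setT.
  apply: (@le_trans _ _ (\int[law 0]_z ray_ind (x - L) z)).
    apply: (le_bRint measurableT l0 _ bI); first by apply: bmeasB => //; exact: bmeas_cst.
    by move=> z _; exact: f_ray.
  rewrite -lee_fin bRint_EFin // integral_indic ?setIT //; last exact: measurable_ray.
  exact: hB1.
have EN0 : 0 <= \int[law N]_y green_fun v b L x y.
  by apply: Rintegral_ge0 => y _; case/andP: (f1 y Ax).
have EN : \int[law N]_y green_fun v b L x y <= e.
  by apply: le_trans hN _; rewrite mulrC divfK.
apply: (@le_trans _ _ (total_error S Q X v b L A N x + 4 * e)); last first.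
  by rewrite lerD2r; exact: (total_error_small hX H hg e0 e2 eb eb2 eC N Ax).
exact: tent_arith (tent_upper_approx X H hg N Ax) tele g0 (lexx _) E0 E01 EN0 EN hu.
Qed.

End TentAsymptotics2.

(** * Consequences of the hypotheses *)

Section SlowVariation.
Context {R : realType}.
Variables (v s p : R -> R).
Hypothesis v0 : forall y : R, 0 <= y -> 0 < v y.
Hypothesis vdecr : forall y y' : R, 0 <= y -> y <= y' -> v y' <= v y.
Hypothesis vdiff : forall y : R, 0 < y -> derivable v y 1.
Hypothesis vo : forall e : R, 0 < e -> exists A, forall y, A <= y -> `|derive1 v y| <= e * v y ^+ 2.
Hypothesis s0 : forall y : R, 0 <= y -> 0 < s y.
Hypothesis sincr : forall y y' : R, 0 <= y -> y <= y' -> s y <= s y'.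
Hypothesis so : forall e : R, 0 < e -> exists A, forall y, A <= y -> s y <= e * (v y)^-1.
Hypothesis p0 : forall y : R, 0 <= y -> 0 <= p y.
Hypothesis pdecr : forall y y' : R, 0 <= y -> y <= y' -> p y' <= p y.
Hypothesis pint : integrable_at_infinity p.

(** Mean value theorem for 1 / v, whose derivative - v' / v^2 tends to 0. *)
Lemma inv_drift_slow (e : R) : 0 < e -> exists A, forall y y', A <= y -> y <= y' ->
  (v y')^-1 - (v y)^-1 <= e * (y' - y).
Proof.
move=> e0; have [A hA] := vo e0; exists (Num.max A 1) => y y'.
rewrite ge_max => /andP[Ay y1] yy.
have pos z : y <= z -> 0 < z by move=> yz; lra.
have vz z : y <= z -> 0 < v z by move=> yz; apply: v0; exact: ltW (pos _ yz).
have dv z : y <= z -> is_derive z 1 (fun t => (v t)^-1) (- (v z) ^- 2 *: derive1 v z).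
  move=> yz; have vn : v z != 0 by rewrite gt_eqF // vz.
  rewrite derive1E; exact: (is_deriveV vn (derivableP (vdiff (pos z yz)))).
have cv : {within `[y, y'], continuous (fun t => (v t)^-1)}.
  apply: continuous_in_subspaceT => z; rewrite inE /= in_itv /= => /andP[yz _].
  by apply: differentiable_continuous; apply/derivable1_diffP; case: (dv z yz).
have [c] := MVT_segment yy (fun z hz => dv z (ltW (andP (hz)).1)) cv.
rewrite in_itv /= => /andP[yc _] ->.
rewrite ler_wpM2r ?subr_ge0 // /GRing.scale /=.
have := hA c (le_trans Ay yc); have vc := vz c yc.
have v2 : 0 < v c ^+ 2 by rewrite exprn_gt0.
rewrite ler_norml => /andP[h1 _].
rewrite mulNr -mulrN mulrC ler_pdivrMr //; lra.
Qed.

(** s is bounded below by s 0 > 0 while s = o(1 / v), so 1 / v tends to infinity. *)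
Lemma drift_vanishes (e : R) : 0 < e -> exists A, forall y, A <= y -> v y <= e.
Proof.
move=> e0; have s00 := s0 (lexx 0).
have [A hA] := so (mulr_gt0 e0 s00); exists (Num.max A 0) => y.
rewrite ge_max => /andP[Ay y0]; have vy := v0 y0.
have h1 := hA y Ay; have h2 := sincr (lexx 0) y0.
have : s 0 <= e * s 0 / v y by exact: le_trans h1.
by rewrite ler_pdivlMr // mulrC ler_pM2r.
Qed.

Lemma drift_jump_small (e : R) : 0 < e -> exists A, forall y, A <= y -> s y * v y <= e.
Proof.
move=> e0; have [A hA] := so e0; exists (Num.max A 0) => y.
by rewrite ge_max => /andP[/hA Ay y0]; rewrite -ler_pdivlMr // v0.
Qed.

(** By monotonicity each term is at most the integral of p over an earlier block of length L, and
    the blocks used form the tail of a convergent series. *)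
Lemma tail_sum_small (L e : R) : 0 < L -> 0 < e -> exists A0, forall A, A0 <= A ->
  forall J, \sum_(j < J) L * p (A + j%:R * L) <= e.
Proof.
move=> L0 e0; have [a0 ha0] := pint.
pose a := Num.max a0 0.
have a00 : 0 <= a by rewrite /a le_max lexx orbT.
have ia : lebesgue_measure.-integrable `[a, +oo[ (EFin \o p).
  apply: integrableS ha0 => //; apply: subset_itvr; by rewrite bnd_simp /a le_max lexx.
have pge y : `[a, +oo[%classic y -> 0 <= p y.
  by rewrite /= in_itv /= andbT => ay; apply: p0; exact: le_trans ay.
pose c j := (\int[lebesgue_measure]_(y in upblock a L j) (p y)%:E)%E.
have mb j : measurable (upblock a L j) by exact: measurable_itv.
have cover : `[a, +oo[%classic = \bigcup_j upblock a L j.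
  apply/seteqP; split => y.
    by rewrite /= in_itv /= andbT => /(upblock_cover L0)[j hj]; exists j.
  move=> [j _]; rewrite /upblock /= !in_itv /= andbT => /andP[h _].
  by apply: le_trans h; rewrite lerDl mulr_ge0 // ltW.
have mp j : measurable_fun (upblock a L j) (EFin \o p).
  apply: measurable_funS (measurable_int _ ia) => //.
  by rewrite cover; exact: bigcup_sup.
have c0 j : (0 <= c j)%E.
  apply: integral_ge0 => y yj; rewrite lee_fin pge // cover; by exists j.
have [K hK] : exists K, (\int[lebesgue_measure]_(y in `[a, +oo[) (p y)%:E = K%:E)%E.
  exists (\int[lebesgue_measure]_(y in `[a, +oo[) p y).
  by rewrite EFin_Rintegral.
have hc N : (\sum_(n < N) c n <= K%:E)%E.
  rewrite -hK cover ge0_integral_bigcup //; last 3 first.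
  - by rewrite -cover; exact: measurable_int ia.
  - by rewrite -cover => y /pge; rewrite lee_fin.
  - exact: upblock_triv.
  by rewrite -(big_mkord xpredT c); exact: nneseries_lim_ge.
have [n0 /(_ _ (leqnn n0)) hn0] := nneseries_tail_small c0 hc e0.
(* One block more than n0: term j is compared with block j + n0, which must end at or before A + j
   L. *)
exists (a + n0.+1%:R * L) => A hA J.
rewrite -lee_fin -sumEFin; apply: le_trans hn0.
apply: (@le_trans _ _ (\sum_(n0 <= m < n0 + J) c m)%E); last exact: nneseries_lim_ge.
have -> : (\sum_(n0 <= m < n0 + J) c m = \sum_(i < J) c (i + n0)%N)%E.
  by rewrite -{1}[n0]add0n big_addn addnC addnK big_mkord.
apply: lee_sum => j _; rewrite /c.
set m := (j + n0)%N.
have am : 0 <= a + m.+1%:R * L by rewrite addr_ge0 // mulr_ge0 // ltW.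
have hm : a + m.+1%:R * L <= A + j%:R * L.
  rewrite /m -addnS natrD mulrDl; lra.
apply: (@le_trans _ _ (\int[lebesgue_measure]_(y in upblock a L m) (p (A + j%:R * L))%:E)%E).
  have mE : lebesgue_measure (upblock a L m) = L%:E.
    rewrite /upblock lebesgue_measure_itv /= lte_fin ltrD2l ltr_pM2r // ltr_nat ltnSn.
    by rewrite -EFinD; congr EFin; rewrite -natr1; ring.
  by rewrite integral_cst; [rewrite mulrC EFinM -mE lexx|exact: mb].
have ple y : upblock a L m y -> p (A + j%:R * L) <= p y.
  rewrite /upblock /= in_itv /= => /andP[h1 h2].
  have y0 : 0 <= y by apply: le_trans h1; rewrite addr_ge0 // mulr_ge0 // ltW.
  by apply: pdecr => //; apply: (le_trans (ltW h2)).
have pm y : upblock a L m y -> (0 <= (p y)%:E)%E.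
  by move=> ym; rewrite lee_fin pge // cover; exists m.
have pc : (0 <= (p (A + j%:R * L))%:E)%E by rewrite lee_fin p0 // (le_trans am).
by apply: ge0_le_integral => //; [exact: mb|exact: mp].
Qed.

(** A nonincreasing integrable p satisfies y p(y) -> 0, and s y <= 1 / v y grows at most linearly
    because 1 / v has bounded slope. *)
Lemma tail_jump_small (e : R) : 0 < e -> exists A, forall y, A <= y -> s y * p y <= e.
Proof.
move=> e0; have e2 : 0 < e / 2 by rewrite divr_gt0.
have [A1 h1] := tail_sum_small ltr01 e2.
have [A2 h2] := inv_drift_slow ltr01.
have [A3 h3] := drift_jump_small ltr01.
pose a := Num.max A1 0; pose b := Num.max A2 0.
have a0 : 0 <= a by rewrite /a le_max lexx orbT.
have b0 : 0 <= b by rewrite /b le_max lexx orbT.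
exists (Num.max (Num.max A3 b) (Num.max (a + 1) ((v b)^-1 + 2 * a + 2))) => y.
rewrite !ge_max => /andP[/andP[yA3 yb] /andP[ya yv]].
have y0 : 0 <= y by lra.
have vy := v0 y0; have py := p0 y0.
have hp : (y - a - 1) * p y <= e / 2.
  have aA : A1 <= a by rewrite /a le_max lexx.
  apply: le_trans (h1 a aA (Num.truncn (y - a))).
  have ya0 : 0 <= y - a by lra.
  have := truncn_itv ya0; set J := Num.truncn _ => /andP[J1 J2].
  apply: (@le_trans _ _ (\sum_(j < J) p y)).
    rewrite sumr_const card_ord -mulr_natl ler_wpM2r //.
    by move: J2; rewrite -natr1; lra.
  apply: ler_sum => j _; rewrite mul1r mulr1 pdecr //; first by rewrite addr_ge0.
  have : (j%:R : R) <= J%:R by rewrite ler_nat ltnW.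
  lra.
have bA : A2 <= b by rewrite /b le_max lexx.
have yb' : b <= y by rewrite /b ge_max.
have hv := h2 b y bA yb'; rewrite mul1r in hv.
have hs : s y <= (v y)^-1.
  by have := h3 y yA3; rewrite -ler_pdivlMr // div1r.
have hs2 : s y <= 2 * (y - a - 1) by lra.
have := ler_wpM2r py hs2; lra.
Qed.

End SlowVariation.

Section ProbabilityOf.
Context {R : realType} d (T : measurableType d).
Variable mu : {measure set T -> \bar R}.
Hypothesis mu1 : mu setT = 1%E.

(** A measure of mass 1 packed as a probability, so that the stochastic order applies to the kernel
    at a single state. *)
Definition probability_of of mu setT = 1%E : set T -> \bar R := mu.

Local Notation p := (probability_of mu1).
HB.instance Definition _ := Measure.on p.
HB.instance Definition _ := Measure_isProbability.Build _ _ _ p mu1.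

End ProbabilityOf.

(** * Domination of the jump moments *)

Section Majorant.
Context {R : realType}.

(** A power cut off below K: its superlevel sets at nonnegative levels are half-lines, as the
    comparison in stochastic order requires. *)
Definition phi (k : nat) (K u : R) : R := if K < u then u ^+ k else 0.

Lemma measurable_phi k K : measurable_fun setT (phi k K).
Proof.
apply: measurable_fun_ifT; [|exact: measurable_funX|exact: measurable_cst].
by apply: measurable_fun_ltr => //; exact: measurable_cst.
Qed.

Lemma phi_ge0 k K u : 0 <= K -> 0 <= phi k K u.
Proof. by move=> K0; rewrite /phi; case: ifPn => // h; rewrite exprn_ge0 // (le_trans K0) // ltW. Qed.

Lemma phi0 k K : 0 <= K -> phi k K 0 = 0.
Proof. by move=> K0; rewrite /phi ltNge K0. Qed.

Lemma phi_upper k K t : (k = 1 \/ k = 2)%N -> 0 <= K -> 0 <= t ->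
  exists c, forall u, (t < phi k K u) = (c < u).
Proof.
move=> kE K0 t0.
have sq (u : R) : 0 <= u -> (t < u ^+ 2) = (Num.sqrt t < u).
  move=> u0; rewrite -{1}(sqr_sqrtr t0) ltr_pXn2r ?nnegrE ?sqrtr_ge0 //.
exists (Num.max K (if k == 1%N then t else Num.sqrt t)) => u; rewrite gt_max /phi.
case: ifPn => /= h; last by rewrite ltNge t0.
have u0 : 0 <= u by rewrite (le_trans K0) // ltW.
by case: kE => ->; rewrite ?expr1 //= sq.
Qed.

Variables (S : set R) (Q : R.-pker R ~> R) (s : R -> R).
Context d1 (T1 : measurableType d1) (P1 : probability T1 R) (xihat : {RV P1 >-> R}).
Hypothesis xihat_2 : ('E_P1[(fun w => xihat w ^+ 2)%R] < +oo)%E.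
Hypothesis hxihat : forall y, S y -> 0 <= y ->
    st_le (Q y)
      (fun z => `|jump y z| * \1_[set u | `|jump y u| < s y] z) P1 xihat.

Let m2 : measurable_fun setT (fun w => xihat w ^+ 2).
Proof. exact: measurable_funX. Qed.

Lemma integrable_sqr : P1.-integrable setT (EFin \o (fun w => xihat w ^+ 2)).
Proof.
apply/integrableP; split; first exact/measurable_EFinP.
apply: le_lt_trans xihat_2; rewrite unlock le_eqVlt; apply/orP; left; apply/eqP.
by apply: eq_integral => w _ /=; rewrite ger0_norm // sqr_ge0.
Qed.

Lemma integrable_phi k K : (k = 1 \/ k = 2)%N -> 0 <= K ->
  P1.-integrable setT (EFin \o (fun w => phi k K (xihat w))).
Proof.
move=> kE K0.
have i1 : P1.-integrable setT (EFin \o (fun w => 1 + xihat w ^+ 2)).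
  have i0 : P1.-integrable setT (EFin \o (cst 1)).
    apply: (@bounded_integrable _ _ _ _ _ _ 1) => // [|w _]; last by rewrite normr1.
    by apply: (@le_lt_trans _ _ 1%E); [exact: probability_le1|rewrite ltry].
  rewrite (_ : EFin \o _ = (EFin \o cst 1%R) \+ (EFin \o (fun w => xihat w ^+ 2)%R))%E; last first.
    by apply/funext => w /=; rewrite EFinD.
  by apply: integrableD => //; exact: integrable_sqr.
apply: (le_integrable _ _ _ i1) => //.
  apply/measurable_EFinP; apply: measurableT_comp => //; exact: measurable_phi.
move=> w _ /=; rewrite lee_fin !ger0_norm ?phi_ge0 //; last by rewrite addr_ge0 // sqr_ge0.
rewrite /phi; case: ifPn => h; last by rewrite addr_ge0 // sqr_ge0.
case: kE => ->; last by rewrite lerDr.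
by rewrite expr1; have := sqr_ge0 (xihat w - 2^-1); rewrite sqrrB; lra.
Qed.

(** Tail moments of the dominating variable: [maj xihat 1] serves as t1 and [maj xihat 2 0] as
    B2. *)
Definition maj (k : nat) (K : R) : R := \int[P1]_w phi k K (xihat w).

Lemma small_jump_maj k K y : (k = 1 \/ k = 2)%N -> 0 <= K -> S y -> 0 <= y ->
  \int[Q y]_(z in small_jump (jump y) (s y)) phi k K `|jump y z| <= maj k K.
Proof.
move=> kE K0 Sy y0.
pose q : probability R R := probability_of (Q1 Q y).
set J := small_jump (jump y) (s y).
have mj : measurable_fun setT (@jump R y).
  by apply: measurable_funB => //; exact: measurable_cst.
have mJ : measurable J by exact: measurable_small_jump.
pose eta z : R := `|jump y z| * \1_J z.
have meta : measurable_fun setT eta.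
  apply: measurable_funM; first exact: measurableT_comp.
  exact: measurable_indic.
have := @st_le_integral R _ _ _ _ q P1 eta xihat (phi k K) meta (measurable_funPT xihat)
  (measurable_phi k K) (fun u => phi_ge0 k u K0) (fun t => phi_upper kE K0) (hxihat Sy y0).
move=> h.
have -> : \int[Q y]_(z in J) phi k K `|jump y z| = fine (\int[q]_z (phi k K (eta z))%:E)%E.
  rewrite /Rintegral integral_mkcond; congr fine; apply: eq_integral => z _.
  rewrite /patch /eta indicE; case: ifPn => zJ; first by rewrite mulr1.
  by rewrite mulr0 phi0.
have i := integrable_phi kE K0.
have fin2 := integrable_fin_num measurableT i.
have fin1 : (\int[q]_z (phi k K (eta z))%:E)%E \is a fin_num.
  rewrite ge0_fin_numE; first by apply: le_lt_trans h _; rewrite ltey_eq fin2.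
  by apply: integral_ge0 => z _; rewrite lee_fin phi_ge0.
by rewrite /maj /Rintegral fine_le.
Qed.

Lemma maj_ge0 k K : 0 <= K -> 0 <= maj k K.
Proof. by move=> K0; apply: Rintegral_ge0 => w _; exact: phi_ge0. Qed.

Lemma maj_noninc k K K' : (k = 1 \/ k = 2)%N -> 0 <= K -> K <= K' -> maj k K' <= maj k K.
Proof.
move=> kE K0 KK; have K0' := le_trans K0 KK.
apply: le_Rintegral => //; [exact: integrable_phi|exact: integrable_phi|].
move=> w _; rewrite /phi; case: ifPn => h; first by rewrite (le_lt_trans KK).
exact: (phi_ge0 k (xihat w) K0).
Qed.

(** Dominated convergence, with the square of xihat as majorant. *)
Lemma maj2_vanishes (e : R) : 0 < e -> exists2 K, 0 <= K & maj 2 K <= e.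
Proof.
move=> e0.
have mph n : measurable_fun setT (EFin \o (fun w => phi 2 n%:R (xihat w))).
  by apply/measurable_EFinP; apply: measurableT_comp => //; exact: measurable_phi.
have ae1 : {ae P1, forall w, setT w -> (fun n => (phi 2 n%:R (xihat w))%:E) @ \oo --> 0%E}.
  apply: aeW => w _; apply: cvg_near_cst; exists (Num.truncn `|xihat w|).+1 => // n /= hn.
  rewrite /phi ltNge (_ : _ <= _) //.
  apply: (le_trans (ler_norm _)); apply: ltW; apply: lt_le_trans (truncnS_gt _) _.
  by rewrite ler_nat.
have ae2 : {ae P1, forall w n, setT w -> (`|(phi 2 n%:R (xihat w))%:E| <= (xihat w ^+ 2)%:E)%E}.
  apply: aeW => w n _; rewrite lee_fin ger0_norm ?phi_ge0 //.
  by rewrite /phi; case: ifP => // _; exact: sqr_ge0.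
have [_ _] := dominated_convergence measurableT mph (measurable_cst 0%E) ae1 integrable_sqr ae2.
rewrite integral0 => /fine_cvgP[h1 /cvgrPdist_le /(_ _ e0)[N _ h2]].
exists N%:R => //; have := h2 N (leqnn N).
by rewrite sub0r normrN; apply: le_trans; exact: ler_norm.
Qed.

(** Pointwise, at most 2 u / L indices satisfy (j + 2) L / 2 < u, so the weighted sum is at most
    u^2, and it vanishes for u <= L, the smallest threshold. A finite second moment thus makes the
    first moments summable. *)
Lemma maj1_sum (L : R) J : 0 < L ->
  \sum_(j < J) L / 2 * maj 1 (j.+2%:R * L / 2) <= maj 2 L.
Proof.
move=> L0; have K0 j : 0 <= j.+2%:R * L / 2 by rewrite divr_ge0 ?mulr_ge0 // ltW.
have i1 j : P1.-integrable setT (EFin \o (fun w => phi 1 (j.+2%:R * L / 2) (xihat w))).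
  by apply: integrable_phi; [left|exact: K0].
rewrite -lee_fin -sumEFin.
have -> : (\sum_(j < J) (L / 2 * maj 1 (j.+2%:R * L / 2))%:E =
    \int[P1]_w (\sum_(j < J) L / 2 * phi 1 (j.+2%:R * L / 2) (xihat w))%:E)%E.
  under [RHS]eq_integral do rewrite -sumEFin.
  rewrite ge0_integral_sum //; last 2 first.
  - move=> j; apply/measurable_EFinP; apply: measurable_funM; first exact: measurable_cst.
    by apply: measurableT_comp => //; exact: measurable_phi.
  - by move=> j w _; rewrite lee_fin mulr_ge0 ?phi_ge0 // divr_ge0 // ltW.
  apply: eq_bigr => j _; rewrite /maj -RintegralZl //.
  rewrite EFin_Rintegral //.
  rewrite (_ : EFin \o _ = (fun w => (L / 2)%:E * (phi 1 (j.+2%:R * L / 2) (xihat w))%:E)%E); last first.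
    by apply/funext => w.
  exact: (integrableZl measurableT _ (i1 (nat_of_ord j))).
rewrite /maj EFin_Rintegral //; last by apply: integrable_phi => //; [right|exact: ltW].
apply: ge0_le_integral => //.
- by move=> w _; rewrite lee_fin sumr_ge0 // => j _; rewrite mulr_ge0 ?phi_ge0 // divr_ge0 // ltW.
- apply/measurable_EFinP; apply: measurable_sum => j; apply: measurable_funM; first exact: measurable_cst.
  by apply: measurableT_comp => //; exact: measurable_phi.
- by apply/measurable_EFinP; apply: measurableT_comp => //; exact: measurable_phi.
move=> w _; rewrite lee_fin; set u := xihat w.
have cnt : 0 <= u -> \sum_(j < J) L / 2 * (j.+2%:R * L / 2 < u)%R%:R <= u.
  move=> u0; elim: J => [|n IH]; first by rewrite big_ord0.
  rewrite big_ord_recr /=; case: ltP => h; last by rewrite mulr0 addr0.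
  rewrite mulr1; apply: le_trans (ltW h).
  have : \sum_(j < n) L / 2 * (j.+2%:R * L / 2 < u)%R%:R <= n%:R * (L / 2).
    have -> : n%:R * (L / 2) = \sum_(j < n) L / 2 by rewrite sumr_const card_ord mulr_natl.
    apply: ler_sum => j _.
    by case: (_ < _); rewrite ?mulr1 // mulr0 divr_ge0 // ltW.
  rewrite -[n.+2%:R]natr1 -[n.+1%:R]natr1; lra.
rewrite {2}/phi; case: ifPn => h.
  have u0 : 0 <= u by rewrite ltW // (lt_trans L0).
  rewrite (eq_bigr (fun j : 'I_J => L / 2 * (j.+2%:R * L / 2 < u)%R%:R * u)); last first.
    by move=> j _; rewrite /phi; case: ifP; rewrite ?expr1 ?mulr1 ?mulr0 ?mul0r.
  by rewrite -mulr_suml expr2 ler_wpM2r // cnt.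
rewrite big1 // => j _; rewrite /phi ltNge (_ : u <= _) ?mulr0 //.
rewrite -leNgt in h; apply: (le_trans h).
by rewrite -mulrA mulrCA ler_pMr // -natr1 -[j.+1%:R]natr1; have : 0 <= j%:R :> R by []; lra.
Qed.

End Majorant.

Section Assembly.
Context {R : realType}.
Variables (S : set R) (Q : R.-pker R ~> R).
Context d1 (T1 : measurableType d1) (P1 : probability T1 R).
Variables (xihat : {RV P1 >-> R}) (v s p : R -> R) (b : R).
Hypothesis mS : measurable S.
Hypothesis v_gt0 : {in `[0, +oo[, forall x, 0 < v x}.
Hypothesis v_decr : {in `[0, +oo[ &, {homo v : x y /~ x <= y}}.
Hypothesis v_diff : {in `]0, +oo[, forall x, derivable v x 1}.
Hypothesis v'_o : derive1 v =o_ +oo (fun x => v x ^+ 2).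
Hypothesis b_gt0 : 0 < b.
Hypothesis s_gt0 : {in `[0, +oo[, forall x, 0 < s x}.
Hypothesis s_incr : {in `[0, +oo[ &, {homo s : x y / x <= y}}.
Hypothesis s_o : s =o_ +oo (fun x => (v x)^-1).
Hypothesis hm1 : truncated_moment Q 1 (s x) x / v x @[x --> pinfty_in S] --> (1 : R).
Hypothesis hm2 : truncated_moment Q 2 (s x) x @[x --> pinfty_in S] --> b.
Hypothesis p_ge0 : {in `[0, +oo[, forall y, 0 <= p y}.
Hypothesis p_nonincr : {in `[0, +oo[ &, {homo p : x y /~ x <= y}}.
Hypothesis p_int : integrable_at_infinity p.
Hypothesis htail : forall y, S y -> 0 <= y ->
    (Q y [set z | s y <= `|jump y z|]%R <= (p y * v y)%:E)%E.
Hypothesis xihat_2 : ('E_P1[(fun w => xihat w ^+ 2)%R] < +oo)%E.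
Hypothesis hxihat : forall y, S y -> 0 <= y ->
    st_le (Q y)
      (fun z => `|jump y z| * \1_[set u | `|jump y u| < s y] z) P1 xihat.

Let in0 (y : R) : 0 <= y -> y \in `[0, +oo[.
Proof. by move=> y0; rewrite in_itv /= y0. Qed.

Let v0 y : 0 <= y -> 0 < v y. Proof. by move=> /in0; exact: v_gt0. Qed.
Let vdecr y y' : 0 <= y -> y <= y' -> v y' <= v y.
Proof. by move=> y0 yy; apply: v_decr => //; apply: in0 => //; exact: le_trans yy. Qed.
Let s0 y : 0 <= y -> 0 < s y. Proof. by move=> /in0; exact: s_gt0. Qed.
Let sincr y y' : 0 <= y -> y <= y' -> s y <= s y'.
Proof. by move=> y0 yy; apply: s_incr => //; apply: in0 => //; exact: le_trans yy. Qed.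
Let p0 y : 0 <= y -> 0 <= p y. Proof. by move=> /in0; exact: p_ge0. Qed.
Let pdecr y y' : 0 <= y -> y <= y' -> p y' <= p y.
Proof. by move=> y0 yy; apply: p_nonincr => //; apply: in0 => //; exact: le_trans yy. Qed.
Let vdiff y : 0 < y -> derivable v y 1.
Proof. by move=> y0; apply: v_diff; rewrite in_itv /= y0. Qed.

Let pinfty_near (A : set R) : (\forall x \near +oo, A x) -> exists M, forall y, M <= y -> A y.
Proof.
move=> [M [_ hM]]; exists (M + 1) => y My; apply: hM; apply: lt_le_trans My.
by rewrite ltrDl.
Qed.

Let vo e : 0 < e -> exists A, forall y, A <= y -> `|derive1 v y| <= e * v y ^+ 2.
Proof.
move=> e0; have /(_ e e0) := (eqoP _ _ _).1 v'_o => /pinfty_near[A hA].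
exists A => y /hA; by rewrite (ger0_norm (sqr_ge0 _)).
Qed.

Let so e : 0 < e -> exists A, forall y, A <= y -> s y <= e * (v y)^-1.
Proof.
move=> e0; have /(_ e e0) := (eqoP _ _ _).1 s_o => /pinfty_near[A hA].
exists (Num.max A 0) => y; rewrite ge_max => /andP[/hA h y0].
apply: le_trans (ler_norm _) (le_trans h _).
by rewrite ger0_norm // invr_ge0 ltW // v0.
Qed.

Let mj y : measurable_fun setT (@jump R y).
Proof. by apply: measurable_funB => //; exact: measurable_cst. Qed.

Let J y := small_jump (jump y) (s y).

Let mJ y : measurable (J y). Proof. exact: measurable_small_jump. Qed.
Let mJC y : measurable (~` J y). Proof. by apply: measurableC. Qed.

Let JC y : ~` J y = [set z | s y <= `|jump y z|].
Proof. by apply/seteqP; split => z; rewrite /J /small_jump /= leNgt => /negP. Qed.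

(** The moments are given for jumps of size at most s, the domination for jumps of size less than s.
    The difference lives on jumps of size exactly s, which the tail bound covers. *)
Lemma truncated_moment_small_jump k y : S y -> 0 <= y ->
  `|truncated_moment Q k (s y) y - \int[Q y]_(z in J y) jump y z ^+ k| <= s y ^+ k * (p y * v y).
Proof.
move=> Sy y0; have sy := s0 y0.
pose E := [set z : R | `|jump y z| <= s y].
have mE : measurable E.
  rewrite -[E]setTI; have : measurable_fun setT (fun w : R => `|jump y w|) by exact: measurableT_comp.
  move=> /(_ measurableT `]-oo, s y]%classic (measurable_itv _)).
  by rewrite (_ : _ @^-1` _ = E) //; apply/seteqP; split => w /=; rewrite in_itv.
have EJ : E = J y `|` (E `\` J y).
  apply/seteqP; split => z; last by case=> [h|[]] //; exact: ltW h.
  by move=> Ez; have [h|h] := pselect (J y z); [left|right].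
have mEJ : measurable (E `\` J y) by exact: measurableD.
have bm D : D `<=` E -> bmeas D (fun z => jump y z ^+ k).
  move=> DE; apply: (@bmeasI _ _ _ _ _ (s y ^+ k)); first exact: measurable_funX.
  by move=> z /DE Ez; rewrite normrX lerXn2r ?nnegrE ?normr_ge0 // ltW.
rewrite /truncated_moment -/E [in X in X - _]EJ bRint_setU //; last 3 first.
- by apply/seteqP; split => // z [h [_ h']].
- by apply: Q_ltoo; exact: measurableU.
- by apply: bm; rewrite -EJ.
rewrite addrAC subrr add0r.
have QEJ := Q_ltoo Q y mEJ.
apply: (@le_trans _ _ (\int[Q y]_(z in E `\` J y) (s y ^+ k))).
  apply: (le_norm_bRint mEJ QEJ); [by apply: bm => z []|exact: bmeas_cst|].
  by move=> z [Ez _]; rewrite normrX lerXn2r ?nnegrE ?normr_ge0 // ltW.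
rewrite Rintegral_cst // ler_wpM2l //; first by rewrite exprn_ge0 // ltW.
rewrite -lee_fin fineK; last by rewrite ge0_fin_numE.
apply: le_trans (htail Sy y0); rewrite -JC.
by apply: le_measure; rewrite ?inE // => z [].
Qed.

Let B2 := maj xihat 2 0.
Let k1 : (1 = 1 \/ 1 = 2)%N. Proof. by left. Qed.
Let k2 : (2 = 1 \/ 2 = 2)%N. Proof. by right. Qed.

Lemma phi2_sqr (u : R) : phi 2 0 `|u| = u ^+ 2.
Proof.
rewrite /phi normr_gt0; case: eqP => [->|_] /=; first by rewrite expr0n.
by rewrite -normrX ger0_norm // sqr_ge0.
Qed.

Lemma phi1_cut1 (K u : R) : 0 <= K -> phi 1 K `|u| = cut1 K u.
Proof. by move=> K0; rewrite /phi /cut1 expr1. Qed.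

Lemma setting : drift_setting S Q v s p (maj xihat 1) b B2.
Proof.
split => //.
- exact: maj_ge0.
- by move=> K K0; exact: maj_ge0.
- by move=> K K' K0 KK; exact: (maj_noninc xihat_2 k1 K0 KK).
- by move=> y Sy y0; rewrite -/(J y) JC; exact: htail.
- move=> y K Sy y0 K0; under eq_Rintegral do rewrite -phi1_cut1 //.
  exact: (small_jump_maj xihat_2 hxihat k1 K0 Sy y0).
- move=> y Sy y0; under eq_Rintegral do rewrite -phi2_sqr.
  exact: (small_jump_maj xihat_2 hxihat k2 (lexx _) Sy y0).
Qed.

Let near_states (f : R -> R) (l e : R) : f x @[x --> pinfty_in S] --> l -> 0 < e ->
  exists M, forall y, M <= y -> S y -> `|f y - l| <= e.
Proof.
move=> /cvgrPdist_le h e0; have := h e e0; rewrite /pinfty_in => hn.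
have [M hM] := pinfty_near hn.
by exists M => y /hM h2 Sy; rewrite distrC; exact: h2.
Qed.

Let first_moment e : 0 < e -> exists A, forall y, A <= y -> S y ->
  `|\int[Q y]_(z in J y) jump y z - v y| <= e * v y.
Proof.
move=> e0; have e2 : 0 < e / 2 by rewrite divr_gt0.
have [A1 h1] := near_states hm1 e2.
have [A2 h2] := tail_jump_small v0 vdiff vo so p0 pdecr p_int e2.
exists (Num.max (Num.max A1 A2) 0) => y; rewrite !ge_max => /andP[/andP[y1 y2] y0] Sy.
have vy := v0 y0.
have h3 := truncated_moment_small_jump 1 Sy y0.
have h4 := h1 y y1 Sy; have h5 := h2 y y2.
have h6 : `|truncated_moment Q 1 (s y) y - v y| <= e / 2 * v y.
  have -> : truncated_moment Q 1 (s y) y - v y = (truncated_moment Q 1 (s y) y / v y - 1) * v y.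
    by field; rewrite gt_eqF.
  by rewrite normrM (gtr0_norm vy) ler_pM2r.
have h7 : s y ^+ 1 * (p y * v y) <= e / 2 * v y by rewrite expr1 mulrA ler_pM2r.
have e1 : \int[Q y]_(z in J y) jump y z ^+ 1 = \int[Q y]_(z in J y) jump y z.
  by apply: eq_Rintegral => z _; rewrite expr1.
rewrite e1 in h3.
move: h3 h6; move: (truncated_moment _ _ _ _) (Rintegral _ _ _) => m m'.
rewrite !ler_norml => /andP[a1 a2] /andP[a3 a4]; apply/andP; split; lra.
Qed.

Let second_moment e : 0 < e -> exists A, forall y, A <= y -> S y ->
  `|\int[Q y]_(z in J y) jump y z ^+ 2 - b| <= e.
Proof.
move=> e0; have e2 : 0 < e / 2 by rewrite divr_gt0.
have [A1 h1] := near_states hm2 e2.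
have [A2 h2] := tail_jump_small v0 vdiff vo so p0 pdecr p_int e2.
have [A3 h3] := drift_jump_small v0 so ltr01.
exists (Num.max (Num.max A1 A2) (Num.max A3 0)) => y.
rewrite !ge_max => /andP[/andP[y1 y2] /andP[y3 y0]] Sy.
have vy := v0 y0; have sy := s0 y0; have py := p0 y0.
have h4 := truncated_moment_small_jump 2 Sy y0.
have h5 := h1 y y1 Sy; have h6 := h2 y y2; have h7 := h3 y y3.
have h8 : s y ^+ 2 * (p y * v y) <= e / 2.
  rewrite (_ : _ * _ = (s y * p y) * (s y * v y)); last by ring.
  rewrite -[leRHS]mulr1 ler_pM //; [rewrite mulr_ge0 // ltW //|rewrite mulr_ge0 // ltW //].
move: h4 h5; move: (truncated_moment _ _ _ _) (Rintegral _ _ _) => m m'.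
rewrite !ler_norml => /andP[a1 a2] /andP[a3 a4]; apply/andP; split; lra.
Qed.

(** Jumps up to K get the factor K / L from the minimum; longer ones keep their full second moment,
    bounded by [maj xihat 2 K]. *)
Let mix_bound K L y : S y -> 0 <= y -> 0 <= K -> 0 < L ->
  \int[Q y]_(z in J y) (jump y z ^+ 2 * Num.min (`|jump y z| / L) 1)
  <= K / L * B2 + maj xihat 2 K.
Proof.
move=> Sy y0 K0 L0; have sy := s0 y0; have QJ := Q_ltoo Q y (mJ y).
have KL : 0 <= K / L by rewrite divr_ge0 // ltW.
have mabs : measurable_fun setT (fun z : R => `|jump y z|) by exact: measurableT_comp.
have bphi K' : 0 <= K' -> bmeas (J y) (fun z => phi 2 K' `|jump y z|).
  move=> K'0; apply: (@bmeasI _ _ _ _ _ (s y ^+ 2)).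
    by apply: measurableT_comp => //; exact: measurable_phi.
  move=> z Jz; rewrite ger0_norm ?phi_ge0 // /phi; case: ifP => _; last by rewrite sqr_ge0.
  by rewrite lerXn2r ?nnegrE // ltW.
have mn (u : R) : 0 <= Num.min (`|u| / L) 1 <= 1.
  by rewrite le_min ler01 andbT divr_ge0 ?ge_min ?lexx ?orbT // ltW.
have bm : bmeas (J y) (fun z => jump y z ^+ 2 * Num.min (`|jump y z| / L) 1).
  apply: (@bmeasI _ _ _ _ _ (s y ^+ 2)).
    apply: measurable_funM; first exact: measurable_funX.
    apply: measurable_minr; last exact: measurable_cst.
    by apply: measurable_funM => //; exact: measurable_cst.
  move=> z Jz; have /andP[n1 n2] := mn (jump y z).
  rewrite normrM (ger0_norm n1) -[leRHS]mulr1 ler_pM // normrX lerXn2r ?nnegrE //; exact: ltW.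
apply: (@le_trans _ _ (\int[Q y]_(z in J y) (K / L * phi 2 0 `|jump y z| + phi 2 K `|jump y z|))).
  apply: (le_bRint (mJ y) QJ bm); first by apply: bmeasD; [apply: bmeasZ|]; exact: bphi.
  move=> z _; rewrite phi2_sqr; set u := jump y z; have /andP[n1 n2] := mn u.
  rewrite /phi; case: ifPn => h.
    rewrite -normrX (ger0_norm (sqr_ge0 _)).
    have : u ^+ 2 * Num.min (`|u| / L) 1 <= u ^+ 2 * 1 by rewrite ler_wpM2l // sqr_ge0.
    have : 0 <= K / L * u ^+ 2 by rewrite mulr_ge0 // sqr_ge0.
    lra.
  rewrite addr0 mulrC ler_wpM2r ?sqr_ge0 // (le_trans (_ : _ <= `|u| / L)) //.
    by rewrite ge_min lexx.
  by rewrite ler_pM2r ?invr_gt0 // leNgt.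
rewrite (bRintD (mJ y) QJ) //; [|by apply: bmeasZ; exact: bphi|exact: bphi].
rewrite (bRintZ (mJ y) QJ); last exact: bphi.

apply: lerD; last exact: (small_jump_maj xihat_2 hxihat k2 K0 Sy y0).
by apply: ler_wpM2l => //; exact: (small_jump_maj xihat_2 hxihat k2 (lexx _) Sy y0).
Qed.

(** The order of choices: K from the tail of the second moment, L large against K, then A depending
    on L, since L * v A and the Riemann sums of p with step L must be small. *)
Lemma good_exists e : 0 < e -> exists L0, forall L, L0 <= L -> exists A0, forall A, A0 <= A ->
  good S Q v s p (maj xihat 1) b e L A.
Proof.
move=> e0; have e2 : 0 < e / 2 by rewrite divr_gt0.
have [K K0 hK] := maj2_vanishes xihat_2 e2.
have B20 : 0 <= B2 by exact: maj_ge0.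
(* The last entry makes K / L * B2 at most e / 2; L >= K lets the second-moment tail at L be bounded
   by that at K. *)
exists (Num.max 1 (Num.max K (2 * K * B2 / e))) => L.
rewrite !ge_max => /and3P[L1 LK LB].
have L0 : 0 < L by exact: lt_le_trans L1.
have [A1 h1] := inv_drift_slow v0 vdiff vo e0.
have eL : 0 < e / L by rewrite divr_gt0.
have [A2 h2] := drift_vanishes v0 s0 sincr so eL.
have [A3 h3] := drift_jump_small v0 so e0.
have [A4 h4] := tail_sum_small p0 pdecr p_int L0 e0.
have [A5 h5] := first_moment e0.
have [A6 h6] := second_moment e0.
exists (Num.max 0 (Num.max (Num.max A1 A2) (Num.max (Num.max A3 A4) (Num.max A5 A6)))) => A.
rewrite !ge_max => /and3P[A00 /andP[AA1 AA2] /and3P[/andP[AA3 AA4] AA5 AA6]].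
split => //.
- by move=> y y' Ay yy; apply: h1 => //; exact: le_trans Ay.
- by have := h2 A AA2; rewrite ler_pdivlMr // mulrC.
- by move=> y Ay; apply: h3; exact: le_trans Ay.
- exact: h4.
- move=> n; apply: le_trans (maj1_sum xihat_2 n L0) _.
  apply: (@le_trans _ _ (maj xihat 2 K)); first exact: (maj_noninc xihat_2 k2 K0 LK).
  by apply: (le_trans hK); lra.
- move=> y Sy Ay; have y0 : 0 <= y by exact: le_trans Ay.
  apply: (le_trans (mix_bound Sy y0 K0 L0)).
  have : K / L * B2 <= e / 2.
    rewrite mulrAC ler_pdivrMr //; move: LB; rewrite ler_pdivrMr //; lra.
  lra.
- by move=> y Sy Ay; apply: h5 => //; exact: le_trans Ay.
- by move=> y Sy Ay; apply: h6 => //; exact: le_trans Ay.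
Qed.

End Assembly.

(** * The averaging property *)

Section Renewal.
Context {R : realType} d (Omega : measurableType d) (P : probability Omega R).
Variables (S : set R) (Q : R.-pker R ~> R) (X : nat -> {RV P >-> R}).
Variables (v s p t1 : R -> R) (b B2 e L A : R).
Hypothesis hX : markov_chain S Q X.
Hypothesis H : drift_setting S Q v s p t1 b B2.
Hypothesis hg : good S Q v s p t1 b e L A.
Hypotheses (e0 : 0 < e) (e2 : e <= 2^-1) (eb : e <= b / 8) (eb2 : e * b <= 2).
Hypothesis eC : err_const b B2 * e <= 2^-1.
Hypothesis hlimsup : {ae P, forall w, limn_esup (fun n => (X n w)%:E) = +oo%E}.

Local Notation green := (green X).
Local Notation law := (law X).

Definition greenoo : {measure set R -> \bar R} := mseries law 0.
(** A real integral, equal to 0 by default when the mass is infinite; its value is informative only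
    beyond the level where windows have finite mass. *)
Definition tent_green (dl x : R) : R := \int[greenoo]_(y in S) tent dl (y - x).

Let A0 : 0 <= A. Proof. exact: (good_A hg). Qed.
Let L0 : 0 < L. Proof. exact: lt_le_trans (good_L hg). Qed.
Let mS : measurable S. Proof. exact: (ds_mS H). Qed.
Let v0 x : A <= x -> 0 < v x.
Proof. by move=> Ax; apply: (ds_v H); exact: le_trans Ax. Qed.
Let mSI (i : interval R) : measurable (S `&` [set` i]).
Proof. by apply: measurableI => //; exact: measurable_itv. Qed.

Lemma greenooE D (f : R -> \bar R) : measurable D -> measurable_fun D f ->
  (forall y, D y -> 0 <= f y)%E ->
  (\int[greenoo]_(y in D) f y = \sum_(n <oo) \int[law n]_(y in D) f y)%E.
Proof.
by move=> mD mf f0; rewrite /greenoo ge0_integral_measure_series.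
Qed.

Lemma greenoo_le D (f : R -> \bar R) (K : \bar R) : measurable D -> measurable_fun D f ->
  (forall y, D y -> 0 <= f y)%E ->
  (forall N, \int[green N]_(y in D) f y <= K)%E ->
  (\int[greenoo]_(y in D) f y <= K)%E.
Proof.
move=> mD mf f0 h; rewrite greenooE //; apply: lime_le.
  by apply: is_cvg_nneseries => n _ _; exact: integral_ge0.
apply: nearW => N; rewrite big_mkord; apply: le_trans (h N).
by rewrite ge0_integral_measure_sum.
Qed.

Lemma green_le_greenoo N D (f : R -> \bar R) : measurable D -> measurable_fun D f ->
  (forall y, D y -> 0 <= f y)%E ->
  (\int[green N]_(y in D) f y <= \int[greenoo]_(y in D) f y)%E.
Proof.
move=> mD mf f0; rewrite greenooE // ge0_integral_measure_sum //.
rewrite -(big_mkord xpredT (fun n => \int[law n]_(y in D) f y)%E).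
by apply: nneseries_lim_ge => n _ _; exact: integral_ge0.
Qed.

Lemma greenoo_window w : A <= w ->
  (greenoo (S `&` `[w, (w + L)%R[) <= (8 * L / v w)%:E)%E.
Proof.
move=> Aw; have h := greenoo_le (mSI _) (measurable_cst 1%E : measurable_fun (S `&` `[w, (w + L)%R[) _).
rewrite -[leLHS]mul1e -integral_cst //; apply: h => // N.
rewrite integral_cst // mul1e; apply: le_trans (green_window hX H hg e0 e2 eb eb2 eC N Aw).
apply: le_measure; rewrite ?inE //.
  by apply: measurableI; [exact: mSI|exact: measurable_itv].
move=> y [Sy] yw; split => //; split => //; move: yw; rewrite /= !in_itv /= andbT => /andP[h1 _].
exact: le_trans h1.
Qed.

Lemma greenoo_windows w n : A <= w ->
  (greenoo (S `&` `[w, (w + n%:R * L)%R[) <= (n%:R * (8 * L / v (w + n%:R * L)))%:E)%E.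
Proof.
move=> Aw; elim: n => [|n IH].
  rewrite mul0r addr0 mul0r (_ : _ `&` _ = set0) ?measure0 //.
  by apply/seteqP; split => // y [_] /=; rewrite in_itv /= => /andP[h1]; rewrite ltNge h1.
have nL : 0 <= n%:R * L by rewrite mulr_ge0 // ltW.
have Awn : A <= w + n%:R * L by lra.
have nE : w + n.+1%:R * L = w + n%:R * L + L by rewrite -natr1; ring.
apply: (@le_trans _ _ (greenoo ((S `&` `[w, (w + n%:R * L)%R[) `|`
    (S `&` `[(w + n%:R * L)%R, (w + n%:R * L + L)%R[)))).
  apply: le_measure; [by rewrite inE; exact: mSI|by rewrite inE; apply: measurableU; exact: mSI|].
  move=> y [Sy]; rewrite /= !in_itv /= nE => /andP[h1 h2].
  have [h|h] := leP (w + n%:R * L) y; [right|left]; (split; first exact: Sy); apply/andP; split => //; rewrite ?bnd_simp.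
apply: le_trans; first exact: (measureU2 greenoo (mSI _) (mSI _)).
apply: (le_trans (leeD IH (greenoo_window Awn))).
have L0_ := L0.
have v1 : 0 < v (w + n.+1%:R * L) by apply: v0; rewrite nE; lra.
have v2 : 0 < v (w + n%:R * L) by exact: v0.
have vv : v (w + n.+1%:R * L) <= v (w + n%:R * L).
  by apply: (ds_vdecr H); [exact: le_trans Awn|rewrite nE; lra].
have hle : 8 * L / v (w + n%:R * L) <= 8 * L / v (w + n.+1%:R * L).
  by rewrite ler_wpM2l ?lef_pV2 ?posrE // mulr_ge0 // ltW.
set V := 8 * L / v (w + n%:R * L) in hle *; set V' := 8 * L / v (w + n.+1%:R * L) in hle *.
rewrite -EFinD lee_fin -[n.+1%:R]natr1 mulrDl mul1r lerD //.
by rewrite ler_wpM2l.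
Qed.

Lemma measurable_tentR dl x (D : set R) : measurable_fun D (fun y : R => (tent dl (y - x))%:E).
Proof.
by apply: measurable_funTS; apply/measurable_EFinP; exact: measurable_tent.
Qed.

Lemma greenoo_states : greenoo (~` S) = 0%E.
Proof.
rewrite /greenoo /= /mseries eseries0 // => n _ _; exact: (law_states hX).
Qed.

(** The N-step masses increase with N and obey the bounds from N0 on, so their limit inherits
    them. *)
Lemma tent_green_asymptotics : exists B, forall x, B <= x ->
  `|v x / L * tent_green L x - 1| <= 2 * err_const b B2 * e + 4 * e.
Proof.
have [B hB] := tent_asymptotics hX H hg e0 e2 eb eb2 eC hlimsup.
exists (Num.max B (A + L)) => x; rewrite ge_max => /andP[Bx Ax].
have [N0 hN] := hB x Bx.
have Ax' : A <= x by have := L0; lra.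
have vx := v0 Ax'.
set c := 2 * err_const b B2 * e + 4 * e in hN *.
have vL : 0 < v x / L by rewrite divr_gt0.
have tE N : (\int[green N]_(y in S) (tent L (y - x))%:E = (tent_mass S X L A N x)%:E)%E.
  have mU := measurable_upper A H; have gU : (green N (upper S A) < +oo)%E by exact: green_ltoo.
  rewrite /tent_mass bRint_EFin //; last exact: (bmeas_tent hg).
  rewrite [LHS]integral_mkcond [RHS]integral_mkcond; apply: eq_integral => y _.
  rewrite /patch; case: ifPn => [/set_mem Sy|/negP nSy]; last first.
    by rewrite memNset // => -[/mem_set].
  have [yA|yA] := pselect (upper S A y); first by rewrite mem_set.
  rewrite memNset // tent_out //.
  have : y < A by rewrite ltNge; apply/negP => h; apply: yA; split => //=; rewrite in_itv /= h.
  by move=> h; rewrite ler0_norm; lra.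
have t0 y : (0 <= (tent L (y - x))%:E)%E by rewrite lee_fin; case/andP: (tent_itv L0 (y - x)).
have mt := @measurable_tentR L x S.
have up N : (\int[green N]_(y in S) (tent L (y - x))%:E <= ((1 + c) / (v x / L))%:E)%E.
  apply: (@le_trans _ _ (\int[green (maxn N N0)]_(y in S) (tent L (y - x))%:E)%E).
    rewrite !ge0_integral_measure_sum //.
    rewrite -!(big_mkord xpredT (fun n => \int[law n]_(y in S) (tent L (y - x))%:E)%E).
    apply: lee_sum_nneg_natr; last exact: leq_maxl.
    by move=> n _ _; exact: integral_ge0.
  rewrite tE lee_fin ler_pdivlMr // mulrC.
  by have := hN (maxn N N0) (leq_maxr _ _); rewrite ler_norml; lra.
have upoo := greenoo_le mS mt (fun y _ => t0 y) up.
have fin : (\int[greenoo]_(y in S) (tent L (y - x))%:E)%E \is a fin_num.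
  by rewrite ge0_fin_numE; [exact: le_lt_trans upoo (ltry _)|exact: integral_ge0].
have eqT : (\int[greenoo]_(y in S) (tent L (y - x))%:E = (tent_green L x)%:E)%E.
  by rewrite /tent_green /Rintegral fineK.
rewrite eqT lee_fin ler_pdivlMr // in upoo.
have lo := green_le_greenoo N0 mS mt (fun y _ => t0 y).
rewrite eqT tE lee_fin in lo.
have := hN N0 (leqnn _); rewrite !ler_norml => /andP[h1 _].
have h2 := ler_wpM2l (ltW vL) lo.
by apply/andP; split; lra.
Qed.

Local Open Scope ereal_scope.

(** A shift of the defining series by one step. *)
Lemma renewal_identity (f : R -> \bar R) : measurable_fun setT f -> (forall y, 0 <= f y) ->
  \int[greenoo]_y f y = \int[law 0]_y f y + \int[greenoo]_y \int[Q y]_z f z.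
Proof.
move=> mf f0.
have mQ : measurable_fun setT (fun y => \int[Q y]_z f z).
  by apply: measurable_fun_integral_kernel => // U mU; exact: measurable_kernel.
have Qf0 y : 0 <= \int[Q y]_z f z by exact: integral_ge0.
rewrite !greenooE //.
have i0 n : 0 <= \int[law n]_y f y by exact: integral_ge0.
rewrite nneseries_recl //; congr (_ + _).
rewrite -(nneseries_addn (f := fun n => \int[law n]_y f y) 1) //.
by apply: eq_eseriesr => n _; rewrite addn1 (ge0_law_next hX).
Qed.

End Renewal.

Lemma far_left_arith (R : realFieldType) (i k w : R) : 0 < i -> 0 < k -> 0 < w -> w^-1 <= i ->
  k / 2 / (i + k) * (2 / w) <= k.
Proof.
move=> i0 k0 w0 wi; have ik : 0 < i + k by exact: addr_gt0.
rewrite (_ : k / 2 / (i + k) * (2 / w) = k * (w^-1 / (i + k))); last first.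
  by field; rewrite !gt_eqF.
rewrite -[leRHS]mulr1 ler_wpM2l //; first exact: ltW.
rewrite ler_pdivrMr //; lra.
Qed.

Lemma far_right_arith (R : realFieldType) (i k w : R) : 0 < i -> 0 < k -> 0 < w -> w^-1 <= i ->
  k / 2 / (i + k) * (2 / w) <= k / (1 + k * w).
Proof.
move=> i0 k0 w0 wi; have ik : 0 < i + k by exact: addr_gt0.
have -> : k / 2 / (i + k) * (2 / w) = k / (w * (i + k)) by field; rewrite !gt_eqF.
have wi1 : 1 <= i * w by rewrite -ler_pdivrMr // mul1r.
have wk : 0 < k * w by exact: mulr_gt0.
have h1 : 0 < 1 + k * w by lra.
have h2 : 0 < w * (i + k) by exact: mulr_gt0.
rewrite ler_wpM2l ?lef_pV2 ?posrE //; [exact: ltW|lra].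
Qed.

(** * Distant and low states in the renewal equation *)

Section FarPart.
Context {R : realType} d (Omega : measurableType d) (P : probability Omega R).
Variables (S : set R) (Q : R.-pker R ~> R) (X : nat -> {RV P >-> R}).
Variables (v s p t1 : R -> R) (b B2 e L A dl : R).
Hypothesis hX : markov_chain S Q X.
Hypothesis H : drift_setting S Q v s p t1 b B2.
Hypothesis hg : good S Q v s p t1 b e L A.
Hypotheses (e0 : 0 < e) (e2 : e <= 2^-1) (eb : e <= b / 8) (eb2 : e * b <= 2).
Hypothesis eC : err_const b B2 * e <= 2^-1.
Hypotheses (dl0 : 0 < dl) (dlL : dl <= L).
Hypothesis vinf : forall a : R, 0 < a -> exists B, forall x, B <= x -> v x <= a.

Local Notation green := (green X).
Local Notation greenoo := (greenoo X).

Let A0 : 0 <= A. Proof. exact: (good_A hg). Qed.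
Let L0 : 0 < L. Proof. exact: lt_le_trans (good_L hg). Qed.
Let b0 : 0 < b. Proof. exact: (ds_b H). Qed.
Let mS : measurable S. Proof. exact: (ds_mS H). Qed.
Let v0 x : A <= x -> 0 < v x.
Proof. by move=> Ax; apply: (ds_v H); exact: le_trans Ax. Qed.

Lemma tent01 (z : R) : 0 <= tent dl z <= 1. Proof. exact: tent_itv. Qed.

Lemma measurable_far (K x : R) : measurable [set y : R | K <= `|y - x|].
Proof.
rewrite (_ : [set y | _] = (fun y : R => `|y - x|) @^-1` `[K, +oo[%classic); last first.
  by apply/seteqP; split => y /=; rewrite in_itv /= andbT.
have mabs : measurable_fun setT (fun y : R => `|y - x|).
  by apply: measurableT_comp => //; apply: measurable_funB => //; exact: measurable_cst.
by rewrite -[_ @^-1` _]setTI; exact: (mabs measurableT _ (measurable_itv _)).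
Qed.

Lemma bmeas_tent_at (x : R) D : bmeas D (fun y : R => tent dl (y - x)).
Proof.
apply: (@bmeasI _ _ _ D _ 1); first exact: measurable_tent.
by move=> y _; case/andP: (tent01 (y - x)) => h1 h2; rewrite ger0_norm.
Qed.

Lemma transition_tent_ge0 x y : 0 <= transition Q (fun z => tent dl (z - x)) y.
Proof. by apply: Rintegral_ge0 => z _; case/andP: (tent01 (z - x)). Qed.

Lemma EFin_transition_tent x y :
  (\int[Q y]_z (tent dl (z - x))%:E = (transition Q (fun z => tent dl (z - x)) y)%:E)%E.
Proof. by rewrite -bRint_EFin //; [rewrite (Q_ltoo Q)|exact: bmeas_tent_at]. Qed.

(** Reaching the support of the tent requires a jump longer than r / 2, where r is the distance to
    x; for small jumps the Markov inequality gives 2 / r times the truncated first moment. *)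
Lemma transition_tent_far x y : S y -> A <= y -> 2 * dl <= `|y - x| ->
  transition Q (fun z => tent dl (z - x)) y <= p y * v y + 2 / `|y - x| * t1 (`|y - x| / 2).
Proof.
move=> Sy Ay far; have y0 : 0 <= y by exact: le_trans Ay.
have dl0_ := dl0; set r := `|y - x| in far *; have r0 : 0 < r by lra.
have r2 : 0 <= r / 2 by lra.
set J := small_jump (jump y) (s y).
have mJ : measurable J by exact: (measurable_small_jump _ (measurable_jump y)).
have mJC : measurable (~` J) by exact: measurableC.
have bt D := @bmeas_tent_at x D.
have -> : transition Q (fun z => tent dl (z - x)) y = \int[Q y]_(z in J `|` ~` J) tent dl (z - x).
  by rewrite setUv.
rewrite bRint_setU ?setICr ?setUv ?Q_ltoo //.
rewrite addrC lerD //.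
  apply: (@le_trans _ _ (\int[Q y]_(z in ~` J) 1)).
    apply: le_bRint => //; [exact: Q_ltoo|exact: bmeas_cst|].
    by move=> z _; case/andP: (tent01 (z - x)).
  rewrite Rintegral_cst // mul1r -lee_fin fineK; first exact: (ds_tail H).
  by rewrite ge0_fin_numE // Q_ltoo.
apply: le_trans (ler_wpM2l _ (ds_cut1 H Sy y0 r2)); last by rewrite divr_ge0 // ltW.
have bc : bmeas J (fun z => cut1 (r / 2) (jump y z)).
  apply: (@bmeasI _ _ _ J _ (s y)); first exact: (measurableT_comp (measurable_cut1 _) (measurable_jump y)).
  move=> z Jz; rewrite ger0_norm ?cut1_ge0 // /cut1; case: ifP => _; first exact: ltW.
  by apply: ltW; exact: (ds_s H).
rewrite -bRintZ ?Q_ltoo //; apply: le_bRint => //; [exact: Q_ltoo|exact: bmeasZ|].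
move=> z Jz; case/andP: (tent01 (z - x)) => t0 t1_.
have [h|h] := leP dl `|z - x|.
  rewrite tent_out //; rewrite mulr_ge0 ?cut1_ge0 // divr_ge0 // ltW //.
have h2 : r / 2 < `|jump y z|.
  have : r <= `|z - x| + `|z - y|.
    by rewrite /r (_ : y - x = (z - x) - (z - y)) ?ler_normB //; ring.
  rewrite /jump; lra.
rewrite /cut1 h2; apply: (le_trans t1_); rewrite mulrAC ler_pdivlMr //; lra.
Qed.

(** The bound of [sum_err] for C0 = 1, C1 = C2 = 0 and M = 2, multiplied by b. *)
Definition far_const := (4 + 16 / b + 64 * 0 / b + 8 * 1 * (2 + 0) / b) * 2 * e * b.

(** After multiplication by a suitable c, the bound of [transition_tent_far] has the shape required
    by [sum_err], whose central zone is empty because K > 2 L. Dividing by c at the end produces the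
    factor (1 / K + k) / v x, with k the rate at x. *)
Lemma far_part (K x : R) N : 2 * L < K -> A <= x ->
  (\int[green N]_(y in upper S A `&` [set y : R | K <= `|y - x|]%R)
     (transition Q (fun z => tent dl (z - x)) y)%:E
   <= (far_const * (K^-1 + rate v b x) / v x)%:E)%E.
Proof.
move=> LK Ax; have vx := v0 Ax; have L0_ := L0; have K0 : 0 < K by lra.
have b0_ := b0.
have k0 : 0 < rate v b x by rewrite /rate divr_gt0 ?mulr_gt0.
have Ki : 0 < K^-1 by rewrite invr_gt0.
set f := transition Q (fun z => tent dl (z - x)).
(* Equals k / 2 / (1 / K + k): then c * 2 / r is at most k, and also at most k / (1 + k r), for
   every distance r >= K. *)
set c := v x / (b * (K^-1 + rate v b x)).
have c0 : 0 < c by rewrite /c divr_gt0 // mulr_gt0 // addr_gt0.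
have ik : 0 < K^-1 + rate v b x by exact: addr_gt0.
have ck : c = rate v b x / 2 / (K^-1 + rate v b x).
  move: ik; rewrite /c; set i := K^-1; rewrite /rate => ik.
  field; rewrite gt_eqF //=; rewrite (_ : i * b + 2 * v x = b * (i + 2 * v x / b)) ?gt_eqF ?mulr_gt0 //.
  by field; rewrite gt_eqF.
have f0 y : 0 <= f y by exact: transition_tent_ge0.
have mf : measurable_fun setT f by apply: measurable_transition; exact: bmeas_tent_at.
set D := _ `&` _.
have mD : measurable D.
  by apply: measurableI; [exact: (measurable_upper A H)|exact: measurable_far].
pose e1 (y : R) := p (Num.max y 0) * v (Num.max y 0).
have mmono (g : R -> R) : (forall y y' : R, 0 <= y -> y <= y' -> g y' <= g y) ->
    measurable_fun setT (fun y : R => g (Num.max y 0)).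
  move=> hf; apply: nonincreasing_measurable => // y y' yy.
  by apply: hf; [rewrite le_max lexx orbT|rewrite ge_max !le_max lexx yy orbT].
have DA (y : R) : D y -> [/\ S y, A <= y & K <= `|y - x|].
  by move=> [[Sy]] /=; rewrite in_itv /= andbT.
have e1E (y : R) : D y -> e1 y = p y * v y.
  by move=> /DA[_ Ay _]; rewrite /e1 max_l // (le_trans A0 Ay).
have cb : c <= 1.
  rewrite /c ler_pdivrMr ?mul1r; last by rewrite mulr_gt0 // addr_gt0.
  rewrite /rate mulrDr (_ : b * (2 * v x / b) = 2 * v x); last by field; rewrite gt_eqF.
  have : 0 <= b * K^-1 by rewrite mulr_ge0 // ltW.
  lra.
have pt (y : R) : D y -> c * f y <= e1 y + c * (2 / `|y - x|) * t1 (`|y - x| / 2).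
  move=> /[dup] Dy /DA[Sy Ay far]; rewrite e1E //.
  have y0 : 0 <= y by exact: le_trans Ay.
  have far2 : 2 * dl <= `|y - x| by have := dlL; lra.
  apply: le_trans (ler_wpM2l (ltW c0) (transition_tent_far Sy Ay far2)) _.
  rewrite mulrDr lerD //; last by rewrite mulrA.
  rewrite ler_piMl // mulr_ge0 //; first exact: (ds_p H).
  by apply: ltW; exact: (ds_v H).
have err := @sum_err _ (green N) D (fun y => c * f y) e1 A L 2 x (rate v b x) e b 1 0 0 v p t1.
have : (\int[green N]_(y in D) (c * f y)%:E
   <= ((4 + 16 / b + 64 * 0 / b + 8 * 1 * (2 + 0) / b) * 2 * e)%:E)%E.
  apply: err => //.
  - by move=> y /DA[].
  - exact: measurable_funM.
  - by apply: measurable_funM; apply: mmono; [exact: (ds_pdecr H)|exact: (ds_vdecr H)].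
  - exact: (ds_v H).
  - exact: (ds_vdecr H).
  - exact: (good_slow hg).
  - have h := good_Lv hg; have h2 := ler_wpM2l (ltW e0) h; have e0_ := e0; have e2_ := e2.
    have : e * e <= 2^-1 * 1 by apply: ler_pM => //; lra.
    lra.
  - exact: (ds_p H).
  - exact: (ds_pdecr H).
  - exact: (good_p hg).
  - exact: (ds_t1decr H).
  - exact: (ds_t1 H).
  - exact: (good_t1 hg).
  - move=> w; apply: (@le_trans _ _ (green N (upper S A `&` `[w, (w + L)%R[))).
      apply: le_measure; rewrite ?inE.
      + by apply: measurableI => //; exact: measurable_itv.
      + by apply: measurableI; [exact: (measurable_upper A H)|exact: measurable_itv].
      by move=> y [[hy _] hw].
    have := window_bound8 hX H hg e0 e2 eb eb2 eC N w.
    by rewrite (_ : 8 * L = 4 * L * 2) //; ring.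
  - by move=> y _; rewrite mulr_ge0 // ltW.
  - move=> y /[dup] Dy /DA[Sy Ay far] h.
    have yx : `|y - x| = - (y - x) by rewrite ltr0_norm //; lra.
    have Kyx : K <= - (y - x) by rewrite -yx.
    apply: (le_trans (pt y Dy)); rewrite yx lerD2l ler_wpM2r //.
      by apply: (ds_t1 H); lra.
    have w0 : 0 < - (y - x) by exact: lt_le_trans Kyx.
    by rewrite ck; apply: far_left_arith => //; rewrite lef_pV2 ?posrE.
  - move=> y /DA[Sy Ay far] h1 h2; exfalso.
    have : `|y - x| <= 2 * L by rewrite ler_norml h1 ltW.
    lra.
  - move=> y /[dup] Dy /DA[Sy Ay far] h.
    have yx : `|y - x| = y - x by rewrite gtr0_norm //; lra.
    have Kyx : K <= y - x by rewrite -yx.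
    have z0 : 0 < y - x by lra.
    apply: (le_trans (pt y Dy)); rewrite yx lerD2l !mul0r addr0 mul1r.
    rewrite [leRHS]mulrAC ler_wpM2r //.
      by apply: (ds_t1 H); lra.
    by rewrite ck; apply: far_right_arith => //; rewrite lef_pV2 ?posrE.
have -> : (\int[green N]_(y in D) (c * f y)%:E = c%:E * \int[green N]_(y in D) (f y)%:E)%E.
  rewrite -ge0_integralZl //; first exact/measurable_EFinP/measurable_funTS.
    by move=> y _; rewrite lee_fin.
  by rewrite lee_fin ltW.
rewrite -lee_pdivlMl // => /le_trans; apply; rewrite -EFinM lee_fin /far_const.
rewrite /c; move: ik; set i := K^-1; set k := rate v b x => ik.
rewrite le_eqVlt; apply/orP; left; apply/eqP; field.
by rewrite !gt_eqF.
Qed.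

(** Such a transition jumps from below A to beyond A + L, and these jumps are counted by
    [upcross_far_le]. *)
Lemma low_part : exists K : R, forall N x, A + L + dl <= x ->
  (\int[green N]_(y in lower S A)
     (transition Q (fun z => tent dl (z - x)) y)%:E <= K%:E)%E.
Proof.
have [K hK] := upcross_far_le hX H hg e0 e2 eb eb2 eC.
exists K => N x xA; apply: le_trans (hK N).
apply: ge0_le_integral => //.
- exact: (measurable_lower A H).
- by move=> y _; rewrite lee_fin transition_tent_ge0.
- apply/measurable_EFinP/measurable_funTS; apply: measurable_transition; exact: bmeas_tent_at.
- by apply: measurable_funTS; exact: (measurable_kernel Q _ (measurable_ray _)).
move=> y _; rewrite -EFin_transition_tent.
rewrite -[leRHS]mul1e -integral_cst; last exact: measurable_ray.
rewrite [leRHS]integral_mkcond; apply: ge0_le_integral => //.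
- by move=> z _; rewrite lee_fin; case/andP: (tent01 (z - x)).
- by apply: measurable_tentR.
- by apply/(measurable_restrictT _ _).1; [exact: measurable_ray|exact: measurable_cst].
move=> z _; rewrite /patch; case: ifPn => [_|/negP nz].
  by rewrite lee_fin; case/andP: (tent01 (z - x)).
rewrite tent_out //; have : z < A + L.
  by rewrite ltNge; apply/negP => h; apply: nz; rewrite inE /ray /= in_itv /= h.
by move=> h; rewrite ler0_norm; have := dl0; lra.
Qed.

(** 1 / v grows by at most e r over a length r, which is negligible against 1 / v as v tends to
    0. *)
Lemma drift_ratio (r a : R) : 0 <= r -> 0 < a -> exists2 B, A <= B &
  forall y y', B <= y -> y <= y' -> y' - y <= r -> v y <= (1 + a) * v y'.
Proof.
move=> r0 a0; have c0 : 0 < a / (e * r + 1).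
  by rewrite divr_gt0 // ltr_wpDl // mulr_ge0 // ltW.
have [B hB] := vinf c0; exists (Num.max A B); first by rewrite le_max lexx.
move=> y y'; rewrite ge_max => /andP[Ay By] yy yr.
have Ay' : A <= y' by exact: le_trans yy.
have vy := v0 Ay; have vy' := v0 Ay'.
have h1 := good_slow hg Ay yy.
have h2 : (v y')^-1 <= (v y)^-1 + e * r.
  have := ler_wpM2l (ltW e0) yr; lra.
have h3 := ler_wpM2l (ltW vy) (ler_wpM2l (ltW vy') h2).
rewrite mulfV ?mulr1 in h3; last by rewrite gt_eqF.
rewrite mulrDr mulrDr in h3; rewrite mulrCA mulfV ?gt_eqF // mulr1 in h3.
have h4 : v y * (e * r) <= a.
  have := hB y By; rewrite ler_pdivlMr; last by rewrite ltr_wpDl // mulr_ge0 // ltW.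
  by lra.
have h5 := ler_wpM2l (ltW vy') h4; lra.
Qed.

Definition window (x r : R) : set R := S `&` `[x - r, x + r]%classic.

Lemma measurable_window x r : measurable (window x r).
Proof. by apply: measurableI => //; exact: measurable_itv. Qed.

Lemma window_mass (r : R) : 0 <= r -> exists C B, [/\ 0 <= C, A <= B & forall x, B <= x ->
  (greenoo (window x r) <= (C / v x)%:E)%E].
Proof.
move=> r0; have L0_ := L0.
pose n := (Num.truncn (2 * r / L)).+1.
have nr : 2 * r < n%:R * L by rewrite -ltr_pdivrMr // truncnS_gt.
have [B AB hB] := drift_ratio (ltW (le_lt_trans (mulr_ge0 (ler0n _ _) r0) nr)) (ltr01 : 0 < (1 : R)).
exists (n%:R * (8 * L) * 2), (B + r); split.
- by rewrite !mulr_ge0 // ltW.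
- lra.
move=> x Bx; have Bw : B <= x - r by lra.
have Aw : A <= x - r by lra.
have vx : 0 < v x by apply: v0; lra.
have vn : 0 < v (x - r + n%:R * L) by apply: v0; lra.
apply: (@le_trans _ _ (greenoo (S `&` `[(x - r)%R, (x - r + n%:R * L)%R[))).
  apply: le_measure; rewrite ?inE; [exact: measurable_window|exact: measurableI|].
  move=> y [Sy]; rewrite /= !in_itv /= => /andP[h1 h2]; split => //.
  by rewrite h1 /=; lra.
apply: le_trans (greenoo_windows hX H hg e0 e2 eb eb2 eC n Aw) _.
rewrite lee_fin -!mulrA ler_wpM2l // !mulrA.
have A0_ := A0; have h1 : v x <= v (x - r) by apply: (ds_vdecr H); lra.
have h2 := hB (x - r) (x - r + n%:R * L) Bw.
have h3 : v (x - r) <= (1 + 1) * v (x - r + n%:R * L) by apply: h2; lra.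
rewrite ler_pdivlMr // mulrAC ler_pdivrMr // -!mulrA ler_wpM2l // ler_wpM2l //; first exact: ltW.
lra.
Qed.

End FarPart.

Lemma tent_lip (R : realType) (l u w : R) : 0 < l -> `|tent l u - tent l w| <= `|u - w| / l.
Proof.
move=> l0; rewrite /tent /pos.
have h : `|(1 - `|u| / l) - (1 - `|w| / l)| <= `|u - w| / l.
  rewrite (_ : _ - _ = (`|w| - `|u|) / l); last by ring.
  have li : 0 <= l^-1 by rewrite invr_ge0 ltW.
  by rewrite normrM (ger0_norm li) ler_wpM2r // distrC ler_dist_dist.
apply: le_trans h; set a := 1 - _; set c := 1 - _.
have h1 := ler_norm (a - c); have h2 := ler_norm (c - a); rewrite distrC in h2.
by rewrite ler_norml; case: (leP 0 a); case: (leP 0 c) => hc ha; lra.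
Qed.

Lemma common_bound (R : realDomainType) (Pr : nat -> R -> Prop) N :
  (forall j, exists B, forall y, B <= y -> Pr j y) ->
  exists B, forall j y, (j < N)%N -> B <= y -> Pr j y.
Proof.
move=> h; elim: N => [|N [B hB]]; first by exists 0.
have [B' hB'] := h N; exists (Num.max B B') => j y; rewrite ltnS leq_eqVlt ge_max.
by move=> /orP[/eqP-> /andP[_]|jN /andP[+ _]]; [exact: hB'|exact: hB].
Qed.

(** * Averaging against the limit law *)

Section Averaging.
Context {R : realType} d (Omega : measurableType d) (P : probability Omega R).
Variables (S : set R) (Q : R.-pker R ~> R) (X : nat -> {RV P >-> R}).
Context d2 (T2 : measurableType d2) (P2 : probability T2 R) (xi : {RV P2 >-> R}).
Variables (v s p t1 : R -> R) (b B2 e L A dl : R).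
Hypothesis hX : markov_chain S Q X.
Hypothesis H : drift_setting S Q v s p t1 b B2.
Hypothesis hg : good S Q v s p t1 b e L A.
Hypotheses (e0 : 0 < e) (e2 : e <= 2^-1) (eb : e <= b / 8) (eb2 : e * b <= 2).
Hypothesis eC : err_const b B2 * e <= 2^-1.
Hypotheses (dl0 : 0 < dl) (dlL : dl <= L).
Hypothesis vinf : forall a : R, 0 < a -> exists B, forall x, B <= x -> v x <= a.
Hypothesis hxi : jump_cvg_in_distribution S Q xi.

Local Notation law := (law X).
Local Notation greenoo := (greenoo X).
Local Notation tent_green := (tent_green S X dl).
Local Notation window := (window S).

Let A0 : 0 <= A. Proof. exact: (good_A hg). Qed.
Let L0 : 0 < L. Proof. exact: lt_le_trans (good_L hg). Qed.
Let b0 : 0 < b. Proof. exact: (ds_b H). Qed.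
Let mS : measurable S. Proof. exact: (ds_mS H). Qed.
Let v0 x : A <= x -> 0 < v x.
Proof. by move=> Ax; apply: (ds_v H); exact: le_trans Ax. Qed.
Let P2T : (P2 setT < +oo)%E. Proof. by rewrite probability_setT ltry. Qed.
Let t01 z : 0 <= tent dl z <= 1. Proof. exact: tent_itv. Qed.

Let cont_tent (w : R) : continuous (fun u => tent dl (w + u)).
Proof.
move=> u; apply/cvgrPdist_le => eps eps0; near=> u'.
apply: le_trans (tent_lip _ _ dl0) _.
rewrite (_ : w + u - (w + u') = u - u'); last by ring.
rewrite ler_pdivrMr //; near: u'; apply: cvgr_dist_le; first exact: cvg_id.
exact: mulr_gt0.
Unshelve. all: by end_near. Qed.

Let mtent : measurable_fun setT (tent dl).
Proof.
rewrite (_ : tent dl = fun y => tent dl (y - 0)); first exact: measurable_tent.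
by apply/funext => y; rewrite subr0.
Qed.

Let bt dd (T : measurableType dd) (f : T -> R) (D : set T) : measurable_fun setT f ->
  bmeas D (fun y => tent dl (f y)).
Proof.
move=> mf; apply: (@bmeasI _ _ _ D _ 1); first exact: measurableT_comp.
by move=> y _; case/andP: (t01 (f y)) => h1 h2; rewrite ger0_norm.
Qed.

Let jump_mean y w := \int[Q y]_z tent dl (w + jump y z).
Let limit_mean w := \int[P2]_t tent dl (w + xi t).

Let mxi w : measurable_fun setT (fun t => w + xi t).
Proof. by apply: measurable_funD => //; exact: measurable_cst. Qed.

Let mean_lip dd (T : measurableType dd) (q : {measure set T -> \bar R}) (f : T -> R) w w' :
  q setT = 1%E -> measurable_fun setT f ->
  `|\int[q]_z tent dl (w + f z) - \int[q]_z tent dl (w' + f z)| <= `|w - w'| / dl.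
Proof.
move=> q1 mf; have qT : (q setT < +oo)%E by rewrite q1 ltry.
have mw c : measurable_fun setT (fun z => c + f z).
  by apply: measurable_funD => //; exact: measurable_cst.
rewrite -bRintB //; [|exact: bt|exact: bt].
apply: (@le_trans _ _ (\int[q]_z (`|w - w'| / dl))).
  apply: le_norm_bRint => //; [by apply: bmeasB; exact: bt|exact: bmeas_cst|].
  move=> z _; apply: le_trans (tent_lip _ _ dl0) _.
  by rewrite (_ : w + f z - (w' + f z) = w - w') //; ring.
by rewrite Rintegral_cst // q1 mulr1.
Qed.

(** Weak convergence concerns one test function at a time, here one shift w. Both means are
    Lipschitz in w, so a finite net of [-K, K] gives uniformity in y. *)
Lemma uniform_weak_limit (K a : R) : 0 <= K -> 0 < a -> exists B, forall x, B <= x ->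
  forall y, S y -> `|y - x| <= K ->
  `|transition Q (fun z => tent dl (z - x)) y - limit_mean (y - x)| <= a.
Proof.
(* The mesh of the net: a shift by eta moves either mean by at most eta / dl = a / 3. *)
move=> K0 a0; pose eta := dl * a / 3; have eta0 : 0 < eta by rewrite divr_gt0 // mulr_gt0.
pose w j : R := - K + j%:R * eta; pose N := (Num.truncn (2 * K / eta)).+1.
have net j : exists B, forall y, B <= y -> S y -> `|jump_mean y (w j) - limit_mean (w j)| <= a / 3.
  have bd : exists M, forall u, `|tent dl (w j + u)| <= M.
    by exists 1 => u; case/andP: (t01 (w j + u)) => h1 h2; rewrite ger0_norm.
  have /cvgrPdist_le h := hxi (@cont_tent (w j)) bd.
  have a3 : 0 < a / 3 by rewrite divr_gt0.
  have [M [_ hM]] := h _ a3; exists (M + 1) => y My Sy.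
  by rewrite distrC; apply: hM => //; apply: lt_le_trans My; rewrite ltrDl.
have [B hB] := common_bound N net; exists (B + K) => x Bx y Sy yx.
have yx1 : - K <= y - x <= K by rewrite -ler_norml.
have [yx2 yx3] := andP yx1.
pose j := Num.truncn ((y - x + K) / eta).
have h0 : 0 <= (y - x + K) / eta by rewrite divr_ge0 //; [lra|exact: ltW].
have := truncn_itv h0; rewrite -/j ler_pdivlMr // ltr_pdivrMr // => /andP[j1 j2].
have jN : (j < N)%N.
  rewrite /N ltnS; apply: le_truncn; rewrite ler_pM2r ?invr_gt0 //; lra.
have yB : B <= y by lra.
have h1 := hB j y jN yB Sy.
have wj : `|y - x - w j| / dl <= a / 3.
  rewrite -natr1 mulrDl mul1r in j2.
  rewrite ler_pdivrMr // (_ : a / 3 * dl = eta); last by rewrite /eta; ring.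
  by rewrite ler_norml /w; move: j1 j2; set c := j%:R * eta; lra.
have E1 : transition Q (fun z => tent dl (z - x)) y = jump_mean y (y - x).
  rewrite /transition /jump_mean; congr Rintegral; apply/funext => z.
  by congr tent; rewrite /jump; ring.
have h2 := @mean_lip _ _ (Q y) (@jump R y) (y - x) (w j) (Q1 Q y) (measurable_jump y).
have h3 := @mean_lip _ _ P2 xi (y - x) (w j) (probability_setT P2) (measurable_funP xi).
rewrite E1; rewrite -/(jump_mean _ _) -/(jump_mean _ _) in h2.
rewrite -/(limit_mean _) -/(limit_mean _) in h3.
have h2' := le_trans h2 wj; have h3' := le_trans h3 wj.
move: h1 h2' h3'; rewrite !ler_norml; lra.
Qed.

Section Fubini.
Variables (D : set R) (x : R).
Hypothesis mD : measurable D.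

Let F (z : R * T2) : \bar R := ((fun y => (tent dl (y - (x - xi z.2)))%:E) \_ D) z.1.

Let F0 z : (0 <= F z)%E.
Proof. by rewrite /F; apply: erestrict_ge0 => y; rewrite lee_fin; case/andP: (t01 (y - (x - xi z.2))). Qed.

Let mF : measurable_fun setT F.
Proof.
rewrite (_ : F = (fun z => (tent dl (z.1 - (x - xi z.2)) * \1_D z.1)%:E)); last first.
  apply/funext => z; rewrite /F /patch indicE; case: ifPn => _; first by rewrite mulr1.
  by rewrite mulr0.
apply/measurable_EFinP; apply: measurable_funM.
  apply: measurableT_comp => //; apply: measurable_funB; first exact: measurable_fst.
  apply: measurable_funB; first exact: measurable_cst.
  by apply: measurableT_comp => //; exact: measurable_snd.
by apply: measurableT_comp; [exact: measurable_indic|exact: measurable_fst].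
Qed.

Local Open Scope ereal_scope.

Let green_series t : \int[greenoo]_(y in D) (tent dl (y - (x - xi t)))%:E =
  \sum_(0 <= n <oo) \int[distribution P (X n)]_y F (y, t).
Proof.
rewrite greenooE //; [|exact: measurable_tentR|
  by move=> y _; rewrite lee_fin; case/andP: (t01 (y - (x - xi t)))].
by apply: eq_eseriesr => n _; rewrite integral_mkcond.
Qed.

Let mgreen_n n : measurable_fun setT (fun t => \int[distribution P (X n)]_y F (y, t)).
Proof. exact: (@measurable_fun_fubini_tonelli_G _ _ _ _ R (distribution P (X n)) F mF F0). Qed.

Lemma measurable_tent_green_shift :
  measurable_fun setT (fun t => \int[greenoo]_(y in D) (tent dl (y - (x - xi t)))%:E).
Proof.
under eq_fun do rewrite green_series.
apply: ge0_emeasurable_sum => // n t _ _; exact: integral_ge0.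
Qed.

(** The Green measure is a countable sum of finite measures: Fubini is applied to each law, and the
    series is exchanged with the integral. *)
Lemma tent_green_fubini :
  \int[greenoo]_(y in D) \int[P2]_t (tent dl (y - (x - xi t)))%:E =
  \int[P2]_t \int[greenoo]_(y in D) (tent dl (y - (x - xi t)))%:E.
Proof.
under [RHS]eq_integral do rewrite green_series.
rewrite integral_nneseries //; last by move=> n t _; exact: integral_ge0.
have mG : measurable_fun D (fun y => \int[P2]_t (tent dl (y - (x - xi t)))%:E).
  apply: measurable_funTS.
  pose f (z : R * T2) := (tent dl (z.1 - (x - xi z.2)))%:E.
  have mf : measurable_fun setT f.
    apply/measurable_EFinP; apply: measurableT_comp => //.
    apply: measurable_funB; first exact: measurable_fst.
    apply: measurable_funB; first exact: measurable_cst.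
    by apply: measurableT_comp => //; exact: measurable_snd.
  apply: (@measurable_fun_fubini_tonelli_F _ _ _ _ R P2 f mf) => z.
  by rewrite lee_fin; case/andP: (t01 (z.1 - (x - xi z.2))).
rewrite greenooE //; last first.
  by move=> y _; apply: integral_ge0 => t _; rewrite lee_fin; case/andP: (t01 (y - (x - xi t))).
apply: eq_eseriesr => n _.
rewrite -(@fubini_tonelli _ _ _ _ R (distribution P (X n)) P2 F mF F0).
rewrite integral_mkcond; apply: eq_integral => y _.
rewrite /patch /F; case: ifPn => yD.
  by apply: eq_integral => t _; rewrite /patch yD.
by under eq_integral => t _ do rewrite /patch (negbTE yD); rewrite integral0.
Qed.

End Fubini.

Lemma drift_compare (r a : R) : 0 <= r -> 0 < a -> exists2 B, A <= B &
  forall x x', B <= x -> `|x - x'| <= r ->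
    [/\ A <= x', v x <= (1 + a) * v x' & `|v x - v x'| <= a * v x'].
Proof.
move=> r0 a0; have [B AB hB] := drift_ratio H hg e0 vinf r0 a0.
exists (B + r) => [|x x' Bx]; first by lra.
rewrite ler_norml => /andP[h1 h2]; have A0_ := A0.
have Ax' : A <= x' by lra.
have vx' := v0 Ax'; have ax' : 0 < a * v x' by exact: mulr_gt0.
split => //.
  have [xx|/ltW xx] := leP x x'; first by apply: hB; lra.
  by have := ds_vdecr H (le_trans A0_ Ax') xx; lra.
have [xx|/ltW xx] := leP x x'.
  have h3 : v x <= (1 + a) * v x' by apply: hB; lra.
  have h4 : v x' <= v x by apply: (ds_vdecr H) => //; lra.
  rewrite ger0_norm; lra.
have h3 : v x' <= (1 + a) * v x by apply: hB; lra.
have h4 : v x <= v x' by apply: (ds_vdecr H) => //; lra.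
have h5 := ler_wpM2l (ltW a0) h4.
rewrite ler0_norm; lra.
Qed.

Lemma tent_green_window (x0 r x : R) : x0 - r <= x - dl -> x + dl <= x0 + r ->
  tent_green x = \int[greenoo]_(y in window x0 r) tent dl (y - x).
Proof.
move=> h1 h2; rewrite /tent_green /Rintegral; congr fine.
rewrite [LHS]integral_mkcond [RHS]integral_mkcond; apply: eq_integral => y _.
rewrite /patch; case: ifPn => [/set_mem Sy|/negP nSy]; last first.
  by rewrite memNset // => -[/mem_set].
case: ifPn => // /negP nw; rewrite tent_out //; rewrite leNgt; apply/negP.
rewrite ltr_norml => /andP[h3 h4]; apply: nw; rewrite inE; split => //=.
rewrite in_itv /=; apply/andP; split; lra.
Qed.

Lemma bmeas_tent_window (x0 r x : R) : bmeas (window x0 r) (fun y : R => tent dl (y - x)).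
Proof. by apply: bt; apply: measurable_funB => //; exact: measurable_cst. Qed.

(** C is chosen before r: a tent only sees a window of half-width dl around its centre, and r
    affects the starting level alone. *)
Lemma tent_window_bound : exists2 C, 0 <= C & forall r, 0 <= r -> exists2 B, A <= B &
  forall x x', B <= x -> v x * \int[greenoo]_(y in window x r) tent dl (y - x') <= C.
Proof.
have dl0_ := dl0.
have [C [B0 [C0 AB0 hB0]]] := window_mass hX H hg e0 e2 eb eb2 eC vinf (ltW dl0).
exists (2 * C) => [|r r0]; first by rewrite mulr_ge0.
have [C' [B1 [C'0 AB1 hB1]]] := window_mass hX H hg e0 e2 eb eb2 eC vinf r0.
have rd : 0 <= r + dl by lra.
have [B2' AB2 hB2] := drift_compare rd (ltr01 : 0 < (1 : R)).
exists (Num.max (B0 + r + dl) (Num.max B1 B2')) => [|x x']; first by rewrite !le_max; apply/orP; left; lra.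
rewrite !ge_max => /and3P[x0 x1 x2].
have fin : (greenoo (window x r) < +oo)%E by exact: le_lt_trans (hB1 x x1) (ltry _).
have mW := measurable_window H x r; have mW' := measurable_window H x' dl.
have Ax : A <= x by lra.
have vx := v0 Ax.
have [xx|xx] := leP (`|x - x'|) (r + dl); last first.
  rewrite (_ : \int[greenoo]_(y in window x r) tent dl (y - x') = 0); first by rewrite mulr0 mulr_ge0.
  rewrite /Rintegral integral0_eq // => y [Sy]; rewrite /= in_itv /= => /andP[h1 h2].
  rewrite tent_out // leNgt; apply/negP; rewrite ltr_norml => /andP[h3 h4].
  by move: xx; rewrite ltNge => /negP; apply; rewrite ler_norml; lra.
have [Ax' hv _] := hB2 x x' x2 xx.
have vx' := v0 Ax'.
have Bx' : B0 <= x' by move: xx; rewrite ler_norml => /andP[]; lra.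
have h1 : (\int[greenoo]_(y in window x r) (tent dl (y - x'))%:E <= (C / v x')%:E)%E.
  apply: le_trans (hB0 x' Bx').
  rewrite -[leRHS]mul1e -integral_cst // [leLHS]integral_mkcond [leRHS]integral_mkcond.
  apply: ge0_le_integral => //.
  - by move=> y _; apply: erestrict_ge0 => z _; rewrite lee_fin; case/andP: (t01 (z - x')).
  - exact: ((measurable_restrictT _ mW).1 (@measurable_tentR R dl x' (window x r))).
  - exact: ((measurable_restrictT _ mW').1 (measurable_cst _)).
  move=> y _; rewrite /patch; case: ifPn => [/set_mem[Sy _]|_]; last first.
    by case: ifPn => // _; rewrite lee_fin.
  case: ifPn => [_|/negP nw]; first by rewrite lee_fin; case/andP: (t01 (y - x')).
  rewrite tent_out // leNgt; apply/negP; rewrite ltr_norml => /andP[h3 h4].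
  by apply: nw; rewrite inE; split => //=; rewrite in_itv /=; lra.
rewrite -bRint_EFin // ?lee_fin in h1; last exact: bmeas_tent_window.
rewrite ler_pdivlMr // in h1.
have h2 : 0 <= \int[greenoo]_(y in window x r) tent dl (y - x').
  by apply: Rintegral_ge0 => y _; case/andP: (t01 (y - x')).
have h3 := ler_wpM2r h2 hv; lra.
Qed.

Let mlimit (D : set R) x : measurable_fun D (fun y => limit_mean (y - x)).
Proof.
apply: measurable_funTS; apply/measurable_EFinP.
pose f (z : R * T2) := (tent dl (z.1 - x + xi z.2))%:E.
have mf : measurable_fun setT f.
  apply/measurable_EFinP; apply: measurableT_comp => //; apply: measurable_funD.
    by apply: measurable_funB; [exact: measurable_fst|exact: measurable_cst].
  by apply: measurableT_comp => //; exact: measurable_snd.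
rewrite (_ : _ \o _ = fubini_F P2 f).
  apply: (@measurable_fun_fubini_tonelli_F _ _ _ _ R P2 f mf) => z.
  by rewrite lee_fin; case/andP: (t01 (z.1 - x + xi z.2)).
by apply/funext => y; rewrite /= /limit_mean bRint_EFin //; exact: bt.
Qed.

Let limit_mean01 w : 0 <= limit_mean w <= 1.
Proof.
have P1 : \int[P2]_t (1 : R) = 1.
  by rewrite Rintegral_cst // mul1r; exact: (congr1 fine (probability_setT P2)).
rewrite Rintegral_ge0 /=; last by move=> t _; case/andP: (t01 (w + xi t)).
rewrite -[leRHS]P1; apply: le_bRint => //; [exact: bt|exact: bmeas_cst|].
by move=> t _; case/andP: (t01 (w + xi t)).
Qed.

Lemma bmeas_limit_mean (D : set R) x : measurable D -> bmeas D (fun y => limit_mean (y - x)).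
Proof.
move=> mD; apply: (@bmeasI _ _ _ D _ 1); first exact: mlimit.
by move=> y _; case/andP: (limit_mean01 (y - x)) => h1 h2; rewrite ger0_norm.
Qed.

(** The tent is moved by xi but the mass is counted in a fixed window around x. This keeps the
    function bounded even where x - xi falls below the controlled levels. *)
Definition window_green (x r : R) (t : T2) : R :=
  \int[greenoo]_(y in window x r) tent dl (y - (x - xi t)).

Lemma bmeas_window_green x r : (greenoo (window x r) < +oo)%E ->
  bmeas setT (window_green x r).
Proof.
move=> fin; have mW := measurable_window H x r.
apply: (@bmeasI _ _ _ setT _ (fine (greenoo (window x r)))).
  apply/measurable_EFinP; rewrite (_ : _ \o _ =
    (fun t => \int[greenoo]_(y in window x r) (tent dl (y - (x - xi t)))%:E)%E).
    exact: measurable_tent_green_shift.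
  by apply/funext => t; rewrite /= /window_green bRint_EFin //; exact: bmeas_tent_window.
move=> t _; rewrite -[leRHS]mul1r -Rintegral_cst //.
apply: le_norm_bRint => //; [exact: bmeas_tent_window|exact: bmeas_cst|].
by move=> y _; case/andP: (t01 (y - (x - xi t))) => h1 h2; rewrite ger0_norm.
Qed.

Lemma window_green_mean x r : (greenoo (window x r) < +oo)%E ->
  \int[greenoo]_(y in window x r) limit_mean (y - x) = \int[P2]_t window_green x r t.
Proof.
move=> fin; have mW := measurable_window H x r.
apply: EFin_inj; rewrite bRint_EFin //; last exact: bmeas_limit_mean.
rewrite bRint_EFin //; last exact: bmeas_window_green.
have := @tent_green_fubini (window x r) x mW.
under [in LHS]eq_integral => y _.
  have e1 : (\int[P2]_t (tent dl (y - (x - xi t)))%:E = (limit_mean (y - x))%:E)%E.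
    rewrite /limit_mean bRint_EFin //; last exact: bt.
    by apply: eq_integral => t _; congr (tent dl _)%:E; ring.
  rewrite e1; over.
move=> ->; apply: eq_integral => t _.
by rewrite /window_green bRint_EFin //; exact: bmeas_tent_window.
Qed.

End Averaging.

Lemma fin_between (R : realDomainType) (a : \bar R) (m : R) : (0 <= a)%E -> (a <= m%:E)%E ->
  exists2 r, a = r%:E & 0 <= r <= m.
Proof. by case: a => [r| |] // h1 h2; exists r => //; move: h1 h2; rewrite !lee_fin => -> ->. Qed.

Lemma averaging_arith (R : realFieldType) (a C' vx fc K1 b r tg I1 I2 : R) :
  0 <= a -> 0 <= C' -> 0 < vx -> 0 <= fc -> 0 <= K1 -> 0 < b -> 0 < r -> 4 * fc <= a * r ->
  vx <= a / 4 / (K1 + 2 * fc / b + 1) -> 0 <= tg - I1 ->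
  tg - I1 <= K1 + fc * (r^-1 + 2 * vx / b) / vx ->
  `|I1 - I2| <= a / 4 / (C' + 1) * (C' / vx) ->
  `|vx * tg - vx * I2| <= a.
Proof.
move=> a0 C0 v0 f0 K0 b0 r0 h1 h2 h3 h4 h5.
have q0 : 0 <= K1 + 2 * fc / b by rewrite addr_ge0 // divr_ge0 ?mulr_ge0 // ltW.
have e1 : vx * `|I1 - I2| <= a / 4.
  apply: le_trans (ler_wpM2l (ltW v0) h5) _.
  rewrite (_ : vx * _ = a / 4 * (C' / (C' + 1))); last by field; rewrite !gt_eqF //; lra.
  rewrite ler_piMr //; first by lra.
  by rewrite ler_pdivrMr; lra.
have e2 : vx * (K1 + 2 * fc / b) <= a / 4.
  apply: le_trans (ler_wpM2r q0 h2) _.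
  set q := K1 + 2 * fc / b in q0 *.
  rewrite (_ : a / 4 / (q + 1) * q = a / 4 * (q / (q + 1))); last by ring.
  rewrite ler_piMr //; first by lra.
  by rewrite ler_pdivrMr; lra.
have e3 : fc / r <= a / 4 by rewrite ler_pdivrMr //; lra.
have e4 : vx * (tg - I1) <= a / 2.
  apply: le_trans (ler_wpM2l (ltW v0) h4) _.
  rewrite (_ : vx * _ = vx * (K1 + 2 * fc / b) + fc / r); first by lra.
  by field; rewrite !gt_eqF.
have e5 : 0 <= vx * (tg - I1) by rewrite mulr_ge0 // ltW.
rewrite (_ : _ - _ = vx * (tg - I1) + vx * (I1 - I2)); last by ring.
apply: le_trans (ler_normD _ _) _; rewrite ger0_norm // normrM (gtr0_norm v0); lra.
Qed.

Section AveragingProperty.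
Context {R : realType} d (Omega : measurableType d) (P : probability Omega R).
Variables (S : set R) (Q : R.-pker R ~> R) (X : nat -> {RV P >-> R}).
Context d2 (T2 : measurableType d2) (P2 : probability T2 R) (xi : {RV P2 >-> R}).
Variables (v s p t1 : R -> R) (b B2 e L A dl : R).
Hypothesis hX : markov_chain S Q X.
Hypothesis H : drift_setting S Q v s p t1 b B2.
Hypothesis hg : good S Q v s p t1 b e L A.
Hypotheses (e0 : 0 < e) (e2 : e <= 2^-1) (eb : e <= b / 8) (eb2 : e * b <= 2).
Hypothesis eC : err_const b B2 * e <= 2^-1.
Hypotheses (dl0 : 0 < dl) (dlL : dl <= L).
Hypothesis vinf : forall a : R, 0 < a -> exists B, forall x, B <= x -> v x <= a.
Hypothesis hxi : jump_cvg_in_distribution S Q xi.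

Local Notation law := (law X).
Local Notation greenoo := (greenoo X).
Local Notation tent_green := (tent_green S X dl).
Local Notation window := (window S).
Local Notation window_green := (window_green S X xi dl).
Let limit_mean w := \int[P2]_t tent dl (w + xi t).
Let rmean x := transition Q (fun z => tent dl (z - x)).

Let A0 : 0 <= A. Proof. exact: (good_A hg). Qed.
Let L0 : 0 < L. Proof. exact: lt_le_trans (good_L hg). Qed.
Let b0 : 0 < b. Proof. exact: (ds_b H). Qed.
Let mS : measurable S. Proof. exact: (ds_mS H). Qed.
Let v0 x : A <= x -> 0 < v x.
Proof. by move=> Ax; apply: (ds_v H); exact: le_trans Ax. Qed.
Let t01 z : 0 <= tent dl z <= 1. Proof. exact: tent_itv. Qed.
Let P2T : (P2 setT < +oo)%E. Proof. by rewrite probability_setT ltry. Qed.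
Let rmean0 x y : 0 <= rmean x y. Proof. exact: transition_tent_ge0. Qed.
Let mW x r : measurable (window x r). Proof. exact: (measurable_window H). Qed.
Let brmean x D : bmeas D (rmean x).
Proof. exact: (bmeasS (@subsetT _ D) (bmeas_transition Q (bmeas_tent_at dl0 x setT))). Qed.
Let mrmean x D : measurable_fun D (fun y => (rmean x y)%:E).
Proof. by apply/measurable_EFinP/measurable_funTS; case: (brmean x setT). Qed.

Lemma greenoo_integral_states (f : R -> \bar R) : measurable_fun setT f -> (forall y, 0 <= f y)%E ->
  (\int[greenoo]_y f y = \int[greenoo]_(y in S) f y)%E.
Proof.
move=> mf f0; rewrite (@ge0_negligible_integral _ _ _ _ setT (~` S)) //.
- by rewrite setTD setCK.
- exact: measurableC.
- exact: (greenoo_states hX).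
Qed.

(** Renewal equation for the tent. Outside the window it leaves the initial law, the low states and
    the distant states. The first two are bounded; only the third can grow like 1 / v x, with the
    small factor 1 / r. *)
Lemma green_window_mean : exists2 K, 0 <= K & forall r, 2 * L < r -> exists2 B, A <= B &
  forall x, B <= x -> (greenoo (window x r) < +oo)%E /\
    0 <= tent_green x - \int[greenoo]_(y in window x r) rmean x y
      <= K + far_const b e * (r^-1 + rate v b x) / v x.
Proof.
have [K hK] := low_part hX H hg e0 e2 eb eb2 eC dl0.
exists (1 + Num.max 0 K) => [|r r0]; first by rewrite addr_ge0 // le_max lexx.
have L0_ := L0; have dlL_ := dlL; have dl0_ := dl0; have r00 : 0 <= r by lra.
have [C [B1 [C0 AB1 hB1]]] := window_mass hX H hg e0 e2 eb eb2 eC vinf r00.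
exists (Num.max B1 (A + L + dl + r)) => [|x]; first by rewrite le_max AB1.
rewrite ge_max => /andP[x1 x2]; have Ax : A <= x by lra.
have vx := v0 Ax.
have fin : (greenoo (window x r) < +oo)%E by exact: le_lt_trans (hB1 x x1) (ltry _).
split=> //.
set W := window x r in fin *; have mWx : measurable W by exact: mW.
set w := \int[greenoo]_(y in W) rmean x y; set c := far_const b e * _ / _.
have mU := measurable_upper A H; have mL := measurable_lower A H.
have WU : W `<=` upper S A.
  move=> y [Sy]; rewrite /= in_itv /= => /andP[h1 h2]; split => //=.
  by rewrite in_itv /= andbT; lra.
have tT : (tent_green x)%:E = (\int[greenoo]_y (tent dl (y - x))%:E)%E.
  rewrite greenoo_integral_states; first last.
  - by move=> y; rewrite lee_fin; case/andP: (t01 (y - x)).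
  - exact: measurable_tentR.
  rewrite (@tent_green_window _ _ _ _ S X dl dl0 x r x); [|lra|lra].
  rewrite bRint_EFin //; last exact: (bmeas_tent_at dl0).
  rewrite [LHS]integral_mkcond [RHS]integral_mkcond; apply: eq_integral => y _.
  rewrite /patch; case: (boolP (y \in S)) => [/set_mem Sy|/negP nSy]; last first.
    by rewrite memNset // => -[/mem_set].
  case: ifPn => // /negP nw; rewrite tent_out // leNgt; apply/negP.
  rewrite ltr_norml => /andP[h3 h4]; apply: nw; rewrite inE; split => //=.
  by rewrite in_itv /=; lra.
rewrite (renewal_identity hX) // in tT; last 2 first.
- exact: measurable_tentR.
- by move=> y; rewrite lee_fin; case/andP: (t01 (y - x)).
have QE : (\int[greenoo]_y \int[Q y]_z (tent dl (z - x))%:E = \int[greenoo]_y (rmean x y)%:E)%E.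
  by apply: eq_integral => y _; rewrite EFin_transition_tent.
have r0E y : (0 <= (rmean x y)%:E)%E by rewrite lee_fin.
have SUL : S = upper S A `|` lower S A.
  rewrite /upper /lower -setIUr; apply/esym/setIidPl => y _ /=.
  by rewrite !in_itv /= andbT; case: (leP A y); [left|right].
have UW : upper S A = W `|` (upper S A `\` W) by rewrite setDUK.
have dUL : [disjoint upper S A & lower S A].
  apply/disj_setPS => y [/upperP[_ h1] /lowerP[_ h2]]; lra.
have split_ : (\int[greenoo]_y (rmean x y)%:E = \int[greenoo]_(y in W) (rmean x y)%:E
   + \int[greenoo]_(y in upper S A `\` W) (rmean x y)%:E
   + \int[greenoo]_(y in lower S A) (rmean x y)%:E)%E.
  rewrite greenoo_integral_states; [|exact: (@mrmean x _)|exact: r0E].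
  rewrite {1}SUL ge0_integral_setU; [|exact: mU|exact: mL|exact: (@mrmean x _)|by move=> y _; exact: r0E|exact: dUL].
  congr (_ + _)%E; rewrite {1}UW ge0_integral_setU; [by []|exact: mWx|exact: measurableD|exact: (@mrmean x _)|by move=> y _; exact: r0E|].
  by apply/disj_setPS => y [h1 [_ h2]].
rewrite QE split_ in tT.
have [a aE /andP[a0 a1]] : exists2 a, (\int[law 0]_y (tent dl (y - x))%:E = a%:E)%E & 0 <= a <= 1.
  apply: fin_between.
    by apply: integral_ge0 => y _; rewrite lee_fin; case/andP: (t01 (y - x)).
  apply: (@le_trans _ _ (\int[law 0]_y (cst 1%E y))%E); last by rewrite integral_cst // law1 mul1e.
  apply: ge0_le_integral => //.
  - by move=> y _; rewrite lee_fin; case/andP: (t01 (y - x)).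
  - exact: measurable_tentR.
  - by move=> y _ /=; rewrite lee_fin; case/andP: (t01 (y - x)).
have [l lE /andP[l0 l1]] : exists2 l, (\int[greenoo]_(y in lower S A) (rmean x y)%:E = l%:E)%E
    & 0 <= l <= K.
  apply: fin_between; first exact: integral_ge0.
  by apply: (greenoo_le mL (@mrmean x _)) => // N; apply: hK; lra.
have [u uE /andP[u0 u1]] : exists2 u, (\int[greenoo]_(y in upper S A `\` W) (rmean x y)%:E = u%:E)%E
    & 0 <= u <= c.
  apply: fin_between; first exact: integral_ge0.
  have mF : measurable (upper S A `&` [set y : R | r <= `|y - x|]).
    by apply: measurableI => //; exact: measurable_far.
  have fp N := far_part hX H hg e0 e2 eb eb2 eC dl0 dlL N r0 Ax.
  rewrite -/c in fp.
  apply: (@le_trans _ _ (\int[greenoo]_(y in upper S A `&` [set y : R | (r <= `|y - x|)%R])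
      (rmean x y)%:E)%E); last exact: (greenoo_le mF (@mrmean x _) (fun y _ => r0E y) fp).
  apply: ge0_subset_integral; [exact: measurableD|exact: mF|exact: (@mrmean x _)|by move=> y _; exact: r0E|].
  move=> y [Uy nW]; split => //=; rewrite leNgt; apply/negP => h; apply: nW.
  have [Sy _] := upperP Uy; split => //=; rewrite in_itv /=.
  by move: h; rewrite ltr_norml => /andP[]; lra.
have wE : (\int[greenoo]_(y in W) (rmean x y)%:E = w%:E)%E by rewrite /w bRint_EFin.
rewrite wE aE lE uE -!EFinD in tT.
case: tT => ->.
have K0 : K <= Num.max 0 K by rewrite le_max lexx orbT.
apply/andP; split; lra.
Qed.

(** Here g stands for u (x - xi) with u = v * tent_green. That value is not controlled where x - xi
    is low, so g is bounded everywhere and agrees with it up to a only where |xi| <= K. *)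
Lemma averaging : exists2 C, 0 <= C & forall a K0, 0 < a -> exists K B, [/\ K0 <= K, A <= B &
  forall x, B <= x -> exists g : T2 -> R, [/\ measurable_fun setT g,
    forall t, 0 <= g t <= C,
    `|v x * tent_green x - \int[P2]_t g t| <= a &
    forall t, `|xi t| <= K -> `|g t - v (x - xi t) * tent_green (x - xi t)| <= a]].
Proof.
have [C C0 hC] := tent_window_bound hX H hg e0 e2 eb eb2 eC dl0 vinf.
have [K1 K10 hK1] := green_window_mean.
exists C => // a K0 a0.
have b0_ := b0; have L0_ := L0; have dl0_ := dl0; have dlL_ := dlL; have A0_ := A0.
set fc := far_const b e in hK1.
have fc0 : 0 <= fc.
  have bi : 0 <= b^-1 by rewrite invr_ge0 ltW.
  rewrite /fc /far_const !mulr_ge0 ?ltW // mulr0 mul0r addr0.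
  by have : 0 < 4 + 16 / b + 8 * 1 * (2 + 0) / b; [lra|].
(* The entry 3 L makes the window wider than 2 L, and 4 fc / a makes the distant contribution at
   most a / 4. *)
pose K := Num.max K0 (Num.max (3 * L) (4 * fc / a)).
have KK0 : K0 <= K by rewrite /K le_max lexx.
have KL : 3 * L <= K by rewrite /K !le_max lexx orbT.
have Kf : 4 * fc / a <= K by rewrite /K !le_max lexx !orbT.
clearbody K.
have [r rE] : exists r, r = K + dl by exists (K + dl).
have r2L : 2 * L < r by rewrite rE; lra.
have r0 : 0 < r by lra.
have [B1 AB1 hB1] := hK1 r r2L.
have [C' [B2' [C'0 AB2 hB2]]] := window_mass hX H hg e0 e2 eb eb2 eC vinf (ltW r0).
have a1 : 0 < a / 4 / (C' + 1) by rewrite !divr_gt0 // ltr_wpDl.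
have [B3 hB3] := uniform_weak_limit dl0 hxi (ltW r0) a1.
have [B4 AB4 hB4] := hC r (ltW r0).
have a2 : 0 < a / (C + 1) by rewrite divr_gt0 // ltr_wpDl.
have K00 : 0 <= K by lra.
have [B5 AB5 hB5] := drift_compare H hg e0 vinf K00 a2.
have a3 : 0 < a / 4 / (K1 + 2 * fc / b + 1).
  have q0 : 0 <= 2 * fc / b.
    by apply: divr_ge0; [apply: mulr_ge0; [lra|exact: fc0]|exact: ltW].
  by apply: divr_gt0; lra.
have [B6 hB6] := vinf a3.
pose B := Num.max (Num.max (B1 + K) (Num.max B2' B3)) (Num.max (B4 + K) (Num.max B5 B6)).
exists K, B; split => //.
  by rewrite /B !le_max; apply/orP; left; apply/orP; left; lra.
move=> x; rewrite /B !ge_max => /andP[/and3P[x1 x2 x3] /and3P[x4 x5 x6]] {B}.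
have Ax : A <= x by lra.
have vx := v0 Ax.
have x1' : B1 <= x by lra.
have [fin /andP[d1_ d2_]] := hB1 x x1'.
have bw := bmeas_window_green xi H dl0 fin.
have tw0 t : 0 <= window_green x r t.
  by apply: Rintegral_ge0 => y _; case/andP: (t01 (y - (x - xi t))).
exists (fun t => v x * window_green x r t); split.
- by case: (bmeasZ (v x) bw).
- have x4' : B4 <= x by lra.
  by move=> t; apply/andP; split; [rewrite mulr_ge0 // ltW|exact: (hB4 x (x - xi t) x4')].
- rewrite bRintZ //.
  rewrite -(window_green_mean xi H dl0 fin).
  set I1 := \int[greenoo]_(y in window x r) rmean x y in d1_ d2_ *.
  set I2 := \int[greenoo]_(y in window x r) _.
  have I12 : `|I1 - I2| <= a / 4 / (C' + 1) * (C' / v x).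
    rewrite /I1 /I2 -bRintB //; last exact: (bmeas_limit_mean xi dl0).
    apply: (@le_trans _ _ (\int[greenoo]_(y in window x r) (a / 4 / (C' + 1)))).
      apply: le_norm_bRint => //; [by apply: bmeasB => //; exact: (bmeas_limit_mean xi dl0)|exact: bmeas_cst|].
      move=> y [Sy]; rewrite /= in_itv /= => yx; apply: hB3 => //.
      by rewrite ler_norml; lra.
    rewrite Rintegral_cst // ler_wpM2l //; first exact: ltW.
    by rewrite -lee_fin fineK; [exact: hB2|rewrite ge0_fin_numE].
  have := averaging_arith (ltW a0) C'0 vx fc0 K10 b0 r0 _ (hB6 x x6) d1_ d2_ I12; apply.
  have Kf' : 4 * fc <= K * a by rewrite -ler_pdivrMr.
  have := mulr_gt0 a0 dl0_; rewrite rE; lra.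
- move=> t ht; have hx : `|x - (x - xi t)| <= K by rewrite subKr.
  have [Ax' _ hv] := hB5 x (x - xi t) x5 hx.
  have /andP[t1_ t2_] : - K <= xi t <= K by rewrite -ler_norml.
  have [w1 w2] : x - r <= x - xi t - dl /\ x - xi t + dl <= x + r by rewrite rE; split; lra.
  have [w3 w4] : x - xi t - r <= x - xi t - dl /\ x - xi t + dl <= x - xi t + r.
    by rewrite rE; split; lra.
  have w5 : B4 <= x - xi t by lra.
  have hw : window_green x r t = tent_green (x - xi t).
    by rewrite (tent_green_window S X dl0 w1 w2).
  have u1 : v (x - xi t) * tent_green (x - xi t) <= C.
    by rewrite (tent_green_window S X dl0 w3 w4); exact: hB4.
  have tg0 : 0 <= tent_green (x - xi t).
    by apply: Rintegral_ge0 => y _; case/andP: (t01 (y - (x - xi t))).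
  rewrite hw -mulrBl normrM (ger0_norm tg0).
  apply: le_trans (ler_wpM2r tg0 hv) _; rewrite -mulrA.
  apply: le_trans (ler_wpM2l (ltW a2) u1) _.
  have C10 : 0 < C + 1 by lra.
  by rewrite mulrAC ler_pdivrMr // ler_wpM2l ?(ltW a0) // lerDl.
Qed.

End AveragingProperty.

(** * Asymptotic flatness *)

Lemma near_arith (R : realFieldType) (z c w rho z' : R) : z < c -> c < z + w -> 2 * w < rho ->
  - w < z' - c < w -> - rho < z' - z < rho.
Proof. by move=> h1 h2 h3 /andP[h4 h5]; apply/andP; split; lra. Qed.

Lemma center_arith (R : realFieldType) (z c w : R) : z < c -> c < z + w -> - w < z - c < w.
Proof. by move=> h1 h2; apply/andP; split; lra. Qed.

Section Flatness.
Context {R : realType} d2 (T2 : measurableType d2) (P2 : probability T2 R) (xi : {RV P2 >-> R}).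

(** What the maximum principle needs of u = v * tent_green: asymptotic boundedness, asymptotic
    equicontinuity, and an asymptotic mean value property in which g replaces u (x - xi) for large
    |xi|. *)
Record averaged (u : R -> R) (C : R) : Prop := Averaged {
  av_bound : exists B, forall x, B <= x -> `|u x| <= C;
  av_equicont : forall a, 0 < a -> exists rho B, 0 < rho /\
    forall x x', B <= x -> `|x - x'| <= rho -> `|u x - u x'| <= a;
  av_mean : forall a K0, 0 < a -> exists K B, K0 <= K /\
    forall x, B <= x -> exists g : T2 -> R, [/\ measurable_fun setT g,
      forall t, `|g t| <= C, `|u x - \int[P2]_t g t| <= a &
      forall t, `|xi t| <= K -> `|g t - u (x - xi t)| <= a] }.

Let P2T : (P2 setT < +oo)%E. Proof. by rewrite probability_setT ltry. Qed.

Lemma averagedN u C : averaged u C -> averaged (fun x => - u x) C.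
Proof.
move=> [[B hB] heq hm]; split.
- by exists B => x /hB; rewrite normrN.
- move=> a /heq[rho [B' [rho0 h]]]; exists rho, B'; split => // x x' x1 x2.
  by rewrite -opprD normrN; exact: h.
move=> a K0 /(hm a K0)[K [B' [KK h]]]; exists K, B'; split => // x /h[g [mg gC gu gx]].
have bg : bmeas setT g by apply: (@bmeasI _ _ _ setT _ C).
exists (fun t => -1 * g t); split.
- by case: (bmeasZ (-1) bg).
- by move=> t; rewrite mulN1r normrN.
- by rewrite bRintZ // mulN1r -opprD normrN.
- by move=> t /gx; rewrite mulN1r -opprD normrN.
Qed.

Let Pfin A : measurable A -> P2 A \is a fin_num.
Proof. by move=> mA; rewrite ge0_fin_numE // (le_lt_trans _ P2T) // le_measure ?inE. Qed.

Lemma measurable_tail (K : R) : measurable [set t | K < `|xi t|]%R.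
Proof.
have h : measurable_fun setT (fun t => `|xi t|) by exact: measurableT_comp.
rewrite -[X in measurable X]setTI (_ : [set t | _] = (fun t => `|xi t|) @^-1` `]K, +oo[%classic).
  exact: (h measurableT _ (measurable_itv _)).
by apply/seteqP; split => t; rewrite /= in_itv /= andbT.
Qed.

Lemma measurable_near (a r : R) : measurable [set t | `|xi t - a| < r]%R.
Proof.
have h : measurable_fun setT (fun t => `|xi t - a|).
  apply: measurableT_comp => //; apply: measurable_funB => //; exact: measurable_cst.
rewrite -[X in measurable X]setTI (_ : [set t | _] = (fun t => `|xi t - a|) @^-1` `]-oo, r[%classic).
  exact: (h measurableT _ (measurable_itv _)).
by apply/seteqP; split => t; rewrite /= in_itv.
Qed.

Lemma tail_small (a : R) : 0 < a -> exists K, fine (P2 [set t | K < `|xi t|]%R) <= a.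
Proof.
move=> a0; pose F n := [set t | n%:R < `|xi t|]%R.
have mF n : measurable (F n) by exact: measurable_tail.
have h : P2 \o F @ \oo --> P2 (\bigcap_n F n).
  apply: nonincreasing_cvg_mu => //.
  - by rewrite (le_lt_trans _ P2T) // le_measure ?inE.
  - exact: bigcap_measurableType.
  - move=> n m nm; apply/subsetPset => t; rewrite /F /=; apply: le_lt_trans.
    by rewrite ler_nat.
have e0 : P2 (\bigcap_n F n) = 0%E.
  rewrite (_ : \bigcap_n F n = set0) ?measure0 //; apply/seteqP; split => // t ht.
  have := ht (Num.truncn `|xi t|).+1 I; rewrite /F /=.
  by rewrite ltNge (ltW (truncnS_gt _)).
rewrite e0 in h; have /fine_cvgP[_ /cvgrPdist_le /(_ _ a0)[N _ hN]] := h.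
exists N%:R; have := hN N (leqnn _); rewrite /= sub0r normrN ger0_norm //.
exact: fine_ge0.
Qed.

Section Upper.
Variables (u : R -> R) (C a M : R).
Hypotheses (C0 : 0 <= C) (hu : averaged u C).
Hypothesis supp : forall rho : R, 0 < rho -> (0 < P2 [set t | `|xi t - a| < rho]%R)%E.
Hypothesis M0 : 0 < M.

Let D x := u x - u (x - a).

Hypothesis hM1 : forall c, 0 < c -> exists B, forall x, B <= x -> D x <= M + c.
Hypothesis hM2 : forall c B, 0 < c -> exists2 x, B <= x & M - c <= D x.

(** D is asymptotically the mean of D (x - xi) and eventually exceeds M by arbitrarily little. If D
    (x - a) were below M - c, equicontinuity would give a deficit c / 2 on the event that xi is near
    a, of probability [pi_] > 0, and D x could not be close to M. *)
Let step (c : R) : 0 < c -> exists c' B, 0 < c' /\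
  forall x, B <= x -> M - c' <= D x -> M - c <= D (x - a).
Proof.
move=> c0; have c4 : 0 < c / 4 by rewrite divr_gt0.
have [rho [B0 [rho0 hB0]]] := av_equicont hu c4.
pose near := [set t | `|xi t - a| < rho]%R.
have mnear : measurable near by exact: measurable_near.
set pi_ := fine (P2 near).
have pi0 : 0 < pi_.
  rewrite fine_gt0 // supp //=; apply: le_lt_trans P2T.
  by rewrite le_measure ?inE.
(* The errors add up to (6 + 2 C) e1, which equals the gain [pi_] * c / 2 of the near event. *)
pose e1 := pi_ * c / (2 * (6 + 2 * C)).
have C6 : 0 < 2 * (6 + 2 * C) by have := C0; lra.
have e10 : 0 < e1 by rewrite divr_gt0 // mulr_gt0.
have e1E : e1 * (2 * (6 + 2 * C)) = pi_ * c by rewrite /e1 mulfVK // gt_eqF.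
clearbody e1.
have [K1 hK1] := tail_small e10.
have [K [B1 [KK hB1]]] := av_mean hu (Num.max K1 (`|a| + rho)) e10.
move: KK; rewrite ge_max => /andP[KK1 KKa].
have [B2 hB2] := hM1 e10.
have K0 : 0 <= K by apply: le_trans KKa; rewrite addr_ge0 // ltW.
pose far := [set t | K < `|xi t|]%R.
have mfar : measurable far by exact: measurable_tail.
have Pfar : fine (P2 far) <= e1.
  apply: le_trans hK1; apply: fine_le; [exact: Pfin|by apply: Pfin; exact: measurable_tail|].
  apply: le_measure; rewrite ?inE //; first exact: measurable_tail.
  by move=> t; rewrite /far /=; apply: le_lt_trans.
exists e1, (Num.max (B0 + K + `|a|) (Num.max (B1 + `|a|) (B2 + K))); split => // x.
rewrite !ge_max => /and3P[x0 x1 x2] hD; rewrite leNgt; apply/negP => hlt.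
have [aa1 aa2] : - `|a| <= a /\ a <= `|a| by split; [rewrite lerNl ler_normr lexx orbT|exact: ler_norm].
have [g [mg gC gu gx]] : exists g : T2 -> R, [/\ measurable_fun setT g,
      forall t, `|g t| <= C, `|u x - \int[P2]_t g t| <= e1 &
      forall t, `|xi t| <= K -> `|g t - u (x - xi t)| <= e1] by apply: hB1; lra.
have [g' [mg' gC' gu' gx']] : exists g : T2 -> R, [/\ measurable_fun setT g,
      forall t, `|g t| <= C, `|u (x - a) - \int[P2]_t g t| <= e1 &
      forall t, `|xi t| <= K -> `|g t - u (x - a - xi t)| <= e1] by apply: hB1; lra.
have bg : bmeas setT g by exact: (@bmeasI _ _ _ setT _ C).
have bg' : bmeas setT g' by exact: (@bmeasI _ _ _ setT _ C).
(* Minus the deficit on the near event, where D (x - xi) <= M + q. *)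
have [q qE] : exists q, q = D (x - a) + c / 2 - M by exists (D (x - a) + c / 2 - M).
have bi (A : set T2) (r : R) : measurable A -> bmeas setT (fun t => r * (\1_A t : R)).
  move=> mA; apply: bmeasZ; apply: (@bmeasI _ _ _ setT _ 1); first exact: measurable_indic.
  by move=> t _; rewrite indicE; case: (_ \in _); rewrite ?normr1 // normr0.
have Ri (A : set T2) (r : R) : measurable A -> \int[P2]_t (r * (\1_A t : R)) = r * fine (P2 A).
  move=> mA; have b1 : bmeas setT (fun t => \1_A t : R).
    by have := bi A 1 mA; rewrite (_ : (fun t => 1 * _) = fun t => \1_A t) //; apply/funext => t; rewrite mul1r.
  by rewrite bRintZ //; congr (_ * _); rewrite /Rintegral integral_indic // setIT.
have pt t : g t - g' t <= (M + 3 * e1) + (q * \1_near t + 2 * C * \1_far t).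
  have := gC t; have := gC' t; rewrite !ler_norml => /andP[gt1 gt2] /andP[gt3 gt4].
  rewrite !indicE; have [tf|tf] := boolP (t \in far).
    have -> : (t \in near) = false.
      apply/negP; rewrite inE => tn; move: tf; rewrite inE /far /= ltNge => /negP; apply.
      apply: le_trans KKa; rewrite -[xi t](subrK a) (le_trans (ler_normD _ _)) // addrC lerD2l.
      exact: ltW.
    have e1_ := e10; have M0_ := M0; rewrite /= mulr0 mulr1 add0r; lra.
  have tK : `|xi t| <= K by rewrite leNgt; apply/negP => h; move: tf; rewrite notin_setE; apply.
  have xK := tK; rewrite ler_norml in xK; case/andP: xK => xK1 xK2.
  have h1 := gx t tK; have h2 := gx' t tK.
  rewrite !ler_norml in h1 h2; case/andP: h1 => h11 h12; case/andP: h2 => h21 h22.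
  have Dx : g t - g' t <= D (x - xi t) + 2 * e1.
    rewrite /D (_ : x - xi t - a = x - a - xi t); last by ring.
    lra.
  rewrite /= mulr0 addr0; have [tn|tn] := boolP (t \in near).
    rewrite inE in tn; have tn' := ltW tn; rewrite /= mulr1.
    have n1 : `|u (x - a) - u (x - xi t)| <= c / 4.
      by apply: hB0; [lra|rewrite (_ : x - a - _ = xi t - a) //; ring].
    have n2 : `|u (x - a - a) - u (x - xi t - a)| <= c / 4.
      by apply: hB0; [lra|rewrite (_ : x - a - a - _ = xi t - a) //; ring].
    rewrite !ler_norml in n1 n2; case/andP: n1 => n11 n12; case/andP: n2 => n21 n22.
    have : D (x - xi t) <= D (x - a) + c / 2 by rewrite /D; lra.
    rewrite qE; have e1_ := e10; lra.
  have := hB2 (x - xi t); rewrite /= mulr0; have e1_ := e10; move=> h3.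
  have : D (x - xi t) <= M + e1 by apply: h3; lra.
  lra.
have bq : bmeas setT (fun t => q * (\1_near t : R)) by exact: bi.
have bC : bmeas setT (fun t => 2 * C * (\1_far t : R)) by exact: bi.
have := @le_bRint _ _ _ P2 setT measurableT P2T _ _ (bmeasB bg bg')
  (bmeasD (bmeas_cst setT (M + 3 * e1)) (bmeasD bq bC)) (fun t _ => pt t).
rewrite bRintB // bRintD //; [|exact: bmeas_cst|exact: bmeasD].
rewrite (bRintD measurableT P2T bq bC) !Ri // Rintegral_cst //.
have -> : fine (P2 setT) = 1 by exact: (congr1 fine (probability_setT P2)).
rewrite mulr1 -/pi_ => hint.
rewrite !ler_norml in gu gu'; case/andP: gu => gu1 gu2; case/andP: gu' => gu1' gu2'.
have Dx : D x <= 2 * e1 + ((M + 3 * e1) + (pi_ * q + 2 * C * e1)).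
  have := ler_wpM2l (_ : 0 <= 2 * C) Pfar; rewrite mulr_ge0 // => /(_ isT) h.
  rewrite [D x]/D; lra.
have hq : pi_ * q < pi_ * (- (c / 2)) by rewrite ltr_pM2l // qE; lra.
lra.
Qed.


Let iterate k (c : R) : 0 < c -> exists c' B, 0 < c' /\
  forall x, B <= x -> M - c' <= D x -> forall j, (j <= k)%N -> M - c <= D (x - j%:R * a).
Proof.
elim: k c => [|k IH] c c0.
  by exists c, 0; split => // x _ h j; rewrite leqn0 => /eqP ->; rewrite mul0r subr0.
have [c1 [B1 [c10 h1]]] := step c0.
have m0 : 0 < Num.min c c1 by rewrite lt_min c0.
have [c2 [B2 [c20 h2]]] := IH _ m0.
exists c2, (Num.max B2 (B1 + k%:R * `|a|)); split => // x; rewrite ge_max => /andP[x2 x1] hx j.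
have h := h2 x x2 hx; rewrite leq_eqVlt ltnS => /orP[/eqP->|jk]; last first.
  by apply: le_trans (h j jk); rewrite lerB // ge_min lexx.
have hk := h k (leqnn _).
rewrite (_ : x - k.+1%:R * a = x - k%:R * a - a); last by rewrite -natr1; ring.
apply: h1.
  have : k%:R * a <= k%:R * `|a| by rewrite ler_wpM2l // ler_norm.
  lra.
by apply: le_trans hk; rewrite lerB // ge_min lexx orbT.
Qed.

(** From a point where D almost attains M, each of k successive translations by a drops u by at
    least M / 2, which exceeds the range 2 C once k M > 4 C. *)
Lemma no_drop : False.
Proof.
have M0_ := M0.
pose k := (Num.truncn (4 * C / M)).+1.
have kM : 4 * C < k%:R * M by rewrite -ltr_pdivrMr // truncnS_gt.
have M2 : 0 < M / 2 by lra.
have [c [B [c0 hB]]] := iterate k M2.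
have [B1 hB1] := av_bound hu.
have [x xB hx] := hM2 (Num.max B (B1 + k%:R * `|a|)) c0.
move: xB; rewrite ge_max => /andP[x0 x1].
have ka : - (k%:R * `|a|) <= k%:R * a <= k%:R * `|a|.
  by rewrite -ler_norml normrM ger0_norm.
have ka0 : 0 <= k%:R * `|a| by rewrite mulr_ge0.
case/andP: ka => ka1 ka2.
have b1 : `|u x| <= C by apply: hB1; lra.
have b2 : `|u (x - k%:R * a)| <= C by apply: hB1; lra.
have tel j : (j <= k)%N -> j%:R * (M / 2) <= u x - u (x - j%:R * a).
  elim: j => [|j IH] jk; first by rewrite !mul0r subr0 subrr.
  have h1 := IH (ltnW jk); have := hB x x0 hx j (ltnW jk); rewrite /D.
  rewrite (_ : x - j.+1%:R * a = x - j%:R * a - a); last by rewrite -natr1; ring.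
  rewrite -[j.+1%:R]natr1 mulrDl mul1r; lra.
have := tel k (leqnn _); move: b1 b2; rewrite !ler_norml; lra.
Qed.

End Upper.

Definition flat_at (u : R -> R) (a : R) := forall th, 0 < th -> exists B,
  forall x, B <= x -> `|u x - u (x - a)| <= th.

(** Applies [no_drop] with M the limsup of u x - u (x - a), taken as the infimum of its eventual
    upper bounds. *)
Let flat_upper u C a th : 0 <= C -> averaged u C ->
  (forall rho : R, 0 < rho -> (0 < P2 [set t | `|xi t - a| < rho]%R)%E) -> 0 < th ->
  exists B, forall x, B <= x -> u x - u (x - a) <= th.
Proof.
move=> C0 hu supp th0; apply: contrapT => nh.
pose E := [set m | exists B, forall x, B <= x -> u x - u (x - a) <= m].
have [B hB] := av_bound hu.
have bd x : B + `|a| <= x -> `|u x - u (x - a)| <= 2 * C.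
  have := ler_norm a => h; have a0 := normr_ge0 a; move=> Bx.
  have h1 : `|u x| <= C by apply: hB; lra.
  have h2 : `|u (x - a)| <= C by apply: hB; lra.
  by rewrite (le_trans (ler_normB _ _)) //; lra.
have E0 : E !=set0.
  by exists (2 * C); exists (B + `|a|) => x /bd; rewrite ler_norml => /andP[].
have Eth : lbound E th.
  move=> m [B' hB']; rewrite leNgt; apply/negP => mth; apply: nh; exists B' => x /hB'.
  by move=> /le_trans; apply; exact: ltW.
have hE : has_inf E by split => //; exists th.
apply: (@no_drop u C a (inf E) C0 hu supp).
- by apply: lt_le_trans (lb_le_inf E0 Eth).
- move=> c c0; have [m [B' hB'] hm] := inf_adherent c0 hE.
  by exists B' => x /hB' /le_trans; apply; exact: ltW.
- move=> c B' c0; apply: contrapT => hn.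
  have : E (inf E - c).
    exists B' => x Bx; rewrite leNgt; apply/negP => h; apply: hn; exists x => //.
    exact: ltW.
  by move=> /(ge_inf (proj2 hE)); lra.
Qed.

Lemma flat_support u C a : 0 <= C -> averaged u C ->
  (forall rho : R, 0 < rho -> (0 < P2 [set t | `|xi t - a| < rho]%R)%E) -> flat_at u a.
Proof.
move=> C0 hu supp th th0; have [B hB] := flat_upper C0 hu supp th0.
have [B' hB'] := flat_upper C0 (averagedN hu) supp th0.
exists (Num.max B B') => x; rewrite ge_max => /andP[/hB h1 /hB' h2].
by rewrite ler_norml; lra.
Qed.

Lemma flat_at0 u : flat_at u 0.
Proof. by move=> th th0; exists 0 => x _; rewrite subr0 subrr normr0 ltW. Qed.

Lemma flat_atB u a a' : flat_at u a -> flat_at u a' -> flat_at u (a - a').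
Proof.
move=> fa fa' th th0; have th2 : 0 < th / 2 by rewrite divr_gt0.
have [B hB] := fa _ th2; have [B' hB'] := fa' _ th2.
exists (Num.max B (B' + a - a')) => x; rewrite ge_max => /andP[h1 h2].
have e1 := hB x h1; have e2 : `|u (x - a + a') - u (x - a + a' - a')| <= th / 2 by apply: hB'; lra.
rewrite (_ : x - a + a' - a' = x - a) in e2; last by ring.
rewrite (_ : x - (a - a') = x - a + a'); last by ring.
by move: e1 e2; rewrite !ler_norml; lra.
Qed.

Lemma flat_at_closed u C a : averaged u C ->
  (forall rho : R, 0 < rho -> exists2 a', `|a - a'| < rho & flat_at u a') -> flat_at u a.
Proof.
move=> hu h th th0; have th2 : 0 < th / 2 by rewrite divr_gt0.
have [rho [B [rho0 hB]]] := av_equicont hu th2.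
have [a' aa' fa'] := h rho rho0; have [B' hB'] := fa' _ th2.
exists (Num.max (B + a) B') => x; rewrite ge_max => /andP[h1 h2].
have e1 := hB' x h2.
have e2 : `|u (x - a) - u (x - a')| <= th / 2.
  apply: hB; first by lra.
  by rewrite (_ : x - a - _ = - (a - a')) ?normrN ?ltW //; ring.
by move: e1 e2; rewrite !ler_norml; lra.
Qed.

(* Rational balls of null probability cover the complement of the support. *)
Lemma flat_full u C (L0 L : set R) : 0 <= C -> averaged u C -> measurable L -> measurable L0 ->
  P2 (xi @^-1` L0) = 1%E -> (forall a, L0 a -> flat_at u a -> L a) -> P2 (xi @^-1` L) = 1%E.
Proof.
move=> C0 hu mL mL0 hL0 hL.
have mpre A : measurable A -> measurable (xi @^-1` A).
  by move=> mA; rewrite -[_ @^-1` _]setTI; exact: measurable_funP.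
pose ball_ (m : nat) : set T2 := if unpickle m is Some (q, n) then
  [set t | `|xi t - ratr q| < (n : nat).+1%:R^-1]%R else set0.
pose F m := if P2 (ball_ m) == 0%E then ball_ m else set0.
have mball m : measurable (ball_ m).
  by rewrite /ball_; case: unpickle => [[q n]|] //; exact: measurable_near.
have mF m : measurable (F m) by rewrite /F; case: ifP.
have nF m : P2 (F m) = 0%E by rewrite /F; case: ifPn => [/eqP|] // _; exact: measure0.
have n0 : P2.-negligible (xi @^-1` (~` L0)).
  apply/negligibleP; first by apply: mpre; exact: measurableC.
  by rewrite preimage_setC; apply: etrans (probability_setC P2 (mpre _ mL0)) _; rewrite hL0 subee.
have nU : P2.-negligible ((\bigcup_m F m) `|` xi @^-1` (~` L0)).
  apply: negligibleU => //; apply: negligible_bigcup => m.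
  by apply/negligibleP => //; exact: nF.
have sub : xi @^-1` (~` L) `<=` (\bigcup_m F m) `|` xi @^-1` (~` L0).
  move=> t /= nL; have [tL0|] := pselect (L0 (xi t)); last by right.
  left; have nflat : ~ flat_at u (xi t) by move=> h; apply: nL; exact: hL.
  have [rho rho0 hrho] : exists2 rho : R, 0 < rho & P2 [set t' | `|xi t' - xi t| < rho]%R = 0%E.
    apply: contrapT => hn; apply: nflat; apply: (flat_support C0 hu) => rho rho0.
    rewrite lt0e measure_ge0 andbT; apply/eqP => h; apply: hn; by exists rho.
  have [n nrho] : exists n : nat, 2 * n.+1%:R^-1 < rho.
    by exists (Num.truncn (2 / rho)); rewrite ltr_pdivrMr // mulrC -ltr_pdivrMr // truncnS_gt.
  have ni : 0 < n.+1%:R^-1 :> R by rewrite invr_gt0.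
  have [q] : exists q : rat, xi t < ratr q < xi t + n.+1%:R^-1.
    have h : xi t < xi t + n.+1%:R^-1 by rewrite ltrDl.
    have [q] := rat_in_itvoo h; rewrite in_itv /= => hq; by exists q.
  move=> /andP[q1 q2].
  exists (pickle (q, n)) => //; rewrite /F /ball_ pickleK.
  have sub2 : [set t' | `|xi t' - ratr q| < n.+1%:R^-1]%R `<=` [set t' | `|xi t' - xi t| < rho]%R.
    move=> t'; rewrite /= !ltr_norml.
    exact: (near_arith q1 q2 nrho).
  case: ifPn => [_|/eqP h]; first by rewrite /= ltr_norml; exact: (center_arith q1 q2).
  exfalso; apply: h; apply/eqP; rewrite eq_le measure_ge0 andbT -hrho.
  by apply: le_measure; rewrite ?inE //; exact: measurable_near.
have nL := negligibleS sub nU.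
have mLC : measurable (xi @^-1` (~` L)) by apply: mpre; exact: measurableC.
have h0 : P2 (xi @^-1` (~` L)) = 0%E by apply/negligibleP.
rewrite -[L]setCK preimage_setC; apply: etrans (probability_setC P2 mLC) _.
by rewrite [X in (_ - X)%E]h0 sube0.
Qed.

End Flatness.

Section TentGreenAveraged.
Context {R : realType} d (Omega : measurableType d) (P : probability Omega R).
Variables (S : set R) (Q : R.-pker R ~> R) (X : nat -> {RV P >-> R}).
Context d2 (T2 : measurableType d2) (P2 : probability T2 R) (xi : {RV P2 >-> R}).
Variables (v s p t1 : R -> R) (b B2 e L A dl : R).
Hypothesis hX : markov_chain S Q X.
Hypothesis H : drift_setting S Q v s p t1 b B2.
Hypothesis hg : good S Q v s p t1 b e L A.
Hypotheses (e0 : 0 < e) (e2 : e <= 2^-1) (eb : e <= b / 8) (eb2 : e * b <= 2).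
Hypothesis eC : err_const b B2 * e <= 2^-1.
Hypotheses (dl0 : 0 < dl) (dlL : dl <= L).
Hypothesis vinf : forall a : R, 0 < a -> exists B, forall x, B <= x -> v x <= a.
Hypothesis hxi : jump_cvg_in_distribution S Q xi.

Local Notation greenoo := (greenoo X).
Local Notation tent_green := (tent_green S X dl).
Local Notation window := (window S).

Let A0 : 0 <= A. Proof. exact: (good_A hg). Qed.
Let v0 x : A <= x -> 0 < v x.
Proof. by move=> Ax; apply: (ds_v H); exact: le_trans Ax. Qed.
Let t01 z : 0 <= tent dl z <= 1. Proof. exact: tent_itv. Qed.

Let tg0 x : 0 <= tent_green x.
Proof. by apply: Rintegral_ge0 => y _; case/andP: (t01 (y - x)). Qed.

(** The tent is 1 / dl-Lipschitz and the window has mass O(1 / v x); replacing v x by v x' costs a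
    vanishing relative error. *)
Lemma tent_green_equicont (a : R) : 0 < a -> exists rho B, 0 < rho /\
  forall x x', B <= x -> `|x - x'| <= rho -> `|v x * tent_green x - v x' * tent_green x'| <= a.
Proof.
move=> a0; have dl0_ := dl0; have r0 : 0 <= dl + 1 by lra.
have [C [B1 [C0 AB1 hB1]]] := window_mass hX H hg e0 e2 eb eb2 eC vinf r0.
have [C' C'0 hC'] := tent_window_bound hX H hg e0 e2 eb eb2 eC dl0 vinf.
have [B2' AB2 hB2] := hC' dl (ltW dl0).
have a2 : 0 < a / 2 / (C' + 1) by rewrite !divr_gt0 // ltr_wpDl.
have [B3 AB3 hB3] := drift_compare H hg e0 vinf (ler01 : 0 <= (1 : R)) a2.
have a1 : 0 < a / 2 / (C + 1) * dl by rewrite mulr_gt0 // !divr_gt0 // ltr_wpDl.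
exists (Num.min 1 (a / 2 / (C + 1) * dl)), (Num.max B1 (Num.max (B2' + 1) B3)).
split; first by rewrite lt_min ltr01.
move=> x x'; rewrite !ge_max le_min => /and3P[x1 x2 x3] /andP[r1 ra].
have [Ax' _ hv] := hB3 x x' x3 r1.
have Ax : A <= x by lra.
have vx := v0 Ax.
have [xx1 xx2] : x - x' <= 1 /\ -1 <= x - x' by move: r1; rewrite ler_norml => /andP[].
have fin : (greenoo (window x (dl + 1)) < +oo)%E by exact: le_lt_trans (hB1 x x1) (ltry _).
have mW := measurable_window H x (dl + 1).
have u' : v x' * tent_green x' <= C'.
  rewrite (@tent_green_window _ _ _ _ S X dl dl0 x' dl x') //; apply: hB2; lra.
have T1 : `|tent_green x - tent_green x'| <= a / 2 / (C + 1) * (C / v x).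
  rewrite (@tent_green_window _ _ _ _ S X dl dl0 x (dl + 1) x); [|lra|lra].
  rewrite (@tent_green_window _ _ _ _ S X dl dl0 x (dl + 1) x'); [|lra|lra].
  rewrite -bRintB //; [|exact: (bmeas_tent_at dl0)|exact: (bmeas_tent_at dl0)].
  apply: (@le_trans _ _ (\int[greenoo]_(y in window x (dl + 1)) (a / 2 / (C + 1)))).
    apply: le_norm_bRint => //; [by apply: bmeasB; exact: (bmeas_tent_at dl0)|exact: bmeas_cst|].
    move=> y _; apply: le_trans (tent_lip _ _ dl0) _.
    rewrite ler_pdivrMr // (_ : y - x - (y - x') = - (x - x')); last by ring.
    by rewrite normrN.
  rewrite Rintegral_cst // ler_wpM2l //; first by rewrite ltW // !divr_gt0 // ltr_wpDl.
  by rewrite -lee_fin fineK; [exact: hB1|rewrite ge0_fin_numE].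
rewrite (_ : _ - _ = v x * (tent_green x - tent_green x') + (v x - v x') * tent_green x');
  last by ring.
apply: le_trans (ler_normD _ _) _; rewrite (_ : a = a / 2 + a / 2); last by field.
apply: lerD.
  rewrite normrM (gtr0_norm vx); apply: le_trans (ler_wpM2l (ltW vx) T1) _.
  rewrite (_ : v x * _ = a / 2 * (C / (C + 1))); last by field; rewrite !gt_eqF //; lra.
  rewrite ler_piMr //; first by lra.
  by rewrite ler_pdivrMr; lra.
rewrite normrM (ger0_norm (tg0 _)).
apply: le_trans (ler_wpM2r (tg0 _) hv) _.
have := ler_wpM2l (ltW a2) u'; rewrite mulrA => /le_trans; apply.
rewrite (_ : _ * C' = a / 2 * (C' / (C' + 1))); last by ring.
rewrite ler_piMr //; first by lra.
by rewrite ler_pdivrMr; lra.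
Qed.

Lemma tent_green_averaged : exists2 C, 0 <= C & averaged xi (fun x => v x * tent_green x) C.
Proof.
have [C C0 hC] := averaging hX H hg e0 e2 eb eb2 eC dl0 dlL vinf hxi.
have [C' C'0 hC'] := tent_window_bound hX H hg e0 e2 eb eb2 eC dl0 vinf.
have [B2' AB2 hB2] := hC' dl (ltW dl0).
exists (Num.max C C'); first by rewrite le_max C0.
split.
- exists B2' => x Bx; have vx : 0 < v x by apply: v0; exact: le_trans Bx.
  rewrite ger0_norm; last by rewrite mulr_ge0 // ltW.
  rewrite le_max; apply/orP; right.
  rewrite (@tent_green_window _ _ _ _ S X dl dl0 x dl x) //; exact: hB2.
- exact: tent_green_equicont.
- move=> a K0 a0; have [K [B [KK AB hB]]] := hC a K0 a0; exists K, B; split => // x /hB.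
  move=> [g [mg g0 gu gx]]; exists g; split => // t.
  by have /andP[h1 h2] := g0 t; rewrite ger0_norm // le_max h2.
Qed.

End TentGreenAveraged.

(** * Subgroups of the line *)

Section Subgroup.
Context {R : realType}.
Variable G : set R.
Hypotheses (G0 : G 0) (GB : forall a a', G a -> G a' -> G (a - a')).

Lemma subgroupD a a' : G a -> G a' -> G (a + a').
Proof. by move=> ha ha'; rewrite -[a']opprK; apply: GB => //; rewrite -sub0r; exact: GB. Qed.

Lemma subgroupMz (k : int) a : G a -> G (k%:~R * a).
Proof.
move=> ha; have nat_case n : G (n%:R * a).
  by elim: n => [|n IH]; [rewrite mul0r|rewrite -natr1 mulrDl mul1r; exact: subgroupD].
case: k => n; first exact: nat_case.
by rewrite NegzE mulrNz mulNr -sub0r; apply: GB => //; exact: nat_case.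
Qed.

Lemma subgroup_lattice (c : R) : 0 < c -> G c -> (forall a, 0 < a -> a < c -> ~ G a) ->
  G `<=` lattice c.
Proof.
move=> c0 Gc hmin a Ga; pose k := Num.floor (a / c).
have /andP[k1 k2] := floor_itv (a / c).
rewrite ler_pdivlMr // in k1; rewrite ltr_pdivrMr // intrD mulrDl mul1r in k2.
have [h|h] := eqVneq a (k%:~R * c); first by exists k.
exfalso; apply: (hmin (a - k%:~R * c)).
- by rewrite subr_gt0 lt_neqAle eq_sym h.
- by rewrite ltrBlDl.
- by apply: GB => //; exact: subgroupMz.
Qed.

Lemma closed_subgroup :
  (forall a, (forall rho : R, 0 < rho -> exists2 a', `|a - a'| < rho & G a') -> G a) ->
  (forall a, G a) \/ exists2 c : R, 0 < c & G `<=` lattice c.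
Proof.
move=> Gcl; have [hdense|hgap] := pselect (forall rho : R, 0 < rho -> exists2 c, 0 < c < rho & G c).
  left=> a; apply: Gcl => rho rho0; have [c /andP[c0 cr] Gc] := hdense rho rho0.
  exists ((Num.floor (a / c))%:~R * c); last exact: subgroupMz.
  have /andP[k1 k2] := floor_itv (a / c).
  rewrite ler_pdivlMr // in k1; rewrite ltr_pdivrMr // intrD mulrDl mul1r in k2.
  by rewrite ger0_norm ?subr_ge0 //; lra.
right; have [rho rho0 hrho] : exists2 rho : R, 0 < rho & forall c, 0 < c -> c < rho -> ~ G c.
  apply: contrapT => hn; apply: hgap => rho rho0; apply: contrapT => hn2; apply: hn.
  by exists rho => // c c0 cr Gc; apply: hn2; exists c => //; rewrite c0.
pose E := [set c | 0 < c /\ G c].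
have [[c [c0 Gc]]|hE] := pselect (exists c, 0 < c /\ G c); last first.
  (* The trivial subgroup lies in every lattice. *)
  exists 1 => // a Ga; exists 0; rewrite // mul0r.
  have [h|h|//] := ltgtP a 0.
    by exfalso; apply: hE; exists (0 - a); split; [lra|exact: GB].
  by exfalso; apply: hE; exists a.
have Ei : has_inf E by split; [exists c|exists 0 => z [/ltW]].
(* A positive element of G below g would differ from g by less than rho, since both are at least the
   infimum. *)
have [g [g0 Gg] gE] := inf_adherent rho0 Ei.
exists g => //; apply: subgroup_lattice => // a a0 ag Ga.
have h1 : inf E <= a by apply: (ge_inf (proj2 Ei)); split.
by apply: (hrho (g - a)); [lra|lra|exact: GB].
Qed.

(** m is the least positive integer in G, and Euclidean division does the rest; when there is none,
    G meets the integers in 0 only and 2 serves. *)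
Lemma integer_subgroup : ~ G 1 -> exists2 m : nat, (1 < m)%N & G `&` lattice 1 `<=` lattice m%:R.
Proof.
move=> nG1.
pose Gp := [pred n : nat | (0 < n)%N && `[< G n%:R >]].
have [[n hn]|hE] := pselect (exists n, Gp n); last first.
  exists 2 => // a [Ga [k _ ka]]; exists 0; rewrite // mul0r -ka mulr1.
  case: k ka => n ka.
    case: n ka => [//|n] ka; exfalso; apply: hE; exists n.+1 => /=; apply/asboolP.
    by move: Ga; rewrite -ka mulr1.
  exfalso; apply: hE; exists n.+1 => /=; apply/asboolP.
  have := GB G0 Ga; rewrite sub0r -ka mulr1 NegzE mulrNz opprK; exact.
have ex : exists n, Gp n by exists n.
case: (ex_minnP ex) => m /= /andP[m0 /asboolP Gm] mmin.
have m1 : (1 < m)%N.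
  rewrite ltn_neqAle m0 andbT; apply/eqP => m1; apply: nG1; by rewrite -m1 in Gm.
exists m => // a [Ga [k _ ka]].
have mr : 0 < m%:R :> R by rewrite ltr0n.
pose r := (k %% m)%Z.
have r0 : (0 <= r)%R by apply: modz_ge0; rewrite gt_eqF.
have rm : (r < m)%R by apply: ltz_pmod.
have kE : k%:~R = (k %/ m)%Z%:~R * m%:R + r%:~R :> R.
  by rewrite {1}(divz_eq k m) intrD intrM.
exists (k %/ m)%Z => //.
have Gr : G r%:~R.
  have -> : r%:~R = a - (k %/ m)%Z%:~R * m%:R by rewrite -ka mulr1 kE; ring.
  by apply: GB => //; exact: subgroupMz.
have [rz|rn] := eqVneq r 0; first by rewrite -ka mulr1 kE rz addr0.
exfalso; case: (r) r0 rm rn Gr => [j|//] _ jm j0 Gj.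
have : Gp j by apply/andP; split; [rewrite lt0n|apply/asboolP].
by move=> /mmin; rewrite leqNgt => /negP; apply.
Qed.

End Subgroup.

(** * Passage to a fixed scale *)

Section TentRefinement.
Context {R : realType}.
Variable dl : R.
Hypothesis dl0 : 0 < dl.

(** As a second difference of [pos], a tent has sums of translates that telescope. *)
Lemma tent_second_difference (l z : R) : 0 < l ->
  l * tent l z = pos (z + l) - 2 * pos z + pos (z - l).
Proof.
move=> l0; rewrite /tent /pos maxr_pMr ?ltW // mulr0.
rewrite (_ : l * (1 - `|z| / l) = l - `|z|); last by field; rewrite gt_eqF.
by case: (ler0P z) => z0; case: (leP 0 (z + l)); case: (leP 0 z); case: (leP 0 (z - l));
  case: (leP 0 (l - _)); lra.
Qed.

Lemma tent_sum n (w : R) : dl * \sum_(k < n) tent dl (w + k%:R * dl)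
  = pos (w + n%:R * dl) - pos (w + n%:R * dl - dl) - pos w + pos (w - dl).
Proof.
elim: n => [|n IH]; first by rewrite big_ord0 mulr0 mul0r addr0; ring.
rewrite big_ord_recr /= mulrDr IH tent_second_difference //.
rewrite (_ : w + n.+1%:R * dl = w + n%:R * dl + dl); last by rewrite -natr1; ring.
by rewrite addrK; ring.
Qed.

Lemma tent_refine m (z : R) : (0 < m)%N ->
  m%:R * tent (m%:R * dl) z = \sum_(i < m) \sum_(k < m) tent dl (z - i%:R * dl + k%:R * dl).
Proof.
move=> m0; have mr : 0 < m%:R :> R by rewrite ltr0n.
have part n : dl * \sum_(i < n) \sum_(k < m) tent dl (z - i%:R * dl + k%:R * dl)
   = pos (z + m%:R * dl) - pos (z + m%:R * dl - n%:R * dl) - pos z + pos (z - n%:R * dl).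
  elim: n => [|n IH]; first by rewrite big_ord0 mulr0 mul0r !subr0; ring.
  rewrite big_ord_recr /= mulrDr IH tent_sum.
  rewrite (_ : z - n%:R * dl + m%:R * dl = z + m%:R * dl - n%:R * dl); last by ring.
  rewrite (_ : z + m%:R * dl - n.+1%:R * dl = z + m%:R * dl - n%:R * dl - dl); last by rewrite -natr1; ring.
  rewrite (_ : z - n.+1%:R * dl = z - n%:R * dl - dl); last by rewrite -natr1; ring.
  by ring.
have ml : 0 < m%:R * dl by exact: mulr_gt0.
have := part m; rewrite addrK => h.
have := tent_second_difference z ml => h2.
apply: (@mulfI _ dl); first by rewrite gt_eqF.
by rewrite h mulrA [dl * _]mulrC h2; ring.
Qed.

(** The n + 1 tents peak at 0, dl, ..., n dl and form a partition of unity between the extreme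
    peaks. *)
Lemma tents_above n (z : R) : 0 < z -> z <= n%:R * dl ->
  \sum_(k < n.+1) tent dl (z - n%:R * dl + k%:R * dl) = 1.
Proof.
move=> z0 zn; have dl0_ := dl0; apply: (@mulfI _ dl); first by rewrite gt_eqF.
rewrite tent_sum -natr1 mulrDl mul1r.
rewrite (_ : z - n%:R * dl + (n%:R * dl + dl) = z + dl); last by ring.
rewrite (_ : z + dl - dl = z); last by ring.
rewrite /pos; case: (leP 0 (z + dl)); case: (leP 0 z); case: (leP 0 (z - n%:R * dl));
  case: (leP 0 (z - n%:R * dl - dl)); lra.
Qed.

(** The n tents peak at dl, ..., n dl, so their sum is at most 1 and is supported in a width (n + 1)
    dl. *)
Lemma tents_below n (z : R) :
  \sum_(k < n) tent dl (z - n%:R * dl + k%:R * dl) <= (if (0 < z) && (z <= n.+1%:R * dl) then 1 else 0).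
Proof.
have dl0_ := dl0; have n0 : 0 <= n%:R * dl by rewrite mulr_ge0 // ltW.
rewrite -(ler_pM2l dl0) tent_sum -natr1 mulrDl mul1r.
rewrite (_ : z - n%:R * dl + n%:R * dl = z); last by ring.
rewrite /pos; set c := n%:R * dl in n0 *.
case: (ltP 0 z) => z0; case: (leP z (c + dl)) => zc /=; case: (leP 0 z); case: (leP 0 (z - dl));
  case: (leP 0 (z - c)); case: (leP 0 (z - c - dl)); lra.
Qed.

End TentRefinement.

Section FiniteSums.
Context {R : realType} d (T : measurableType d).

Lemma bmeas_sum (D : set T) n (f : nat -> T -> R) : (forall i, bmeas D (f i)) ->
  bmeas D (fun x => \sum_(i < n) f i x).
Proof.
move=> bf; elim: n => [|n IH].
  by under eq_fun do rewrite big_ord0; exact: bmeas_cst.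
by under eq_fun do rewrite big_ord_recr /=; exact: bmeasD.
Qed.

Lemma bRint_sum (mu : {measure set T -> \bar R}) (D : set T) n (f : nat -> T -> R) :
  measurable D -> (mu D < +oo)%E -> (forall i, bmeas D (f i)) ->
  \int[mu]_(x in D) (\sum_(i < n) f i x) = \sum_(i < n) \int[mu]_(x in D) f i x.
Proof.
move=> mD muD bf; elim: n => [|n IH].
  rewrite big_ord0; under eq_Rintegral do rewrite big_ord0.
  by rewrite Rintegral_cst // mul0r.
rewrite big_ord_recr /= -IH -bRintD //; last exact: bmeas_sum.
by apply: eq_Rintegral => x _; rewrite big_ord_recr.
Qed.

End FiniteSums.

(** Eventual finiteness of the extended-valued numerator is part of what has to be supplied, through
    the witness r. *)
Lemma ratio_limit (R : realType) (T : Type) (F : set_system T) (FF : Filter F)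
    (f : T -> \bar R) (w : T -> R) :
  (forall a, 0 < a -> \forall x \near F, 0 < w x /\ exists2 r : R, f x = r%:E & `|r / w x - 1| <= a) ->
  (f x / (w x)%:E)%E @[x --> F] --> 1%E.
Proof.
move=> h; have hE x a : (0 < w x /\ exists2 r : R, f x = r%:E & `|r / w x - 1| <= a) ->
    exists2 r : R, (f x / (w x)%:E)%E = r%:E & `|r - 1| <= a.
  by move=> [w0 [r fx hr]]; exists (r / w x) => //; rewrite fx inver gt_eqF.
apply/fine_cvgP; split.
  by have := h 1 ltr01; apply: filterS => x /hE[r -> _].
apply/cvgrPdist_le => a a0; have := h a a0; apply: filterS => x /hE[r /= -> hr].
by rewrite distrC.
Qed.

Section Conclusion.
Context {R : realType} d (Omega : measurableType d) (P : probability Omega R).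
Variables (S : set R) (Q : R.-pker R ~> R) (X : nat -> {RV P >-> R}).
Context d2 (T2 : measurableType d2) (P2 : probability T2 R) (xi : {RV P2 >-> R}).
Variables (v s p t1 : R -> R) (b B2 : R).
Hypothesis hX : markov_chain S Q X.
Hypothesis H : drift_setting S Q v s p t1 b B2.
Hypothesis good_ex : forall e, 0 < e -> exists L0, forall L, L0 <= L -> exists A0,
  forall A, A0 <= A -> good S Q v s p t1 b e L A.
Hypothesis hlimsup : {ae P, forall w, limn_esup (fun n => (X n w)%:E) = +oo%E}.
Hypothesis vinf : forall a : R, 0 < a -> exists B, forall x, B <= x -> v x <= a.
Hypothesis hxi : jump_cvg_in_distribution S Q xi.

Local Notation greenoo := (greenoo X).
Local Notation window := (window S).
Let u dl (x : R) := v x * tent_green S X dl x.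

Let tg0 dl x : 0 < dl -> 0 <= tent_green S X dl x.
Proof. by move=> dl0; apply: Rintegral_ge0 => y _; case/andP: (tent_itv dl0 (y - x)). Qed.

Lemma small_error (a : R) : 0 < a -> exists e, [/\ 0 < e, e <= 2^-1, e <= b / 8, e * b <= 2 &
  err_const b B2 * e <= 2^-1 /\ 2 * err_const b B2 * e + 4 * e <= a].
Proof.
move=> a0; have b0 := ds_b H; set c := err_const b B2.
pose c' := `|c| + 1; have c'0 : 0 < c' by rewrite ltr_wpDl.
have cc : c <= c' by have := ler_norm c; rewrite /c'; lra.
pose e := Num.min (Num.min 2^-1 (b / 8)) (Num.min (2 / b) (Num.min (2^-1 / c') (a / (2 * c' + 4)))).
have q0 : 0 < 2 * c' + 4 by lra.
have i2 : 0 < 2^-1 :> R by rewrite invr_gt0.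
have e0 : 0 < e.
  have [p1 p2 p3 p4] : [/\ 0 < b / 8, 0 < 2 / b, 0 < 2^-1 / c' & 0 < a / (2 * c' + 4)].
    by split; apply: divr_gt0.
  by rewrite /e !lt_min i2 p1 p2 p3 p4.
have : e <= e by []; rewrite {2}/e !le_min => /and3P[/andP[h1 h2] h3 /andP[h4 h5]].
rewrite ler_pdivlMr // in h3; rewrite ler_pdivlMr // in h4; rewrite ler_pdivlMr // in h5.
have h6 := ler_wpM2r (ltW e0) cc.
by exists e; split => //; split; lra.
Qed.

(** The large half-width is taken as a multiple of dl, so that its tent decomposes into tents of
    half-width dl. *)
Lemma mesh (dl a : R) : 0 < dl -> 0 < a -> exists e m A, [/\ [/\ 0 < e, e <= 2^-1, e <= b / 8,
  e * b <= 2 & err_const b B2 * e <= 2^-1], 2 * err_const b B2 * e + 4 * e <= a, (0 < m)%N &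
  good S Q v s p t1 b e (m%:R * dl) A].
Proof.
move=> dl0 a0; have [e [e0 e2 eb eb2 [eC ea]]] := small_error a0.
have [L0 hL0] := good_ex e0.
pose m := (Num.truncn (L0 / dl)).+1.
have mL : L0 <= m%:R * dl by rewrite -ler_pdivrMr // ltW // truncnS_gt.
by have [A hA] := hL0 _ mL; exists e, m, A; split => //; exact: hA.
Qed.

Lemma tent_green_facts (dl : R) : 0 < dl ->
  [/\ exists2 C, 0 <= C & averaged xi (u dl) C,
    forall c a, 0 < a -> exists B, forall x, B <= x ->
      `|v x * tent_green S X dl (x + c) - u dl (x + c)| <= a &
    forall r, 0 <= r -> exists B, forall x, B <= x -> (greenoo (window x r) < +oo)%E].
Proof.
move=> dl0; have [e [m [A [[e0 e2 eb eb2 eC] _ m0 hg]]]] := mesh dl0 (ltr01 : 0 < (1 : R)).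
have dlL : dl <= m%:R * dl by apply: ler_peMl; [exact: ltW|rewrite ler1n].
have [C C0 hC] := tent_green_averaged hX H hg e0 e2 eb eb2 eC dl0 dlL vinf hxi.
split; first by exists C.
- move=> c a a0; have a1 : 0 < a / (C + 1) by rewrite divr_gt0 // ltr_wpDl.
  have [B AB hB] := drift_compare H hg e0 vinf (normr_ge0 c) a1.
  have [B' hB'] := av_bound hC.
  exists (Num.max B (B' + `|c|)) => x; rewrite ge_max => /andP[xB xB'].
  have hc : `|x - (x + c)| <= `|c| by rewrite opprD addrA subrr sub0r normrN.
  have [_ _ hv] := hB x (x + c) xB hc.
  have c1 : - `|c| <= c by rewrite lerNl ler_normr lexx orbT.
  have h1 : `|u dl (x + c)| <= C by apply: hB'; lra.
  have h2 : u dl (x + c) <= C by apply: le_trans h1; exact: ler_norm.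
  have tg := tg0 (x + c) dl0.
  rewrite /u -mulrBl normrM (ger0_norm tg).
  apply: le_trans (ler_wpM2r tg hv) _.
  have := ler_wpM2l (ltW a1) h2; rewrite /u mulrA => /le_trans; apply.
  rewrite (_ : _ * C = a * (C / (C + 1))); last by ring.
  rewrite ler_piMr //; first exact: ltW.
  by rewrite ler_pdivrMr; lra.
- move=> r r0; have [C' [B [_ _ hB]]] := window_mass hX H hg e0 e2 eb eb2 eC vinf r0.
  by exists B => x /hB h; apply: le_lt_trans h (ltry _).
Qed.

(** m times the tent of half-width m dl is a sum of m^2 translates of the small tent by multiples of
    dl. By flatness all contribute alike, so v times the mass of the large tent is about m u; it is
    also about m dl, whence u is about dl. *)
Lemma tent_green_limit (dl a : R) : 0 < dl -> flat_at (u dl) dl -> 0 < a ->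
  exists B, forall x, B <= x -> `|u dl x - dl| <= a.
Proof.
move=> dl0 hflat a0; have [[C C0 hC] hshift hfin] := tent_green_facts dl0.
(* The relative accuracy required at the large scale: multiplied by dl it gives a / 2. *)
have a1 : 0 < a / (2 * dl) by rewrite divr_gt0 // mulr_gt0.
have [e [m [A [[e0 e2 eb eb2 eC] ea m0 hg]]]] := mesh dl0 a1.
have mr : 0 < m%:R :> R by rewrite ltr0n.
set L := m%:R * dl in hg; have L0 : 0 < L by exact: mulr_gt0.
have [B1 hB1] := tent_green_asymptotics hX H hg e0 e2 eb eb2 eC hlimsup.
have flatz c : flat_at (u dl) (c%:~R * dl).
  by apply: (@subgroupMz _ (flat_at (u dl))) => //; [exact: flat_at0|move=> ? ?; exact: flat_atB].
have a4 : 0 < a / 4 by rewrite divr_gt0.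
have near_u i k : exists B, forall x, B <= x ->
    `|v x * tent_green S X dl (x + (i%:R * dl - k%:R * dl)) - u dl x| <= a / 2.
  pose c : R := i%:R * dl - k%:R * dl.
  have [B hB] := hshift c _ a4.
  have fc : flat_at (u dl) (- c).
    by rewrite (_ : - c = (k%:Z - i%:Z)%:~R * dl) ?flatz // intrB /c; ring.
  have [B' hB'] := fc _ a4.
  exists (Num.max B B') => x; rewrite ge_max => /andP[/hB h1 /hB']; rewrite opprK => h2.
  by move: h1 h2; rewrite -/c !ler_norml; lra.
have near_row i : exists B, forall x, B <= x -> forall k, (k < m)%N ->
    `|v x * tent_green S X dl (x + (i%:R * dl - k%:R * dl)) - u dl x| <= a / 2.
  by have [B hB] := common_bound m (near_u i); exists B => x Bx k km; exact: hB.
have [B2' hB2] := common_bound m near_row.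
have r0 : 0 <= 3 * L by lra.
have [B3 hB3] := hfin _ r0.
exists (Num.max (Num.max B1 B2') (Num.max B3 0)) => x; rewrite !ge_max.
move=> /andP[/andP[x1 x2] /andP[x3 x4]].
have vx : 0 < v x by exact: (ds_v H).
have fin := hB3 x x3; have mW := measurable_window H x (3 * L).
have bL (i : nat) : (i < m)%N -> 0 <= i%:R * dl <= L - dl.
  move=> im; apply/andP; split; first by rewrite mulr_ge0 // ltW.
  rewrite /L.
  have : (i.+1%:R : R) * dl <= m%:R * dl by rewrite ler_pM2r // ler_nat.
  by rewrite -natr1; lra.
have TG : m%:R * tent_green S X L x =
    \sum_(i < m) \sum_(k < m) tent_green S X dl (x + (i%:R * dl - k%:R * dl)).
  rewrite (@tent_green_window _ _ _ _ S X L L0 x (3 * L) x); [|lra|lra].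
  have bt (c : R) : bmeas (window x (3 * L)) (fun y : R => tent dl (y - x - c)).
    rewrite (_ : (fun y : R => _) = (fun y : R => tent dl (y - (x + c)))).
      exact: (bmeas_tent_at dl0).
    by apply/funext => y; congr tent; ring.
  have bt2 (i k : nat) : bmeas (window x (3 * L)) (fun y : R => tent dl (y - x - i%:R * dl + k%:R * dl)).
    have := bt (i%:R * dl - k%:R * dl).
    by congr (bmeas _ _); apply/funext => y; congr tent; ring.
  rewrite -bRintZ //; last exact: (bmeas_tent_at L0).
  under eq_Rintegral do rewrite tent_refine //.
  rewrite (@bRint_sum _ _ _ greenoo _ m (fun i y => \sum_(k < m) tent dl (y - x - i%:R * dl + k%:R * dl))) //; last first.
    by move=> i; exact: (@bmeas_sum _ _ _ _ m (fun (k : nat) (y : R) => tent dl (y - x - i%:R * dl + k%:R * dl)) (bt2 i)).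
  apply: eq_bigr => i _.
  rewrite (@bRint_sum _ _ _ greenoo _ m (fun k y => tent dl (y - x - i%:R * dl + k%:R * dl))) //.
  apply: eq_bigr => k _.
  have /andP[i0 i1] := bL i (ltn_ord i); have /andP[k0 k1] := bL k (ltn_ord k).
  rewrite (@tent_green_window _ _ _ _ S X dl dl0 x (3 * L)); [|lra|lra].
  by apply: eq_Rintegral => y _; congr tent; ring.
have hsum : `|v x * (m%:R * tent_green S X L x) - m%:R * (m%:R * u dl x)| <= m%:R * (m%:R * (a / 2)).
  rewrite TG mulr_sumr.
  have sc (c : R) : m%:R * c = \sum_(i < m) c by rewrite sumr_const card_ord mulr_natl.
  rewrite !sc -sumrB; apply: le_trans (ler_norm_sum _ _ _) _; apply: ler_sum => i _.
  rewrite mulr_sumr -sumrB; apply: le_trans (ler_norm_sum _ _ _) _; apply: ler_sum => k _.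
  exact: (hB2 i x (ltn_ord i) x2 k (ltn_ord k)).
have h1 := hB1 x x1.
have h2 : `|v x / L * tent_green S X L x - 1| <= a / (2 * dl) by exact: le_trans ea.
have mm0 : 0 < m%:R * m%:R :> R by exact: mulr_gt0.
have h3 : `|v x * tent_green S X L x / m%:R - u dl x| <= a / 2.
  rewrite -(ler_pM2l mm0) -{1}(gtr0_norm mm0) -normrM.
  move: hsum; rewrite (_ : _ - _ = m%:R * m%:R * (v x * tent_green S X L x / m%:R - u dl x)).
    by move/le_trans; apply; rewrite mulrA.
  by field; rewrite gt_eqF.
have h4 : `|v x * tent_green S X L x / m%:R - dl| <= a / 2.
  have -> : a / 2 = dl * (a / (2 * dl)) by field; rewrite gt_eqF.
  rewrite (_ : _ - _ = dl * (v x / L * tent_green S X L x - 1)).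
    by rewrite normrM (gtr0_norm dl0) ler_wpM2l // ltW.
  by rewrite /L; field; rewrite !gt_eqF.
by move: h3 h4; rewrite !ler_norml; lra.
Qed.

End Conclusion.

(** * Lattices and flat translations *)

Section Lattice.
Context {R : realType} d2 (T2 : measurableType d2) (P2 : probability T2 R) (xi : {RV P2 >-> R}).

Lemma measurable_lattice (c : R) : measurable (lattice c).
Proof.
apply: countable_measurable => //.
apply: (@sub_countable _ _ _ [set: int]); last exact: countableP.
exact: card_image_le.
Qed.

Variables (u : R -> R) (C : R).
Hypotheses (C0 : 0 <= C) (hu : averaged xi u C).

Let flat_sub a a' : flat_at u a -> flat_at u a' -> flat_at u (a - a').
Proof. exact: flat_atB. Qed.

(** If the flat translations did not fill the line, they would lie in a lattice, which would carry
    xi by [flat_full]. *)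
Lemma non_lattice_flat a : non_lattice xi -> flat_at u a.
Proof.
move=> nl; have [//|[c c0 hc]] := closed_subgroup (@flat_at0 _ u) flat_sub
  (fun a => @flat_at_closed _ _ _ P2 xi u C a hu).
exfalso; apply: nl; exists c => //.
apply: (flat_full C0 hu (measurable_lattice c) measurableT); first exact: probability_setT.
by move=> a' _; exact: hc.
Qed.

(** Otherwise the flat integers lie in a sublattice of index m > 1, and [flat_full] puts xi on it,
    against minimality. *)
Lemma minimal_lattice_flat : minimal_lattice xi 1 -> flat_at u 1.
Proof.
move=> [h1 hmin]; apply: contrapT => n1.
have [m m1 hm] := integer_subgroup (@flat_at0 _ u) flat_sub n1.
have m0 : 0 < m%:R :> R by rewrite ltr0n ltnW.
have on_m : on_lattice xi (lattice (m%:R : R)).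
  apply: (flat_full C0 hu (measurable_lattice _) (measurable_lattice 1) h1).
  by move=> a La fa; exact: hm.
have sub : lattice (m%:R : R) `<=` lattice 1.
  by move=> a [k _ <-]; exists (k * m)%R => //; rewrite mulr1 intrM.
have [k _] : lattice (m%:R : R) 1 by rewrite hmin //; exists 1 => //; rewrite mulr1.
rewrite -[m%:R]/((m%:Z)%:~R) -intrM => /eqP; rewrite -[1]/(1%:~R) eqr_int => /eqP km.
have : (`|k| * m = 1)%N by rewrite -[m in LHS]/(absz m) -abszM km.
by move/eqP; rewrite muln_eq1 => /andP[_ /eqP m1']; rewrite m1' in m1.
Qed.

End Lattice.

Lemma sandwich_arith (R : realFieldType) (h dl a q y : R) : dl <= a / 2 -> q <= a / 2 ->
  y <= h + dl + a / 2 -> h - dl - q <= y -> `|y - h| <= a.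
Proof. by move=> h1 h2 h3 h4; rewrite ler_norml; lra. Qed.

(** * Local renewal on intervals and at integers *)

Section LocalRenewal.
Context {R : realType} d (Omega : measurableType d) (P : probability Omega R).
Variables (S : set R) (Q : R.-pker R ~> R) (X : nat -> {RV P >-> R}).
Context d2 (T2 : measurableType d2) (P2 : probability T2 R) (xi : {RV P2 >-> R}).
Variables (v s p t1 : R -> R) (b B2 : R).
Hypothesis hX : markov_chain S Q X.
Hypothesis H : drift_setting S Q v s p t1 b B2.
Hypothesis good_ex : forall e, 0 < e -> exists L0, forall L, L0 <= L -> exists A0,
  forall A, A0 <= A -> good S Q v s p t1 b e L A.
Hypothesis hlimsup : {ae P, forall w, limn_esup (fun n => (X n w)%:E) = +oo%E}.
Hypothesis vinf : forall a : R, 0 < a -> exists B, forall x, B <= x -> v x <= a.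
Hypothesis hxi : jump_cvg_in_distribution S Q xi.

Local Notation greenoo := (greenoo X).
Local Notation window := (window S).

Lemma renewal_measureE B : renewal_measure X B = greenoo B.
Proof. by []. Qed.

Lemma tent_green_shift_limit (dl c a : R) : 0 < dl ->
  flat_at (fun x => v x * tent_green S X dl x) dl -> 0 < a ->
  exists B, forall x, B <= x -> `|v x * tent_green S X dl (x + c) - dl| <= a.
Proof.
move=> dl0 fl a0; have a2 : 0 < a / 2 by rewrite divr_gt0.
have [_ hshift _] := tent_green_facts hX H good_ex vinf hxi dl0.
have [B hB] := hshift c _ a2.
have [B' hB'] := tent_green_limit hX H good_ex hlimsup vinf hxi dl0 fl a2.
exists (Num.max B (B' - c)) => x; rewrite ge_max lerBlDr => /andP[/hB h1 /hB' h2].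
by move: h1 h2; rewrite !ler_norml; lra.
Qed.

Let greenoo_states_I B : measurable B -> greenoo B = greenoo (S `&` B).
Proof.
move=> mB; have mS := ds_mS H.
have mC : measurable (B `&` ~` S) by apply: measurableI => //; exact: measurableC.
have e0 : greenoo (B `&` ~` S) = 0%E.
  apply/eqP; rewrite eq_le measure_ge0 andbT -(greenoo_states hX).
  by apply: le_measure; rewrite ?inE //; exact: measurableC.
have -> : greenoo B = greenoo ((S `&` B) `|` (B `&` ~` S)).
  by rewrite [S `&` B]setIC -setIUr setUv setIT.
rewrite measureU //; [|exact: measurableI|by rewrite setIACA [S `&` _]setIC -setIACA setICr setI0].
by rewrite [X in (_ + X)%E]e0 adde0.
Qed.

(** With mesh dl = h / (N + 1), N tents fit under the indicator and N + 2 dominate it, so the limit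
    values lie between h - dl and h + dl. *)
Lemma renewal_interval (h a : R) : 0 < h -> 0 < a ->
  (forall dl, 0 < dl -> flat_at (fun x => v x * tent_green S X dl x) dl) ->
  exists B, forall x, B <= x -> exists2 r : R,
    renewal_measure X `]x, (x + h)%R] = r%:E & `|v x * r - h| <= a.
Proof.
(* N is large enough for dl = h / (N + 1) to be at most a / 2. *)
move=> h0 a0 fl; pose N := (Num.truncn (2 * h / a)).+1.
have hN : 2 * h < N.+1%:R * a.
  rewrite -natr1 mulrDl mul1r; have : 2 * h < N%:R * a by rewrite -ltr_pdivrMr // truncnS_gt.
  by lra.
have N0 : 0 < N.+1%:R :> R by [].
pose dl := h / N.+1%:R; have dl0 : 0 < dl by rewrite divr_gt0.
have dlN : N.+1%:R * dl = h by rewrite /dl; field; rewrite gt_eqF.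
have dla : dl <= a / 2 by rewrite /dl ler_pdivrMr //; lra.
have [_ _ hfin] := tent_green_facts hX H good_ex vinf hxi dl0.
have a1 : 0 < a / 2 / N.+2%:R by rewrite !divr_gt0.
have near_k j : exists B, forall x, B <= x ->
    `|v x * tent_green S X dl (x + j%:R * dl) - dl| <= a / 2 / N.+2%:R.
  exact: (tent_green_shift_limit _ dl0 (fl dl dl0) a1).
have [B1 hB1] := common_bound N.+2 near_k.
have r0 : 0 <= 3 * h by lra.
have [B2' hB2] := hfin _ r0.
exists (Num.max B1 (Num.max B2' 0)) => x; rewrite !ge_max => /and3P[x1 x2 x3].
have vx : 0 < v x by exact: (ds_v H).
set I := [set` `]x, (x + h)%R]]; have mI : measurable I by exact: measurable_itv.
set W := window x (3 * h); have mW : measurable W by exact: (measurable_window H).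
have fin : (greenoo W < +oo)%E by exact: hB2.
have bi : bmeas W (fun y => \1_I y : R).
  apply: (@bmeasI _ _ _ W _ 1); first exact: measurable_indic.
  by move=> y _; rewrite indicE; case: (_ \in _); rewrite ?normr1 // normr0.
have IW : S `&` I = I `&` W.
  apply/seteqP; split => y; rewrite /I /W /window /= !in_itv /=.
    by move=> [Sy /andP[h1 h2]]; split; [rewrite h1|split => //; lra].
  by move=> [h1 [Sy _]].
exists (\int[greenoo]_(y in W) (\1_I y : R)).
  rewrite bRint_EFin // integral_indic // renewal_measureE greenoo_states_I //.
  by rewrite IW.
set r := \int[_]_(_ in _) _.
have bt (k : nat) (c : R) : bmeas W (fun y : R => tent dl (y - x - c + k%:R * dl)).
  rewrite (_ : (fun y : R => _) = (fun y : R => tent dl (y - (x + c - k%:R * dl)))).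
    exact: (bmeas_tent_at dl0).
  by apply/funext => y; congr tent; ring.
have jN (j : nat) : (j < N.+2)%N -> 0 <= j%:R * dl <= h.
  rewrite ltnS => jN; rewrite -dlN ler_pM2r // ler_nat jN andbT.
  by rewrite mulr_ge0 // ltW.
have TG n k : (k <= n)%N -> (n < N.+2)%N ->
    \int[greenoo]_(y in W) tent dl (y - x - n%:R * dl + k%:R * dl) =
    tent_green S X dl (x + (n - k)%N%:R * dl).
  move=> kn nN; have /andP[j0 j1] := jN (n - k)%N (leq_ltn_trans (leq_subr _ _) nN).
  have dlh : dl <= h by rewrite -dlN ler_peMl ?ltW // ltr1n.
  rewrite (@tent_green_window _ _ _ _ S X dl dl0 x (3 * h)); [|lra|lra].
  by apply: eq_Rintegral => y _; congr tent; rewrite natrB //; ring.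
have near n k : (k <= n)%N -> (n < N.+2)%N ->
    dl - a / 2 / N.+2%:R <= v x * tent_green S X dl (x + (n - k)%N%:R * dl)
     <= dl + a / 2 / N.+2%:R.
  move=> kn nN; have := hB1 (n - k)%N x (leq_ltn_trans (leq_subr _ _) nN) x1.
  by rewrite ler_distl.
have upper : r <= \sum_(k < N.+2) tent_green S X dl (x + (N.+1 - k)%N%:R * dl).
  apply: (@le_trans _ _ (\int[greenoo]_(y in W) \sum_(k < N.+2) tent dl (y - x - N.+1%:R * dl + k%:R * dl))).
    apply: le_bRint => //; first exact: (@bmeas_sum _ _ _ W N.+2 (fun (k : nat) (y : R) => tent dl (y - x - N.+1%:R * dl + k%:R * dl)) (fun k => bt k _)).
    move=> y _; rewrite indicE; case: (boolP (y \in I)) => [|_]; last first.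
      by apply: sumr_ge0 => k _; case/andP: (tent_itv dl0 (y - x - N.+1%:R * dl + k%:R * dl)).
    rewrite inE /I /= in_itv /= => /andP[h1 h2].
    by rewrite (tents_above dl0 (n := N.+1)) ?subr_gt0 // dlN lerBlDl.
  rewrite (@bRint_sum _ _ _ greenoo W N.+2 (fun (k : nat) (y : R) => tent dl (y - x - N.+1%:R * dl + k%:R * dl))) //.
  by apply: ler_sum => k _; rewrite TG // -ltnS.
have lower : \sum_(k < N) tent_green S X dl (x + (N - k)%N%:R * dl) <= r.
  apply: (@le_trans _ _ (\int[greenoo]_(y in W) \sum_(k < N) tent dl (y - x - N%:R * dl + k%:R * dl))).
    rewrite (@bRint_sum _ _ _ greenoo W N (fun (k : nat) (y : R) => tent dl (y - x - N%:R * dl + k%:R * dl))) //.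
    by apply: ler_sum => k _; rewrite TG // ltnW.
  apply: le_bRint => //; first exact: (@bmeas_sum _ _ _ W N (fun (k : nat) (y : R) => tent dl (y - x - N%:R * dl + k%:R * dl)) (fun k => bt k _)).
  move=> y _; apply: le_trans (tents_below dl0 N (y - x)) _; rewrite dlN indicE.
  rewrite (_ : (y \in I) = (0 < y - x) && (y - x <= h)); first by case: (_ && _).
  by apply/idP/idP; rewrite inE /I /= in_itv /= subr_gt0 lerBlDl.
have sc n (c : R) : n%:R * c = \sum_(i < n) c by rewrite sumr_const card_ord mulr_natl.
have up2 : v x * r <= N.+2%:R * (dl + a / 2 / N.+2%:R).
  apply: le_trans (ler_wpM2l (ltW vx) upper) _; rewrite mulr_sumr sc.
  by apply: ler_sum => k _; have /andP[] := near N.+1 k (ltn_ord k) (ltnSn _).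
have lo2 : N%:R * (dl - a / 2 / N.+2%:R) <= v x * r.
  apply: le_trans (ler_wpM2l (ltW vx) lower); rewrite mulr_sumr sc.
  apply: ler_sum => k _.
  by have /andP[] := near N k (ltnW (ltn_ord k)) (ltnW (ltnSn _)).
have q1 : N.+2%:R * (a / 2 / N.+2%:R) = a / 2 by field; rewrite gt_eqF.
have q2 : N%:R * (a / 2 / N.+2%:R) <= a / 2.
  rewrite -[leRHS]q1; apply: ler_wpM2r; first exact: ltW.
  by rewrite ler_nat; exact: (leq_trans (leqnSn N) (leqnSn _)).
rewrite mulrDr q1 in up2; rewrite mulrBr in lo2.
rewrite -[N.+2%:R]natr1 mulrDl mul1r dlN in up2.
have dlN2 : N%:R * dl = h - dl by rewrite -dlN -natr1; ring.
by rewrite dlN2 in lo2; exact: (sandwich_arith dla q2 up2 lo2).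
Qed.

Lemma renewal_atom x : (forall n w, X n w \is a Num.int) -> x \is a Num.int ->
  renewal_measure X [set x] = (\int[greenoo]_(y in S) (tent 1 (y - x))%:E)%E.
Proof.
move=> hint hx; rewrite -(greenoo_integral_states hX H); last 2 first.
- exact: measurable_tentR.
- by move=> y; rewrite lee_fin; case/andP: (tent_itv ltr01 (y - x)).
rewrite greenooE //; last 2 first.
- exact: measurable_tentR.
- by move=> y _; rewrite lee_fin; case/andP: (tent_itv ltr01 (y - x)).
apply: eq_eseriesr => n _; rewrite /law ge0_integral_pushforward //; last 2 first.
- exact: measurable_tentR.
- by move=> y _; rewrite lee_fin; case/andP: (tent_itv ltr01 (y - x)).
have mA : measurable (X n @^-1` [set x]).
  by rewrite -[X in measurable X]setTI; exact: measurable_funP.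
rewrite -[in LHS](setIT (X n @^-1` _)) -integral_indic //.
apply: eq_integral => w _; rewrite indicE /=; congr (_%:E).
case: (boolP (w \in _)) => [|hw]; first by rewrite inE /= => ->; rewrite subrr /tent /pos normr0 mul0r subr0 max_r.
rewrite tent_out //; have /intrP[i hi] := hint n w; have /intrP[j hj] := hx.
rewrite hi hj -intrB -intr_norm -[1]/(1%:~R) ler_int -gtz0_ge1 normr_gt0 subr_eq0.
by apply/eqP => ij; move: hw; rewrite notin_setE /= hi hj ij; apply.
Qed.

End LocalRenewal.

Theorem corollary7 (R : realType)
  (d : measure_display) (Omega : measurableType d) (P : probability Omega R)
  (S : set R) (Q : R.-pker R ~> R) (X : nat -> {RV P >-> R})
  (d1 : measure_display) (T1 : measurableType d1) (P1 : probability T1 R)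
  (xihat : {RV P1 >-> R})
  (d2 : measure_display) (T2 : measurableType d2) (P2 : probability T2 R)
  (xi : {RV P2 >-> R})
  (d3 : measure_display) (T3 : measurableType d3) (P3 : probability T3 R)
  (Xi : {RV P3 >-> R})
  (v s p : R -> R) (b : R)
  (hX : markov_chain S Q X)
  (hlimsup : {ae P, forall w, limn_esup (fun n => (X n w)%:E) = +oo%E})
  (v_gt0 : {in `[0, +oo[, forall x, 0 < v x})
  (v_decr : {in `[0, +oo[ &, {homo v : x y /~ x <= y}})
  (v_diff : {in `]0, +oo[, forall x, derivable v x 1})
  (xv_infty : x * v x @[x --> +oo] --> +oo)
  (v'_o : derive1 v =o_ +oo (fun x => v x ^+ 2))
  (b_gt0 : 0 < b)
  (s_gt0 : {in `[0, +oo[, forall x, 0 < s x})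
  (s_incr : {in `[0, +oo[ &, {homo s : x y / x <= y}})
  (s_o : s =o_ +oo (fun x => (v x)^-1))
  (hm1 : truncated_moment Q 1 (s x) x / v x @[x --> pinfty_in S] --> (1 : R))
  (hm2 : truncated_moment Q 2 (s x) x @[x --> pinfty_in S] --> b)
  (p_ge0 : {in `[0, +oo[, forall y, 0 <= p y})
  (p_nonincr : {in `[0, +oo[ &, {homo p : x y /~ x <= y}})
  (p_int : integrable_at_infinity p)
  (htail : forall y, S y -> 0 <= y ->
    (Q y [set z | s y <= `|jump y z|]%R <= (p y * v y)%:E)%E)
  (xihat_2 : ('E_P1[(fun w => xihat w ^+ 2)%R] < +oo)%E)
  (hxihat : forall y, S y -> 0 <= y ->
    st_le (Q y)
      (fun z => `|jump y z| * \1_[set u | `|jump y u| < s y] z) P1 xihat)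
  (hxi : jump_cvg_in_distribution S Q xi)
  (Xi_1 : ('E_P3[Xi] < +oo)%E)
  (hXi : forall x, S x -> st_le (Q x) (fun z => `|jump x z|) P3 Xi) :
  (non_lattice xi ->
    forall h : R, 0 < h ->
      (renewal_measure X `]x, (x + h)%R] / (h / v x)%:E)%E @[x --> +oo] --> 1%E)
  /\
  ((forall n w, X n w \is a Num.int) ->
    minimal_lattice xi 1 ->
    (renewal_measure X [set k%:R] / (v k%:R)^-1%:E)%E @[k --> \oo] --> 1%E).
Proof.
have mS : measurable S by case: hX.
have H := setting mS v_gt0 v_decr b_gt0 s_gt0 s_incr p_ge0 p_nonincr htail xihat_2 hxihat.
have good_ex e : 0 < e -> _ := @good_exists _ _ _ _ _ _ _ _ _ _ _ v_gt0 v_diff v'_o s_gt0 s_incr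
  s_o hm1 hm2 p_ge0 p_nonincr p_int htail xihat_2 hxihat e.
(* Read off from L * v A <= e with L >= 1 and e = a. *)
have vinf (a : R) : 0 < a -> exists B, forall x, B <= x -> v x <= a.
  move=> a0; have [L0 hL0] := good_ex a a0; have [A0 hA0] := hL0 _ (lexx _).
  have hg := hA0 _ (lexx _); exists A0 => x Ax.
  have A00 := good_A hg; have L1 := good_L hg; have vA := ds_v H A00.
  have := ds_vdecr H A00 Ax; have := good_Lv hg.
  have : v A0 <= L0 * v A0 by rewrite ler_peMl // ltW.
  lra.
have avg dl : 0 < dl -> exists2 C, 0 <= C & averaged xi (fun x => v x * tent_green S X dl x) C.
  by move=> dl0; have [] := tent_green_facts hX H good_ex vinf hxi dl0.
split.
  move=> nl h h0; apply: ratio_limit => a a0.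
  have fl dl : 0 < dl -> flat_at (fun x => v x * tent_green S X dl x) dl.
    by move=> dl0; have [C C0 hC] := avg dl dl0; exact: (non_lattice_flat C0 hC _ nl).
  (* The absolute accuracy a * h becomes the relative accuracy a after division by h. *)
  have [B hB] := renewal_interval hX H good_ex hlimsup vinf hxi h0 (mulr_gt0 a0 h0) fl.
  exists (Num.max B 0); split; first exact: num_real.
  move=> x; rewrite gt_max => /andP[/ltW xB /ltW x0].
  have vx := ds_v H x0; have [r rE hr] := hB x xB.
  split; first exact: divr_gt0.
  exists r => //; rewrite -(ler_pM2r h0) -[X in _ * X]gtr0_norm // -normrM.
  by rewrite (_ : _ * h = v x * r - h) //; field; rewrite !gt_eqF.
move=> hint ml; apply: ratio_limit => a a0.
have [C C0 hC] := avg 1 ltr01.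
have fl := minimal_lattice_flat C0 hC ml.
have [B hB] := tent_green_limit hX H good_ex hlimsup vinf hxi ltr01 fl a0.
have [_ _ hfin] := tent_green_facts hX H good_ex vinf hxi ltr01.
(* The tent of half-width 1 at k lives in the window of radius 1, whose finite mass makes the real
   integral agree with the extended one. *)
have [B' hB'] := hfin 1 ler01.
exists (Num.truncn (Num.max B B')).+1 => // k kN.
have : Num.max B B' <= k%:R.
  by apply: le_trans (ltW (truncnS_gt _)) _; rewrite ler_nat.
rewrite ge_max => /andP[kB kB'].
have vk : 0 < v k%:R by exact: (ds_v H).
split; first by rewrite invr_gt0.
exists (tent_green S X 1 k%:R); last by rewrite invrK mulrC; exact: hB.
rewrite (renewal_atom hX H hint) ?natr_int // (@tent_green_window _ _ _ _ S X 1 ltr01 k%:R 1) //.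
rewrite bRint_EFin //; [|exact: (measurable_window H)|exact: hB'|exact: (bmeas_tent_at ltr01)].
rewrite [LHS]integral_mkcond [RHS]integral_mkcond; apply: eq_integral => y _.
rewrite /patch; case: (boolP (y \in S)) => [/set_mem Sy|/negP nSy]; last first.
  by rewrite memNset // => -[/mem_set].
case: ifPn => // /negP nw; rewrite tent_out // leNgt; apply/negP.
rewrite ltr_norml => /andP[h3 h4]; apply: nw; rewrite inE; split => //=.
by rewrite in_itv /=; lra.
Qed.
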